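(* Let $X\neq\{0\}$ be a complex Banach space with open unit ball $\mathbb{B}$ and let $\frac12\le\lambda\le 1$. Let $g:\mathbb{B}\to\mathbb{C}$ be holomorphic with $g(0)=1$, define $F(x)=g(x)x$ for $x\in\mathbb{B}$, and suppose that $F\in\widehat{\mathcal{F}}_{\lambda}(\mathbb{B})$. Then for every $x_0\in X$ with $\|x_0\|=1$ (and every $T_{x_0}\in T(x_0)$), $$|T_3(1)(F)|\le\frac{(4+3\lambda+2\lambda^2)(7+6\lambda+8\lambda^2)}{18}$$ and $$|T_3(2)(F)|\le\frac{1}{864}(1+2\lambda)^3(9+5\lambda+2\lambda^2)(25+17\lambda+10\lambda^2).$$ The inequalities are sharp: for every $\lambda\in[\frac12,1]$ and for each of the two inequalities there exist such an $F$, $x_0$ and $T_{x_0}$ for which equality holds.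
   Context: $X$ is a complex Banach space with norm $\|\cdot\|$ and $\mathbb{B}=\{x\in X:\|x\|<1\}$. For $x\in X\setminus\{0\}$, $T(x)$ is the set of bounded linear functionals $T_x:X\to\mathbb{C}$ with $T_x(x)=\|x\|$ and $\|T_x\|=1$. $D^nF(x)$ denotes the $n$th Fréchet derivative of $F$ at $x$ (a bounded symmetric $n$-linear map $X^n\to X$). A holomorphic map $F:\mathbb{B}\to X$ is normalized if $F(0)=0$ and $DF(0)=I$; it is locally biholomorphic if $DF(x)$ is invertible with bounded inverse for every $x\in\mathbb{B}$. For $\frac12\le\lambda\le1$, $\widehat{\mathcal{F}}_{\lambda}(\mathbb{B})$ is the class of normalized locally biholomorphic maps $F:\mathbb{B}\to X$ such that $$\operatorname{Re}\left\{T_x\left(\frac{(DF(x))^{-1}\bigl(D^2F(x)(x,x)+DF(x)x\bigr)}{\|x\|}\right)\right\}\ge\frac12-\lambda$$ for every $x\in\mathbb{B}\setminus\{0\}$ and every $T_x\in T(x)$. For $\|x_0\|=1$ and $T_{x_0}\in T(x_0)$, put $A_n=\frac{1}{n!}T_{x_0}\bigl(D^nF(0)(x_0,\ldots,x_0)\bigr)$ for $n=2,3,4$, and define the Toeplitz determinants $$T_3(1)(F)=\begin{vmatrix} 1 & A_2 & A_3 \\ {A_2} & 1 & A_2 \\ {A_3} & A_2 & 1 \end{vmatrix},\qquad T_3(2)(F)=\begin{vmatrix} A_2 & A_3 & A_4 \\ {A_3} & A_2 & A_3 \\ {A_4} & A_3 & A_2 \end{vmatrix}.$$ *)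

(* Defs.v *)
From HB Require Import structures.
From mathcomp Require Import all_boot all_order all_algebra.
From mathcomp Require Import all_classical all_reals all_analysis.
From mathcomp Require Import complex.
Set Implicit Arguments.
Unset Strict Implicit.
Unset Printing Implicit Defensive.
Import Order.TTheory GRing.Theory Num.Theory.
Import numFieldNormedType.Exports.
Local Open Scope classical_set_scope.
Local Open Scope ring_scope.
Local Open Scope complex_scope.

Section BoundedLinear.
Variables (R : realType) (V W : normedModType R[i]).

Definition bounded_linear : {pred V -> W} :=
  fun f => `[< linear f /\ continuous f >].

Lemma bounded_linear_submod_closed : submod_closed bounded_linear.
Proof.
split=> [|a f g /asboolP[fl fc] /asboolP[gl gc]]; apply/asboolP; split.
- by move=> a u v; rewrite -[LHS]/(0 : W) -[RHS]/(a *: 0 + 0 : W) scaler0 addr0.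
- exact: cst_continuous.
- move=> b u v; rewrite -[LHS]/(a *: f _ + g _) fl gl !scalerDr !scalerA.
  by rewrite (mulrC a b) addrACA -!scalerA -scalerDr.
- by move=> x; apply: cvgD; [apply: cvgZr; exact: fc | exact: gc].
Qed.

HB.instance Definition _ :=
  GRing.isSubmodClosed.Build R[i] (V -> W) bounded_linear
    bounded_linear_submod_closed.

Record blin := Blin { blin_fun :> V -> W ; _ : blin_fun \in bounded_linear }.

HB.instance Definition _ := [isSub for blin_fun].
HB.instance Definition _ := [Choice of blin by <:].
HB.instance Definition _ := [SubChoice_isSubLmodule of blin by <:].

Lemma blin_linear (f : blin) : linear f.
Proof. by case: f => f /= /asboolP[]. Qed.

Lemma blin_continuous (f : blin) : continuous f.
Proof. by case: f => f /= /asboolP[]. Qed.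

HB.instance Definition _ (f : blin) :=
  GRing.isLinear.Build R[i] V W *:%R f (blin_linear f).

(* The norms of [V] and [W] take their values in [R[i]]; the supremum has to be
   taken in [R]. *)
Definition opnorm (f : blin) : R :=
  sup [set complex.Re `|f x| | x in [set x : V | `|x| <= 1]].

Lemma Re_normE (U : normedModType R[i]) (x : U) : (complex.Re `|x|)%:C = `|x|.
Proof. by rewrite RRe_real// normr_real. Qed.

Lemma opnorm_has_sup (f : blin) :
  has_sup [set complex.Re `|f x| | x in [set x : V | `|x| <= 1]].
Proof.
split; first by exists (complex.Re `|f 0|), 0; rewrite //= normr0.
have bf : bounded_near f (nbhs (0 : V)).
  exact/linear_bounded_continuous/blin_continuous.
have [M fM] := (bounded_funP f).2 bf 1.
exists (complex.Re M) => _ [x /= x1 <-].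
by have := fM x x1; rewrite lecE => /andP[].
Qed.

Lemma opnorm_ub (f : blin) x : `|x| <= 1 -> complex.Re `|f x| <= opnorm f.
Proof. by move=> x1; apply: sup_upper_bound (opnorm_has_sup f) _ _; exists x. Qed.

Lemma opnorm_ge0 (f : blin) : 0 <= opnorm f.
Proof.
have f0 : 0 <= complex.Re `|f 0| by rewrite -lecR Re_normE normr_ge0.
by apply: le_trans f0 _; apply: opnorm_ub; rewrite normr0 ler01.
Qed.

Lemma opnorm_le (f : blin) (M : R) :
  (forall x, `|x| <= 1 -> `|f x| <= M%:C) -> opnorm f <= M.
Proof.
move=> fM; apply: ge_sup; first by case: (opnorm_has_sup f).
by move=> _ [x /= /fM fx <-]; rewrite -lecR Re_normE.
Qed.

Lemma opnorm_apply (f : blin) x : `|f x| <= (opnorm f)%:C * `|x|.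
Proof.
have [->|x0] := eqVneq x 0; first by rewrite linear0 !normr0 mulr0.
have nx : 0 < `|x| by rewrite normr_gt0.
have : `| `|x|^-1 *: x| <= 1.
  by rewrite normrZ normfV normr_id mulVf ?gt_eqF.
move=> /(@opnorm_ub f); rewrite -lecR Re_normE linearZ normrZ normfV normr_id.
by rewrite ler_pdivrMl// mulrC.
Qed.

Lemma ler_opnormD (f g : blin) :
  (opnorm (f + g))%:C <= (opnorm f)%:C + (opnorm g)%:C.
Proof.
rewrite -rmorphD lecR; apply: opnorm_le => x x1.
rewrite rmorphD (le_trans (ler_normD _ _))// lerD//.
  by rewrite -Re_normE lecR opnorm_ub.
by rewrite -Re_normE lecR opnorm_ub.
Qed.

Lemma opnormZ (l : R[i]) (f : blin) :
  (opnorm (l *: f))%:C = `|l| * (opnorm f)%:C.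
Proof.
have H (a : R[i]) h : (opnorm (a *: h))%:C <= `|a| * (opnorm h)%:C.
  rewrite -(Re_normE (a : R[i]^o)) -rmorphM lecR; apply: opnorm_le => x x1.
  rewrite rmorphM /= (Re_normE (a : R[i]^o)).
  rewrite -[leLHS]/(`|a *: h x|) normrZ ler_wpM2l//.
  by rewrite -Re_normE lecR opnorm_ub.
apply/eqP; rewrite eq_le H /=.
have [->|l0] := eqVneq l 0; first by rewrite normr0 mul0r lecR opnorm_ge0.
have := H l^-1 (l *: f); rewrite scalerA mulVf// scale1r normfV.
by rewrite ler_pdivlMl ?normr_gt0.
Qed.

Lemma opnorm0_eq0 (f : blin) : (opnorm f)%:C = 0 -> f = 0.
Proof.
move=> f0; apply/val_inj/funext => x; apply/eqP.
by rewrite -[_ == _]/(f x == 0) -normr_le0 (le_trans (opnorm_apply _ _))// f0 mul0r.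
Qed.

HB.instance Definition _ :=
  Lmodule_isNormed.Build R[i] blin ler_opnormD opnormZ opnorm0_eq0.

End BoundedLinear.

Notation "''L(' V , W )" := (blin V W) (format "''L(' V ,  W )").

Section FrechetDerivatives.
Variables (R : realType) (X Y : normedModType R[i]).

(* [mlin n] is 'L(X, 'L(X, ... 'L(X, Y))), the space of bounded [n]-linear maps
   from [X] to [Y]; its operator norm is the usual norm of multilinear maps. *)
Fixpoint mlin (n : nat) : normedModType R[i] :=
  if n is n'.+1 then 'L(X, mlin n') : normedModType R[i] else Y.

Fixpoint mlin_diag (n : nat) (x : X) : mlin n -> Y :=
  if n is n'.+1 return mlin n -> Y
  then fun u => mlin_diag x ((u : 'L(X, mlin n')) x)
  else id.

(* The derivative is taken in the operator norm at every order. [insubd] is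
   harmless at a point where the map is differentiable, its differential being
   continuous there. *)
Fixpoint frechet (n : nat) (F : X -> Y) : X -> mlin n :=
  if n is n'.+1 return X -> mlin n
  then fun x => insubd (0 : 'L(X, mlin n')) ('d (frechet n' F) x : X -> mlin n')
  else F.

End FrechetDerivatives.

Section BoundedInverse.
Variables (R : realType) (V W : normedModType R[i]).

Definition is_binv (A : 'L(V, W)) (S : 'L(W, V)) := cancel A S /\ cancel S A.

Definition binvertible (A : 'L(V, W)) := exists S, is_binv A S.

Definition binv (A : 'L(V, W)) : 'L(W, V) := xget 0 [set S | is_binv A S].

End BoundedInverse.

Section Classes.
Variables (R : realType) (X : normedModType R[i]).

(* Maps on the unit ball are total functions on [X]; the ball being open, their
   values outside of it are irrelevant to everything below. *)
Definition unit_ball : set X := [set x | `|x| < 1].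

Definition support_functionals (x : X) : set 'L(X, R[i]^o) :=
  [set T : 'L(X, R[i]^o) | T x = `|x| /\ `|T| = 1].

Definition holomorphic (Y : normedModType R[i]) (D : set X) (F : X -> Y) :=
  forall x, D x -> differentiable F x.

Definition normalized (F : X -> X) :=
  F 0 = 0 /\ forall v, (frechet 1 F 0 : 'L(X, X)) v = v.

Definition locally_biholomorphic (F : X -> X) :=
  holomorphic unit_ball F /\
  forall x, unit_ball x -> binvertible (frechet 1 F x : 'L(X, X)).

Definition Fhat (lam : R) (F : X -> X) :=
  [/\ normalized F, locally_biholomorphic F &
      forall (x : X) (T : 'L(X, R[i]^o)),
        unit_ball x -> x != 0 -> support_functionals x T ->
        2^-1 - lam <=
        complex.Re (T (`|x|^-1 *:
          binv (frechet 1 F x : 'L(X, X))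
            (mlin_diag x (frechet 2 F x) + mlin_diag x (frechet 1 F x))))].

Definition coefA (F : X -> X) (x0 : X) (T : 'L(X, R[i]^o)) (n : nat) : R[i] :=
  (n`!)%:R^-1 * T (mlin_diag x0 (frechet n F 0)).

Definition sym_toeplitz3 (a b c : R[i]) : 'M[R[i]]_3 :=
  \matrix_(j < 3, k < 3) [:: a; b; c]`_`|j - k|%N.

Definition T31 F x0 T : R[i] :=
  \det (sym_toeplitz3 1 (coefA F x0 T 2) (coefA F x0 T 3)).

Definition T32 F x0 T : R[i] :=
  \det (sym_toeplitz3 (coefA F x0 T 2) (coefA F x0 T 3) (coefA F x0 T 4)).

Definition admissible (lam : R) (g : X -> R[i]^o) (F : X -> X)
    (x0 : X) (T : 'L(X, R[i]^o)) :=
  [/\ holomorphic unit_ball g, g 0 = 1,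
      forall x, unit_ball x -> F x = g x *: x, Fhat lam F &
      `|x0| = 1 /\ support_functionals x0 T].

End Classes.

(* Main.v *)
(* On the slice through x0 a map F(x) = g(x) x is F(z x0) = f(z) x0, and membership in
   the class says that p = (z f''/f' + c) / c, with c = lam + 1/2, has nonnegative real
   part and p(0) = 1. Writing 2 q_k for the coefficients of p, those of f are A_2 = c q_1,
   A_3 = c (q_2 + 2 c q_1^2) / 3 and A_4 = c (q_3 + 3 c q_1 q_2 + 2 c^2 q_1^3) / 6, while
   T_3(1) = (1 - A_3) (1 + A_3 - 2 A_2^2) and
   T_3(2) = (A_2 - A_4) (A_2^2 + A_2 A_4 - 2 A_3^2). The factors are estimated by means of
   |q_k| <= 1, |q_2 - q_1^2| <= 1 - |q_1|^2 and
   |q_3 - q_1 q_2|^2 <= (1 - |q_1|^2) (1 - |q_2|^2), which are minors of the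
   Caratheodory-Toeplitz form. Equality holds for F(x) = f(T x) / (T x) x, where
   f' = (1 - i z)^(-2c) and T is a support functional.

   Differentiability once on the ball is all that is assumed, so the existence of the
   higher derivatives (in the operator norm) needs Cauchy's estimate for maps into a
   Banach space; it is obtained from Riemann sums over circles. *)

Require Import Defs.
From HB Require Import structures.
From mathcomp Require Import all_boot all_order all_algebra.
From mathcomp Require Import all_classical all_reals all_analysis.
From mathcomp Require Import complex ring lra.
Import Order.TTheory GRing.Theory Num.Theory.
Import numFieldNormedType.Exports.
Local Open Scope classical_set_scope.
Local Open Scope ring_scope.
Local Open Scope complex_scope.
Set Implicit Arguments.
Unset Strict Implicit.
Unset Printing Implicit Defensive.

(** Both bounds are attained at q_k = i^k, that is, for p(z) = (1 + i z) / (1 - i z): among the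
    rotations q_k = u^k, every factor of the two determinants is largest in modulus for u^2 = -1,
    which is why the extremal function carries i. At that point some terms of a factor oppose each
    other: q_2 against 4 c q_1^2 in 1 + A_3 - 2 A_2^2 = 1 + c (q_2 - 4 c q_1^2) / 3, and 3 q_1 q_3
    against 4 q_2^2 in the second factor of T_3(2). The triangle inequality with |q_k| <= 1 alone
    would add what has to be subtracted. These terms are therefore regrouped around q_2 - q_1^2 and
    q_3 - q_1 q_2, which vanish at the extremum. The minors bound them by multiples of 1 - |q_1|^2,
    a loss that is repaid by the terms in higher powers of q_1, whose coefficients are large because
    c >= 1. *)

(* The norm of [W] takes its values in [R[i]]; [nm] is the same norm with real values. *)
Definition nm (R : realType) (W : normedModType R[i]) (x : W) : R := complex.Re `|x|.

(** * Real-valued norms and the complex modulus *)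

Section RealNorm.
Variables (R : realType) (V : normedModType R[i]).
Local Notation C := (R[i]^o).

Lemma nmE (x : V) : (nm x)%:C = `|x|. Proof. exact: Re_normE. Qed.

Lemma nm_ge0 (x : V) : 0 <= nm x.
Proof. by rewrite -lecR nmE normr_ge0. Qed.

Lemma nm0 : nm (0 : V) = 0.
Proof. by rewrite /nm normr0. Qed.

Lemma nm_eq0 (x : V) : nm x = 0 -> x = 0.
Proof. by move=> h; apply/eqP; rewrite -normr_eq0 -nmE h. Qed.

Lemma nmN (x : V) : nm (- x) = nm x.
Proof. by rewrite /nm normrN. Qed.

Lemma nmD (x y : V) : nm (x + y) <= nm x + nm y.
Proof. by rewrite -lecR rmorphD /= !nmE ler_normD. Qed.

Lemma nmB (x y : V) : nm (x - y) <= nm x + nm y.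
Proof. by rewrite -(nmN y) nmD. Qed.

Lemma nm_distC (x y : V) : nm (x - y) = nm (y - x).
Proof. by rewrite -nmN opprB. Qed.

Lemma nmZ (a : C) (x : V) : nm ((a : R[i]) *: x) = nm a * nm x.
Proof. by apply: complexI; rewrite rmorphM /= !nmE Re_normE normrZ. Qed.

Lemma nm_gt0 (x : V) : x != 0 -> 0 < nm x.
Proof. by move=> x0; rewrite -ltcR nmE normr_gt0. Qed.

End RealNorm.

Section Modulus.
Variable R : realType.
Local Notation C := (R[i]^o).

Lemma cnmE (z : C) : (nm z)%:C = `|z : R[i]|. Proof. exact: Re_normE. Qed.

Lemma nmM (z w : C) : nm ((z : R[i]) * w : C) = nm z * nm w.
Proof. by apply: complexI; rewrite rmorphM /= !cnmE normrM. Qed.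

Lemma nmV (z : C) : nm ((z : R[i])^-1 : C) = (nm z)^-1.
Proof. by apply: complexI; rewrite fmorphV /= !cnmE normfV. Qed.

Lemma nm_real (t : R) : nm (t%:C : C) = `|t|.
Proof. by apply: complexI; rewrite cnmE normc_def /= expr0n addr0 sqrtr_sqr. Qed.

Lemma nm1 : nm (1 : C) = 1.
Proof. by apply: complexI; rewrite cnmE normr1. Qed.

Lemma nm_Re (z : C) : `|complex.Re z| <= nm z.
Proof. by rewrite -lecR cnmE normc_ge_Re. Qed.

Lemma nm_Im (z : C) : `|complex.Im z| <= nm z.
Proof.
rewrite -lecR cnmE normc_def lecR -sqrtr_sqr ler_sqrt ?addr_ge0 ?sqr_ge0//.
by rewrite lerDr sqr_ge0.
Qed.

Lemma nm_ReIm (z : C) : nm z <= `|complex.Re z| + `|complex.Im z|.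
Proof.
rewrite -lecR cnmE normc_def lecR -[leRHS]ger0_norm ?addr_ge0//.
rewrite -[leRHS]sqrtr_sqr ler_sqrt ?sqr_ge0//.
rewrite sqrrD !real_normK ?num_real// -addrA [X in _ <= _ + X]addrC addrA.
by rewrite lerDl mulrn_wge0// mulr_ge0.
Qed.

Lemma nm_nat (n : nat) : nm (n%:R : C) = n%:R.
Proof. by apply: complexI; rewrite cnmE normr_nat rmorph_nat. Qed.

End Modulus.

(** * Dyadic bisection of the unit square *)

Section Bisection.
Variable R : realType.

Definition dy (n : nat) : R := 2^-1 ^+ n.

Lemma dy_gt0 n : 0 < dy n.
Proof. by rewrite exprn_gt0// invr_gt0. Qed.

Lemma dyS n : dy n = dy n.+1 + dy n.+1.
Proof. by rewrite /dy exprS; lra. Qed.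

Lemma dy_small (d : R) : 0 < d -> exists n, dy n < d.
Proof.
move=> d0; have [n hn] : exists n : nat, d^-1 < n%:R.
  by exists (Num.bound d^-1); apply: archi_boundP; rewrite invr_ge0 ltW.
exists n; rewrite /dy exprVn -(invrK d) ltf_pV2 ?posrE ?invr_gt0 ?exprn_gt0//.
apply: lt_le_trans hn _; rewrite -natrX ler_nat.
exact: ltnW (ltn_expl _ _).
Qed.

(** Compactness of the unit square by nested squares: if [P] failed on the whole square, it would
    fail on a sequence of nested quarters shrinking to a point, where the local hypothesis
    contradicts it. The small squares only have to contain the point, not to be centred there.
    One-dimensional arguments take a [P] that ignores [b]. *)
Lemma bisection (P : R -> R -> nat -> Prop) :
  (forall a b n, P a b n.+1 -> P (a + dy n.+1) b n.+1 ->
     P a (b + dy n.+1) n.+1 -> P (a + dy n.+1) (b + dy n.+1) n.+1 -> P a b n) ->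
  (forall s t, 0 <= s <= 1 -> 0 <= t <= 1 -> exists2 d : R, 0 < d &
     forall a b n, dy n < d -> 0 <= a -> a <= s <= a + dy n -> a + dy n <= 1 ->
       0 <= b -> b <= t <= b + dy n -> b + dy n <= 1 -> P a b n) ->
  P 0 0 0%N.
Proof.
move=> Pstep Ploc; apply: contrapT => P0.
have [c cP] : exists c : R * R -> nat -> R * R, forall x n,
  ~ P x.1 x.2 n -> [/\ ~ P (c x n).1 (c x n).2 n.+1,
     x.1 <= (c x n).1 <= x.1 + dy n.+1 & x.2 <= (c x n).2 <= x.2 + dy n.+1].
  have H (xn : (R * R) * nat) : exists y : R * R, ~ P xn.1.1 xn.1.2 xn.2 ->
     [/\ ~ P y.1 y.2 xn.2.+1,
     xn.1.1 <= y.1 <= xn.1.1 + dy xn.2.+1 & xn.1.2 <= y.2 <= xn.1.2 + dy xn.2.+1].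
    case: xn => -[a b] n /=; have d0 := dy_gt0 n.+1.
    have [?|nP] := pselect (P a b n); first by exists (a, b).
    have [h1|n1] := pselect (P a b n.+1); last first.
      by exists (a, b) => _; split=> //=; rewrite lexx lerDl ltW.
    have [h2|n2] := pselect (P (a + dy n.+1) b n.+1); last first.
      by exists (a + dy n.+1, b) => _; split=> //=; rewrite lexx lerDl ltW.
    have [h3|n3] := pselect (P a (b + dy n.+1) n.+1); last first.
      by exists (a, b + dy n.+1) => _; split=> //=; rewrite lexx lerDl ltW.
    exists (a + dy n.+1, b + dy n.+1) => _; split=> /=; last 2 first.
    - by rewrite lexx lerDl ltW.
    - by rewrite lexx lerDl ltW.
    by move=> h4; apply: nP; apply: Pstep.
  have [c cP] := choice H.
  by exists (fun x n => c (x, n)) => x n; apply: (cP (x, n)).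
pose x := fix x n := if n is n'.+1 then c (x n') n' else (0, 0) : R * R.
have xP n : ~ P (x n).1 (x n).2 n.
  by elim: n => [//|n /cP[]].
have xS n : [/\ (x n).1 <= (x n.+1).1 <= (x n).1 + dy n.+1
   & (x n).2 <= (x n.+1).2 <= (x n).2 + dy n.+1].
  by have [_] := cP _ _ (xP n).
(* Left ends increase and right ends decrease, so the supremum of the left ends lies in all the
   nested intervals. *)
have lim (u : nat -> R) : u 0%N = 0 -> (forall n, u n <= u n.+1 <= u n + dy n.+1) ->
    exists s, 0 <= s <= 1 /\ forall n, [/\ 0 <= u n, u n <= s <= u n + dy n & u n + dy n <= 1].
  move=> u0 uS.
  have mono m k : u m <= u (m + k)%N /\ u (m + k)%N + dy (m + k) <= u m + dy m.
    elim: k => [|k [h1 h2]]; first by rewrite addn0.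
    have /andP[h3 h4] := uS (m + k)%N; have := dyS (m + k).
    by rewrite addnS; lra.
  have mn m n : u m <= u n + dy n.
    have [/subnKC <-|/ltnW/subnKC <-] := leqP m n.
      have [h _] := mono m (n - m)%N; apply: (le_trans h).
      by rewrite lerDl ltW ?dy_gt0.
    have [h h'] := mono n (m - n)%N; have := dy_gt0 (n + (m - n)); lra.
  have hs : has_sup (range u).
    by split; [exists (u 0%N), 0%N | exists (u 0%N + dy 0) => _ [m _ <-]].
  have us n : u n <= sup (range u) by apply: sup_upper_bound hs _ _; exists n.
  have su n : sup (range u) <= u n + dy n.
    by apply: ge_sup => [|_ [m _ <-]//]; case: hs.
  have d1 : dy 0 = 1 by rewrite /dy expr0.
  exists (sup (range u)); split.
    by rewrite -{1}u0 us/= (le_trans (su 0%N))// u0 d1 add0r.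
  move=> n; have [h1 h2] := mono 0%N n; rewrite add0n u0 d1 in h1 h2.
  by rewrite h1 us su; split=> //; lra.
have [//|//|s [s01 sP]] := lim (fun n => (x n).1); first by move=> n; case: (xS n).
have [//|//|t [t01 tP]] := lim (fun n => (x n).2); first by move=> n; case: (xS n).
have [d d0 dP] := Ploc s t s01 t01.
have [n nd] := dy_small d0.
apply: (xP n); have [? ? ?] := sP n; have [? ? ?] := tP n.
exact: dP.
Qed.

End Bisection.

(* The square-zero extension of a module embeds it in a commutative ring, where
   [ring] proves linear identities. *)
Section SquareZero.
Variables (K : comNzRingType) (V : lmodType K).

Definition sqz : Type := (K * V)%type.
HB.instance Definition _ := GRing.Zmodule.on sqz.

Definition sqz_mul (x y : sqz) : sqz := (x.1 * y.1, x.1 *: y.2 + y.1 *: x.2).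

Fact sqz_mulA : associative sqz_mul.
Proof.
move=> [a x] [b y] [c z]; rewrite /sqz_mul /= mulrA; congr pair.
by rewrite !scalerDr !scalerA -addrA (mulrC c b) (mulrC c a).
Qed.

Fact sqz_mulC : commutative sqz_mul.
Proof. by move=> [a x] [b y]; rewrite /sqz_mul /= mulrC addrC. Qed.

Fact sqz_mul1 : left_id ((1, 0) : sqz) sqz_mul.
Proof. by move=> [a x]; rewrite /sqz_mul /= mul1r scale1r scaler0 addr0. Qed.

Fact sqz_mulD : left_distributive sqz_mul +%R.
Proof.
move=> [a x] [b y] [c z]; rewrite /sqz_mul /=; congr pair; first exact: mulrDl.
by rewrite scalerDl scalerDr addrACA.
Qed.

Fact sqz_nz : ((1, 0) : sqz) != 0.
Proof. by apply/eqP => -[] /eqP; rewrite oner_eq0. Qed.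

HB.instance Definition _ := GRing.Zmodule_isComNzRing.Build sqz
  sqz_mulA sqz_mulC sqz_mul1 sqz_mulD sqz_nz.

Definition sqv (x : V) : sqz := (0, x).
Definition sqs (a : K) : sqz := (a, 0).

Lemma sqv_inj x y : sqv x = sqv y -> x = y. Proof. by case. Qed.
Lemma sqvD x y : sqv (x + y) = sqv x + sqv y.
Proof. by rewrite /sqv -[RHS]/(_, _) addr0. Qed.
Lemma sqvN x : sqv (- x) = - sqv x.
Proof. by rewrite /sqv -[RHS]/(_, _) oppr0. Qed.
Lemma sqv0 : sqv 0 = 0. Proof. by []. Qed.
Lemma sqvZ a x : sqv (a *: x) = sqs a * sqv x.
Proof. by rewrite /sqv /sqs -[RHS]/(_, _) /= mulr0 scale0r addr0. Qed.
Lemma sqsD a b : sqs (a + b) = sqs a + sqs b.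
Proof. by rewrite /sqs -[RHS]/(_, _) addr0. Qed.
Lemma sqsN a : sqs (- a) = - sqs a.
Proof. by rewrite /sqs -[RHS]/(_, _) oppr0. Qed.
Lemma sqs0 : sqs 0 = 0. Proof. by []. Qed.
Lemma sqs1 : sqs 1 = 1. Proof. by []. Qed.
Lemma sqsM a b : sqs (a * b) = sqs a * sqs b.
Proof. by rewrite /sqs -[RHS]/(_, _) /= !scaler0 addr0. Qed.

Definition sqzE := (sqvD, sqvN, sqv0, sqvZ, sqsD, sqsN, sqs0, sqs1, sqsM).
End SquareZero.

Ltac module := apply: sqv_inj; rewrite !sqzE; ring.

(** * Differentials and derivatives in epsilon-delta form *)

Section Differential.
Variable R : realType.
Local Notation C := (R[i]^o).
Implicit Types V W Z : normedModType R[i].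

(** [A] is a bare function: linearity and boundedness are asked for by the lemmas that use them, so
    derivatives can be computed before any element of ['L(V, W)] is built. *)
Definition dif V W (G : V -> W) (x : V) (A : V -> W) := forall e : R, 0 < e ->
  exists2 d : R, 0 < d & forall h, nm h < d -> nm (G (x + h) - G x - A h) <= e * nm h.

Definition der W (f : C -> W) (z : C) (d : W) := dif f z (fun h : C => (h : R[i]) *: d).

Definition continuous_at V W (G : V -> W) (x : V) := forall e : R, 0 < e ->
  exists2 d : R, 0 < d & forall h, nm h < d -> nm (G (x + h) - G x) <= e.

Definition bounded_at V W (A : V -> W) := exists2 M : R, 0 < M & forall h, nm (A h) <= M * nm h.

Lemma dif_continuous V W (G : V -> W) x A : bounded_at A -> dif G x A -> continuous_at G x.
Proof.
move=> [M M0 AM] dG e e0; have [d d0 dP] := dG 1 ltr01.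
exists (Num.min d (e / (M + 1))); first by rewrite lt_min d0 divr_gt0// addr_gt0.
move=> h; rewrite lt_min => /andP[/dP h1]; rewrite ltr_pdivlMr ?addr_gt0// => h2.
have -> : G (x + h) - G x = (G (x + h) - G x - A h) + A h by rewrite subrK.
apply: (le_trans (nmD _ _)); have := AM h; move: h1 h2; rewrite mul1r mulrDr mulr1 (mulrC M); lra.
Qed.

Lemma bounded_at_scale W (d : W) : bounded_at (fun h : C => (h : R[i]) *: d).
Proof.
exists (nm d + 1) => [|h]; first by rewrite ltr_pwDr ?nm_ge0.
by rewrite nmZ mulrC ler_wpM2r ?nm_ge0// lerDl.
Qed.

Lemma der_continuous W (f : C -> W) z d : der f z d -> continuous_at f z.
Proof. exact/dif_continuous/bounded_at_scale. Qed.

Lemma dif_ext V W (G G' : V -> W) x A : (exists2 r : R, 0 < r & forall h, nm h < r -> G (x + h) = G' (x + h)) ->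
  dif G x A -> dif G' x A.
Proof.
move=> [r r0 GG'] dG e /dG[d d0 dP]; exists (Num.min d r); first by rewrite lt_min d0 r0.
move=> h; rewrite lt_min => /andP[hd hr].
rewrite -GG'// -[X in G' X]addr0 -GG' ?nm0// addr0; exact: dP.
Qed.

Lemma dif_ext_lin V W (G : V -> W) x A A' : (forall h, A h = A' h) -> dif G x A -> dif G x A'.
Proof.
move=> AA dG e /dG[d d0 dP]; exists d => // h hd; rewrite -AA; exact: dP.
Qed.

(** Both candidates are compared at [t *: h] for a small real [t > 0]; by homogeneity the factor [t]
    cancels, and the difference at [h] is below every [e]. *)
Lemma dif_unique V W (G : V -> W) x A B : (forall (a : R[i]) h, A (a *: h) = a *: A h) ->
  (forall (a : R[i]) h, B (a *: h) = a *: B h) -> dif G x A -> dif G x B -> forall h, A h = B h.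
Proof.
move=> AZ BZ dA dB h; apply/eqP; rewrite -subr_eq0; apply/eqP/nm_eq0/eqP.
rewrite eq_le nm_ge0 andbT; apply/ler_addgt0Pl => e e0; rewrite addr0.
have nh : 0 < nm h + 1 by rewrite ltr_pwDr ?nm_ge0.
have e1 : 0 < e / (2 * (nm h + 1)) by rewrite divr_gt0// mulr_gt0.
have [d1 d10 h1] := dA _ e1; have [d2 d20 h2] := dB _ e1.
have [t t0 [ht1 ht2]] : exists2 t : R, 0 < t & t * nm h < d1 /\ t * nm h < d2.
  exists (Num.min d1 d2 / (nm h + 1)); first by rewrite divr_gt0// lt_min d10.
  have H : Num.min d1 d2 / (nm h + 1) * nm h < Num.min d1 d2.
    rewrite -mulrA mulrC gtr_pMl ?lt_min ?d10// mulrC ltr_pdivrMr// mul1r; lra.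
  by split; apply: lt_le_trans H _; rewrite ge_min lexx ?orbT.
have nt : nm ((t%:C : R[i]) *: h) = t * nm h by rewrite nmZ nm_real gtr0_norm.
have := h1 (t%:C *: h); have := h2 (t%:C *: h); rewrite nt => /(_ ht2) H2 /(_ ht1) H1.
have : nm (t%:C *: (A h - B h)) <= 2 * (e / (2 * (nm h + 1)) * (t * nm h)).
  rewrite scalerBr -AZ -BZ.
  set a := G _ - _ in H1 H2; have -> : A (t%:C *: h) - B (t%:C *: h) = (a - B (t%:C *: h)) - (a - A (t%:C *: h)).
    by module.
  apply: le_trans (nmB _ _) _; lra.
rewrite nmZ nm_real gtr0_norm//.
have -> : 2 * (e / (2 * (nm h + 1)) * (t * nm h)) = t * (e * nm h / (nm h + 1)).
  by field; rewrite gt_eqF.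
rewrite ler_pM2l// => /le_trans; apply.
rewrite ler_pdivrMr// ler_pM2l//; lra.
Qed.

Lemma difD V W (G H : V -> W) x A B : dif G x A -> dif H x B ->
  dif (fun y => G y + H y) x (fun h => A h + B h).
Proof.
move=> dG dH e e0; have e1 : 0 < e / 2 by rewrite divr_gt0.
have [d1 d10 h1] := dG _ e1; have [d2 d20 h2] := dH _ e1.
exists (Num.min d1 d2); first by rewrite lt_min d10.
move=> h; rewrite lt_min => /andP[/h1 H1 /h2 H2].
have -> : G (x + h) + H (x + h) - (G x + H x) - (A h + B h) =
  (G (x + h) - G x - A h) + (H (x + h) - H x - B h) by module.
by apply: le_trans (nmD _ _) _; lra.
Qed.

Lemma dif_lin V W Z (L : W -> Z) (G : V -> W) x A :
  (forall u v, L (u - v) = L u - L v) -> bounded_at L -> dif G x A -> dif (fun y => L (G y)) x (fun h => L (A h)).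
Proof.
move=> LB [M M0 LM] dG e e0; have [d d0 h1] := dG (e / M) (divr_gt0 e0 M0).
exists d => // h /h1; rewrite -!LB => H; apply: le_trans (LM _) _.
by rewrite mulrC -ler_pdivlMr// mulrAC.
Qed.

Lemma dif_cst V W (c : W) (x : V) : dif (fun=> c) x (fun=> 0).
Proof. by move=> e e0; exists 1 => // h _; rewrite !subrr nm0 mulr_ge0 ?nm_ge0// ltW. Qed.

Lemma dif_id V (x : V) : dif id x id.
Proof.
move=> e e0; exists 1 => // h _.
by rewrite [x + h]addrC addrK subrr nm0 mulr_ge0 ?nm_ge0// ltW.
Qed.

Lemma dif_comp V W Z (G : V -> W) (H : W -> Z) x A B : bounded_at A -> bounded_at B ->
  (forall u v, B (u + v) = B u + B v) ->
  dif G x A -> dif H (G x) B -> dif (fun y => H (G y)) x (fun h => B (A h)).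
Proof.
move=> [M M0 AM] [N N0 BN] BD dG dH e e0.
have MN : 0 < M + N + 1 by lra.
have [d2 d20 h2] := dH (e / 2 / (M + 1)) ltac:(by rewrite !divr_gt0// addr_gt0).
have [d1 d10 h1] := dG (Num.min 1 (e / 2 / N)) ltac:(by rewrite lt_min ltr01 !divr_gt0).
exists (Num.min d1 (d2 / (M + 1))); first by rewrite lt_min d10 divr_gt0// addr_gt0.
move=> h; rewrite lt_min => /andP[/h1 H1]; rewrite ltr_pdivlMr ?addr_gt0// => hd2.
set k := G (x + h) - G x in H1.
have k1 : nm (k - A h) <= nm h.
  by apply: le_trans H1 _; rewrite ler_piMl ?nm_ge0// ge_min lexx.
have k2 : N * nm (k - A h) <= e / 2 * nm h.
  rewrite mulrC -ler_pdivlMr// mulrAC; apply: le_trans H1 _.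
  by rewrite ler_wpM2r ?nm_ge0// ge_min lexx orbT.
have nk : nm k <= nm h * (M + 1).
  rewrite -(subrK (A h) k); apply: le_trans (nmD _ _) _; have := AM h; lra.
have := h2 k (le_lt_trans nk hd2); rewrite /k (addrC (G x)) subrK -/k => H2.
have -> : H (G (x + h)) - H (G x) - B (A h) = (H (G (x + h)) - H (G x) - B k) + B (k - A h).
  by have -> : B k = B (k - A h) + B (A h) by [rewrite -BD subrK]; module.
apply: le_trans (nmD _ _) _.
have : e / 2 / (M + 1) * nm k <= e / 2 * nm h.
  rewrite mulrAC ler_pdivrMr ?addr_gt0// -[leRHS]mulrA ler_wpM2l//; lra.
have := BN (k - A h); lra.
Qed.

Lemma der_comp W (g : C -> C) (f : C -> W) z (a : C) (b : W) : der g z a -> der f (g z) b ->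
  der (fun y => f (g y)) z ((a : R[i]) *: b).
Proof.
move=> dg df; have := dif_comp (bounded_at_scale a) (bounded_at_scale b) _ dg df.
move/(_ (fun u v => scalerDl b u v)); apply: dif_ext_lin => h.
by rewrite scalerA.
Qed.

Lemma dif_scale V W (a : V -> C) (G : V -> W) x A B : bounded_at A -> bounded_at B ->
  dif a x A -> dif G x B ->
  dif (fun y => (a y : R[i]) *: G y) x (fun h => (a x : R[i]) *: B h + (A h : R[i]) *: G x).
Proof.
move=> bA bB da dG e e0.
have [MA MA0 AM] := bA; have [MB MB0 BM] := bB.
have [d1 d10 h1] := dif_continuous bA da ltr01.
set g := nm (G x); have g0 : 0 <= g := nm_ge0 _.
set n := nm (a x); have n0 : 0 <= n := nm_ge0 _.
have [d2 d20 h2] := dG (e / 3 / (n + 1)) ltac:(by rewrite !divr_gt0//; lra).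
have [d3 d30 h3] := da (e / 3 / (g + 1)) ltac:(by rewrite !divr_gt0//; lra).
have [d4 d40 h4] := dif_continuous bB dG (e := e / 3 / (MA + 1 + e)) ltac:(by rewrite !divr_gt0//; lra).
have [d5 d50 h5] := da 1 ltr01.
have dd : 0 < Num.min (Num.min d3 d2) (Num.min d4 d5) by rewrite !lt_min d20 d30 d40 d50.
exists (Num.min (Num.min d3 d2) (Num.min d4 d5)) => // h.
rewrite !lt_min => /andP[/andP[/h3 H3 /h2 H2] /andP[/h4 H4 /h5 H5]].
set a' := a (x + h) in H3 H5 *; set G' := G (x + h) in H2 H4 *.
have -> : a' *: G' - a x *: G x - (a x *: B h + A h *: G x) =
  a x *: (G' - G x - B h) + (a' - a x - A h : R[i]) *: G x + (a' - a x : R[i]) *: (G' - G x) by module.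
have h0 := nm_ge0 h.
have T1 : nm (a x *: (G' - G x - B h)) <= e / 3 * nm h.
  rewrite nmZ -/n; apply: le_trans (ler_wpM2l n0 H2) _.
  rewrite mulrA ler_wpM2r// mulrC mulrAC ler_pdivrMr ?ler_pM2l; lra.
have T2 : nm ((a' - a x - A h : R[i]) *: G x) <= e / 3 * nm h.
  rewrite nmZ -/g; apply: le_trans (ler_wpM2r g0 H3) _.
  rewrite mulrAC ler_wpM2r// mulrAC ler_pdivrMr ?ler_pM2l; lra.
have T3 : nm ((a' - a x : R[i]) *: (G' - G x)) <= e / 3 * nm h.
  rewrite nmZ.
  have na : nm (a' - a x : C) <= (MA + 1) * nm h.
    rewrite -(subrK (A h) (a' - a x)); apply: le_trans (nmD _ _) _.
    rewrite mulrDl; have := AM h; lra.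
  apply: le_trans (ler_pM (nm_ge0 _) (nm_ge0 _) na H4) _.
  rewrite mulrAC ler_wpM2r// mulrC mulrAC ler_pdivrMr; last lra.
  by rewrite ler_pM2l ?divr_gt0//; lra.
apply: le_trans (nmD _ _) _; have := nmD (a x *: (G' - G x - B h)) ((a' - a x - A h : R[i]) *: G x).
by move: T1 T2 T3; lra.
Qed.

End Differential.

(** * Cauchy theory by Riemann sums *)

Section MeanValue.
Variables (R : realType) (W : normedModType R[i]).
Local Notation C := (R[i]^o).

(** Increments over the two halves of an interval add up, so bisection reduces the estimate, with
    [K + e] in place of [K], to short intervals containing a point [s]; there both ends are expanded
    about [s], and their errors together stay below [e] times the length because [s] lies between
    them. *)
Lemma mean_value (g : C -> W) (D : R -> W) (K : R) :
  (forall t, 0 <= t <= 1 -> der g (t%:C : C) (D t)) ->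
  (forall t, 0 <= t <= 1 -> nm (D t) <= K) -> nm (g (1 : C) - g (0 : C)) <= K.
Proof.
move=> gD DK; apply/ler_addgt0Pr => e e0.
suff : nm (g ((0 + dy R 0)%:C : C) - g (0%:C : C)) <= (K + e) * dy R 0.
  by rewrite /dy expr0 add0r mulr1.
pose P (a b : R) n := nm (g ((a + dy R n)%:C : C) - g (a%:C : C)) <= (K + e) * dy R n.
rewrite -/(P 0 0 0%N); apply: (@bisection _ P) => [a b n h1 h2 _ _|s t s01 _].
  rewrite /P; have := dyS R n; set x := dy R n; set y := dy R n.+1 => ->.
  have -> : g (a + (y + y))%:C - g a%:C = (g (a + y + y)%:C - g (a + y)%:C) + (g (a + y)%:C - g a%:C).
    by rewrite addrA subrKA.
  by apply: le_trans (nmD _ _) _; move: h1 h2; rewrite /P -/y; lra.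
have [d d0 dP] := gD s s01 e e0.
exists d => // a b n nd a0 /andP[as1 sb1] _ _ _ _; rewrite /P.
set x := dy R n in nd sb1 *.
have ub : nm (((a + x - s)%:C : C)) = a + x - s by rewrite nm_real ger0_norm; lra.
have ua : nm (((a - s)%:C : C)) = s - a by rewrite nm_real ler0_norm; lra.
have := dP (a + x - s)%:C; have := dP (a - s)%:C; rewrite ub ua.
have -> : (s%:C : C) + (a - s)%:C = a%:C by rewrite -rmorphD /= addrC subrK.
have -> : (s%:C : C) + (a + x - s)%:C = (a + x)%:C by rewrite -rmorphD /= addrC subrK.
move=> /(_ ltac:(lra)) h1 /(_ ltac:(lra)) h2.
have -> : g (a + x)%:C - g a%:C = (g (a + x)%:C - g s%:C - (a + x - s)%:C *: D s) -
   (g a%:C - g s%:C - (a - s)%:C *: D s) + x%:C *: D s.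
  by rewrite !rmorphB !rmorphD /=; module.
apply: le_trans (nmD _ _) _; have := nmB (g (a + x)%:C - g s%:C - (a + x - s)%:C *: D s)
   (g a%:C - g s%:C - (a - s)%:C *: D s).
have : nm (x%:C *: D s) <= K * x.
  by rewrite nmZ nm_real gtr0_norm ?dy_gt0// mulrC ler_wpM2r ?DK// ltW ?dy_gt0.
move: h1 h2; lra.
Qed.

End MeanValue.

Section Averages.
Variables (R : realType) (W : normedModType R[i]).
Local Notation C := (R[i]^o).
Implicit Types (F G : C -> W) (w u v : C).

(* The mean of [F] over the left endpoints of the [2 ^ n] dyadic parts of the
   segment [w, w + u]: a Riemann sum, without the need of an integral. *)
Fixpoint avg n F w u : W :=
  if n is n'.+1 then (2^-1 : R[i]) *: (avg n' F w (u / 2) + avg n' F (w + u / 2) (u / 2))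
  else F w.

(** Stability under midpoints is enough for dyadic means; it is used for balls and for the
    half-plane of nonnegative real part. *)
Lemma avg_ind (Q : W -> Prop) n F w u :
  (forall x y, Q x -> Q y -> Q ((2^-1 : R[i]) *: (x + y))) ->
  (forall t : R, 0 <= t <= 1 -> Q (F (w + t%:C * u))) -> Q (avg n F w u).
Proof.
move=> Qm; elim: n w u => [|n IH] w u QF /=.
  by have := QF 0; rewrite mul0r addr0; apply; rewrite lexx ler01.
have h2 : (2^-1 : R)%:C = 2^-1 :> R[i] by rewrite fmorphV rmorph_nat.
apply: Qm; apply: IH => t /andP[t0 t1].
  have := QF (t / 2); rewrite rmorphM /= h2 -!mulrA (mulrC u); apply.
  by apply/andP; split; lra.
have := QF ((1 + t) / 2); rewrite rmorphM rmorphD /= h2.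
have -> : (1 + t%:C) * 2^-1 * u = u / 2 + t%:C * (u / 2) :> R[i] by ring.
rewrite addrA; apply; apply/andP; split; lra.
Qed.

Lemma avg_ext n F G w u : (forall t : R, 0 <= t <= 1 -> F (w + t%:C * u) = G (w + t%:C * u)) ->
  avg n F w u = avg n G w u.
Proof.
elim: n w u => [|n IH] w u FG /=.
  by have := FG 0; rewrite mul0r addr0; apply; rewrite lexx ler01.
have h2 : (2^-1 : R)%:C = 2^-1 :> R[i] by rewrite fmorphV rmorph_nat.
congr (_ *: (_ + _)); apply: IH => t /andP[t0 t1].
  have := FG (t / 2); rewrite rmorphM /= h2 -!mulrA (mulrC u); apply.
  by apply/andP; split; lra.
have := FG ((1 + t) / 2); rewrite rmorphM rmorphD /= h2.
have -> : (1 + t%:C) * 2^-1 * u = u / 2 + t%:C * (u / 2) :> R[i] by ring.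
rewrite addrA; apply; apply/andP; split; lra.
Qed.

Lemma avg_shift n F w u v : avg n (fun z => F (z + v)) w u = avg n F (w + v) u.
Proof. by elim: n w u => [//|n IH] w u /=; rewrite !IH addrAC. Qed.

Lemma half_double (x : W) : (2^-1 : R[i]) *: (x + x) = x.
Proof. by rewrite -mulr2n -[x *+ 2]scaler_nat scalerA mulVf ?scale1r// pnatr_eq0. Qed.

Lemma avg_cst n (c : W) w u : avg n (fun=> c) w u = c.
Proof. by elim: n w u => [//|n IH] w u /=; rewrite !IH half_double. Qed.

Lemma avgD n F G w u : avg n (fun z => F z + G z) w u = avg n F w u + avg n G w u.
Proof. by elim: n w u => [//|n IH] w u /=; rewrite !IH; module. Qed.

Lemma avgZ n F (a : R[i]) w u : avg n (fun z => a *: F z) w u = a *: avg n F w u.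
Proof. by elim: n w u => [//|n IH] w u /=; rewrite !IH; module. Qed.

Lemma avg_bound n F w u (x : W) (M : R) :
  (forall t : R, 0 <= t <= 1 -> nm (F (w + t%:C * u) - x) <= M) -> nm (avg n F w u - x) <= M.
Proof.
move=> FM; apply: (@avg_ind (fun y => nm (y - x) <= M)) => // a b ha hb.
rewrite -[x in _ - x]half_double -scalerBr nmZ nmV nm_nat mulrC ler_pdivrMr//.
have -> : a + b - (x + x) = (a - x) + (b - x) by module.
by apply: le_trans (nmD _ _) _; lra.
Qed.

(* The Riemann sum of [F] along the boundary of the parallelogram at [w] with
   edges [u] and [v]. Both orientations of an edge use the same nodes, hence
   the sum vanishes exactly on affine maps. *)
Definition bdry n F w u v : W :=
  (u : R[i]) *: (avg n F w u - avg n F (w + v) u) +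
  (v : R[i]) *: (avg n F (w + u) v - avg n F w v).

(** The inner edges of the four quarters are run through in both directions over the same nodes and
    cancel. The quarters use level [n] where the whole uses [n.+1], so the nodes on the outer edges
    agree. *)
Lemma bdryS n F w u v : bdry n.+1 F w u v =
  bdry n F w (u / 2) (v / 2) + bdry n F (w + u / 2) (u / 2) (v / 2) +
  bdry n F (w + v / 2) (u / 2) (v / 2) + bdry n F (w + u / 2 + v / 2) (u / 2) (v / 2).
Proof.
rewrite /bdry /=.
have hu : w + u / 2 + u / 2 = w + u by rewrite -addrA; congr (_ + _); field.
have hv : w + v / 2 + v / 2 = w + v by rewrite -addrA; congr (_ + _); field.
have -> : w + u / 2 + v / 2 + u / 2 = w + u + v / 2 by field.
have -> : w + u / 2 + v / 2 + v / 2 = w + v + u / 2 by field.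
have -> : w + v / 2 + u / 2 = w + u / 2 + v / 2 by rewrite addrAC.
by rewrite hu hv; module.
Qed.

Lemma bdryD n F G w u v : bdry n (fun z => F z + G z) w u v = bdry n F w u v + bdry n G w u v.
Proof. by rewrite /bdry !avgD; module. Qed.

(** Translating a segment by [e] changes the mean of an affine map by [e] times its slope [d],
    whatever the nodes; the two pairs of opposite edges then contribute - u v d and u v d. *)
Lemma bdry_affine n (c d : W) w u v : bdry n (fun z => c + (z : R[i]) *: d) w u v = 0.
Proof.
have H (a b e : C) : avg n (fun z => c + (z : R[i]) *: d) (a + e) b =
    avg n (fun z => c + (z : R[i]) *: d) a b + (e : R[i]) *: d.
  rewrite -avg_shift -(avg_cst n ((e : R[i]) *: d) a b) -avgD.
  by apply: avg_ext => t _; module.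
by rewrite /bdry !H; module.
Qed.

Lemma bdry_bound n F w u v (M : R) :
  (forall s t : R, 0 <= s <= 1 -> 0 <= t <= 1 -> nm (F (w + s%:C * u + t%:C * v)) <= M) ->
  nm (bdry n F w u v) <= 2 * M * (nm u + nm v).
Proof.
move=> FM.
have B a b : (forall t : R, 0 <= t <= 1 -> nm (F (a + t%:C * b)) <= M) -> nm (avg n F a b) <= M.
  by move=> h; rewrite -[avg _ _ _ _]subr0; apply: avg_bound => t /h; rewrite subr0.
have i0 : 0 <= (0 : R) <= 1 by rewrite lexx ler01.
have i1 : 0 <= (1 : R) <= 1 by rewrite lexx ler01.
have b1 : nm (avg n F w u) <= M by apply: B => t t01; have := FM t 0 t01 i0; rewrite mul0r addr0.
have b2 : nm (avg n F (w + v) u) <= M by apply: B => t t01; have := FM t 1 t01 i1; rewrite mul1r addrAC.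
have b3 : nm (avg n F w v) <= M by apply: B => t t01; have := FM 0 t i0 t01; rewrite mul0r addr0.
have b4 : nm (avg n F (w + u) v) <= M by apply: B => t t01; have := FM 1 t i1 t01; rewrite mul1r.
apply: le_trans (nmD _ _) _; rewrite !nmZ.
have := ler_wpM2l (nm_ge0 u) (le_trans (nmB (avg n F w u) (avg n F (w + v) u)) (lerD b1 b2)).
have := ler_wpM2l (nm_ge0 v) (le_trans (nmB (avg n F (w + u) v) (avg n F w v)) (lerD b4 b3)).
lra.
Qed.

(* Goursat's bisection: on a small parallelogram [F] is affine up to [o(diameter)]. *)
Theorem goursat F w u v :
  (forall s t : R, 0 <= s <= 1 -> 0 <= t <= 1 -> exists D, der F (w + s%:C * u + t%:C * v) D) ->
  forall e : R, 0 < e -> exists N, forall n, (N <= n)%N -> nm (bdry n F w u v) <= e.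
Proof.
move=> FD e e0.
(* The bound is proportional to the area, so those of four quarters add up exactly to that of the
   whole. The threshold [N] depends on the square because each subdivision lowers the level of the
   sum by one. *)
pose P (a b : R) m := exists N, forall n, (N <= n)%N ->
  nm (bdry n F (w + a%:C * u + b%:C * v) ((dy R m)%:C * u) ((dy R m)%:C * v)) <= e * dy R m ^+ 2.
suff : P 0 0 0%N by rewrite /P /dy !expr0 !mul0r !addr0 !mul1r expr1n mulr1.
apply: (@bisection _ P) => [a b m|s t s01 t01].
  move=> [N1 h1] [N2 h2] [N3 h3] [N4 h4].
  exists (maxn (maxn N1 N2) (maxn N3 N4)).+1 => -[//|n]; rewrite ltnS !geq_max.
  move=> /andP[/andP[/h1 {}h1 /h2 {}h2] /andP[/h3 {}h3 /h4 {}h4]].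
  have hd : (dy R m)%:C = (dy R m.+1)%:C * 2 :> R[i].
    by rewrite dyS rmorphD /=; ring.
  have hh (x : C) : (dy R m)%:C * x / 2 = (dy R m.+1)%:C * x by rewrite hd; field.
  rewrite bdryS !hh.
  have E1 : w + (a + dy R m.+1)%:C * u + b%:C * v = w + a%:C * u + b%:C * v + (dy R m.+1)%:C * u.
    by rewrite rmorphD /=; ring.
  have E2 : w + a%:C * u + (b + dy R m.+1)%:C * v = w + a%:C * u + b%:C * v + (dy R m.+1)%:C * v.
    by rewrite rmorphD /=; ring.
  have E3 : w + (a + dy R m.+1)%:C * u + (b + dy R m.+1)%:C * v =
     w + a%:C * u + b%:C * v + (dy R m.+1)%:C * u + (dy R m.+1)%:C * v.
    by rewrite !rmorphD /=; ring.
  rewrite E1 in h2; rewrite E2 in h3; rewrite E3 in h4.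
  apply: le_trans (nmD _ _) _; apply: le_trans (lerD (nmD _ _) (lexx _)) _.
  apply: le_trans (lerD (lerD (nmD _ _) (lexx _)) (lexx _)) _.
  by move: h1 h2 h3 h4; rewrite (dyS R m); lra.
have [D zD] := FD s t s01 t01; set z := w + s%:C * u + t%:C * v in zD.
set L := nm u + nm v; have L0 : 0 <= L by rewrite addr_ge0 ?nm_ge0.
(* With side [x] the diameter is at most [x * L] and so is the sum of the edge lengths; [bdry_bound]
   then yields 2 L^2 x^2 times the slope error, whence this denominator. The added 1 covers
   [L = 0]. *)
have q0 : 0 < 2 * L ^+ 2 + 1 by have := sqr_ge0 L; lra.
have [d d0 dP] := zD (e / (2 * L ^+ 2 + 1)) (divr_gt0 e0 q0).
exists (d / (L + 1)); first by rewrite divr_gt0//; lra.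
move=> a b m; rewrite ltr_pdivlMr; last lra.
set x := dy R m => xd a0 /andP[as1 sb1] _ b0 /andP[bt1 tb1] _.
have x0 : 0 < x := dy_gt0 R m.
exists 0%N => n _.
(* [G] is [F] minus its affine part at [z], which [bdry] does not see. *)
pose G (y : C) : W := F y + ((z : R[i]) *: D - F z + (y : R[i]) *: - D).
have -> : bdry n F (w + a%:C * u + b%:C * v) (x%:C * u) (x%:C * v) =
    bdry n G (w + a%:C * u + b%:C * v) (x%:C * u) (x%:C * v).
  by rewrite /G bdryD bdry_affine addr0.
apply: le_trans (@bdry_bound _ _ _ _ _ (e / (2 * L ^+ 2 + 1) * (x * L)) _) _; last first.
  rewrite !nmM nm_real gtr0_norm// -mulrDr -/L.
  have -> : 2 * (e / (2 * L ^+ 2 + 1) * (x * L)) * (x * L) = e * x ^+ 2 * ((2 * L ^+ 2) / (2 * L ^+ 2 + 1)).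
    by field; rewrite gt_eqF.
  apply: ler_piMr; first by apply: mulr_ge0; [exact: ltW | exact: sqr_ge0].
  by rewrite ler_pdivrMr// mul1r lerDl.
move=> s' t' /andP[s0 s1] /andP[t0 t1].
set y : C := _ + _ + _ * _; pose h : C := y - z.
have hE : h = (a + s' * x - s)%:C * u + (b + t' * x - t)%:C * v.
  by rewrite /h /y /z !(rmorphB, rmorphD, rmorphM) /=; ring.
have sx0 : 0 <= s' * x by rewrite mulr_ge0// ltW.
have tx0 : 0 <= t' * x by rewrite mulr_ge0// ltW.
have sx1 : s' * x <= x by rewrite ler_piMl// ltW.
have tx1 : t' * x <= x by rewrite ler_piMl// ltW.
have nh : nm h <= x * L.
  rewrite hE; apply: le_trans (nmD _ _) _; rewrite !nmM !nm_real /L mulrDr.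
  by apply: lerD; apply: ler_wpM2r; rewrite ?nm_ge0// ler_norml; lra.
have := dP h; rewrite /h (addrC z) subrK -/h => H.
have -> : G y = F y - F z - (h : R[i]) *: D by rewrite /G /h; module.
apply: le_trans (H _) _; first by apply: le_lt_trans nh _; lra.
by rewrite ler_wpM2l// ltW// divr_gt0.
Qed.

End Averages.

(** * The complex exponential *)

Section ComplexExponential.
Variable R : realType.
Local Notation C := (R[i]^o).

Lemma is_derive_dif (f : R -> R) (x d : R) : is_derive x 1 f d -> forall e : R, 0 < e ->
  exists2 r : R, 0 < r & forall h, `|h| < r -> `|f (x + h) - f x - d * h| <= e * `|h|.
Proof.
move=> [fx fd] e e0.
have : h^-1 *: (f (h *: 1 + x) - f x) @[h --> 0^'] --> d by rewrite -fd.
move=> /cvgrPdist_le/(_ e e0); rewrite near_withinE => /nbhs_ballP[r /= r0 rP].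
exists r => // h hr; have [->|h0] := eqVneq h 0.
  by rewrite addr0 subrr mulr0 subr0 normr0 mulr0.
have := rP h; rewrite /ball /= sub0r normrN => /(_ hr h0).
rewrite -[h *: 1]/(h * 1) mulr1 (addrC h) -[h^-1 *: _]/(h^-1 * _) => H.
rewrite -normrN -ler_pdivrMr ?normr_gt0// -normfV -normrM.
by have -> : - (f (x + h) - f x - d * h) / h = d - h^-1 * (f (x + h) - f x) by field.
Qed.

Definition cexp (z : C) : C := (expR (complex.Re z))%:C * (cos (complex.Im z) +i* sin (complex.Im z)).

Lemma cexpE (x y : R) : cexp (x +i* y) = (expR x * cos y) +i* (expR x * sin y).
Proof. by rewrite /cexp /=; simpc. Qed.

Lemma cexpD (z w : C) : cexp (z + w) = cexp z * cexp w.
Proof.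
case: z w => [x y] [x' y'].
have -> : ((x +i* y : C) + (x' +i* y')) = (x + x') +i* (y + y') by [].
rewrite !cexpE expRD cosD sinD; apply/eqP; rewrite eq_complex /=.
by apply/andP; split; apply/eqP; ring.
Qed.

Lemma cexp0 : cexp 0 = 1.
Proof. by rewrite -[0 in LHS]/(0 +i* 0) cexpE expR0 cos0 sin0 !mul1r. Qed.

Lemma nm_cexp (z : C) : nm (cexp z) = expR (complex.Re z).
Proof.
case: z => x y; rewrite /cexp /= nmM nm_real gtr0_norm ?expR_gt0//.
have -> : nm (cos y +i* sin y : C) = 1.
  by apply: complexI; rewrite cnmE normc_def /= cos2Dsin2 sqrtr1.
by rewrite mulr1.
Qed.

Lemma cexp_neq0 (z : C) : cexp z != 0.
Proof. by apply/eqP => h; have := expR_gt0 (complex.Re z); rewrite -nm_cexp h nm0 ltxx. Qed.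

Lemma cexp_period (z : C) : cexp (z + (0 +i* (2 * pi))) = cexp z.
Proof.
have cp : cos (2 * pi) = 1 :> R by rewrite mulrDl !mul1r cosD cospi sinpi; ring.
have sp : sin (2 * pi) = 0 :> R by rewrite mulrDl !mul1r sinD cospi sinpi; ring.
by rewrite cexpD cexpE expR0 !mul1r cp sp -[1 +i* 0]/(1 : R[i]) mulr1.
Qed.

Lemma der_cexp0 : der cexp 0 (1 : C).
Proof.
move=> e e0.
(* The estimates [c1] to [c4] below add up to 9 [e1] times the norm of [h]. The terms of second
   order are made linear by requiring [nm h < e1]. *)
pose e1 := Num.min 1 (e / 10).
have e10 : 0 < e1 by rewrite lt_min ltr01 divr_gt0.
have e1e : e1 <= e / 10 by rewrite ge_min lexx orbT.
have e11 : e1 <= 1 by rewrite ge_min lexx.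
clearbody e1.
have [d1 d10 h1] := is_derive_dif (is_derive_expR (0 : R)) e10.
have [d2 d20 h2] := is_derive_dif (is_derive_cos (0 : R)) e10.
have [d3 d30 h3] := is_derive_dif (is_derive_sin (0 : R)) e10.
exists (Num.min e1 (Num.min d1 (Num.min d2 d3))); first by rewrite !lt_min e10 d10 d20 d30.
move=> [x y]; rewrite !lt_min => /and4P[He H1 H2 H3].
set h : C := x +i* y in He H1 H2 H3 *.
have hx : `|x| <= nm h := nm_Re h; have hy : `|y| <= nm h := nm_Im h.
have := h1 x (le_lt_trans hx H1); have := h2 y (le_lt_trans hy H2); have := h3 y (le_lt_trans hy H3).
rewrite !add0r expR0 cos0 sin0 !(oppr0, mul0r, subr0, addr0, mul1r) => S2 S1 S0.
rewrite cexp0.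
have ex : expR x = (expR x - 1 - x) + x + 1 by ring.
have S0' : `|expR x - 1| <= 2 * `|x|.
  have -> : expR x - 1 = (expR x - 1 - x) + x by ring.
  have := ler_normD (expR x - 1 - x) x; have : e1 * `|x| <= 1 * `|x| by rewrite ler_wpM2r.
  move: S0; lra.
have x1 : `|x| <= 1 by lra.
have S3 : expR x <= 3.
  have := ler_norm (expR x - 1); lra.
have n0 : 0 <= nm h := nm_ge0 h.
have c1 : `|expR x * (cos y - 1)| <= 3 * (e1 * nm h).
  rewrite normrM ger0_norm ?expR_ge0//; apply: ler_pM; rewrite ?expR_ge0//.
  by apply: le_trans S1 _; rewrite ler_wpM2l// ltW.
have c2 : `|expR x * (sin y - y)| <= 3 * (e1 * nm h).
  rewrite normrM ger0_norm ?expR_ge0//; apply: ler_pM; rewrite ?expR_ge0//.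
  by apply: le_trans S2 _; rewrite ler_wpM2l// ltW.
have c3 : `|(expR x - 1) * y| <= 2 * (e1 * nm h).
  rewrite normrM mulrA; apply: ler_pM => //; apply: le_trans S0' _.
  by rewrite ler_pM2l//; lra.
have c4 : `|expR x - 1 - x| <= e1 * nm h.
  by apply: le_trans S0 _; rewrite ler_wpM2l// ltW.
have HE : cexp h - 1 - (h : R[i]) *: (1 : C) =
   (expR x - 1 - x + expR x * (cos y - 1)) +i* (expR x * (sin y - y) + (expR x - 1) * y).
  rewrite -[_ *: _]/((_ : R[i]) * 1) mulr1 /h cexpE.
  rewrite -[LHS]/(_ +i* _); congr (_ +i* _); rewrite /=; ring.
rewrite HE; apply: le_trans (nm_ReIm _) _ => /=.
have := ler_normD (expR x - 1 - x) (expR x * (cos y - 1)).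
have := ler_normD (expR x * (sin y - y)) ((expR x - 1) * y).
have : e1 * nm h <= e / 10 * nm h by rewrite ler_wpM2r.
have : 0 <= e * nm h by rewrite mulr_ge0// ltW.
lra.
Qed.

Lemma der_cexp (z : C) : der cexp z (cexp z).
Proof.
move=> e e0; have n0 : 0 < nm (cexp z) by rewrite nm_cexp expR_gt0.
have [d d0 dP] := der_cexp0 (divr_gt0 e0 n0).
exists d => // h /dP; rewrite add0r cexp0 cexpD => H.
have -> : cexp z * cexp h - cexp z - (h : R[i]) *: cexp z = cexp z * (cexp h - 1 - (h : R[i]) *: (1 : C)).
  by rewrite -![_ *: _]/((_ : R[i]) * _); ring.
by rewrite nmM -ler_pdivlMl// mulrA (mulrC _ e).
Qed.

End ComplexExponential.

(** * Means over circles and Cauchy's estimate *)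

Section CircleMean.
Variables (R : realType) (W : normedModType R[i]).
Local Notation C := (R[i]^o).
Implicit Types (f g : C -> W) (r : R).

(** The mean of [f] over the points r w with w a root of unity of order 2^n, written over a vertical
    segment in logarithmic coordinates so that [goursat], which is about parallelograms, applies. *)
Definition cmean n f r : W := avg n (fun z => f (cexp z)) (ln r)%:C (0 +i* (2 * pi)).

Lemma nm_circle r (t : R) : 0 < r -> nm (cexp ((ln r)%:C + t%:C * (0 +i* (2 * pi)))) = r.
Proof. by move=> r0; rewrite nm_cexp /= !(mul0r, mulr0, subr0, addr0) lnK. Qed.

Lemma cmean_ind (Q : W -> Prop) n f r : 0 < r ->
  (forall x y, Q x -> Q y -> Q ((2^-1 : R[i]) *: (x + y))) ->
  (forall z, nm z = r -> Q (f z)) -> Q (cmean n f r).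
Proof. by move=> r0 Qm Qf; apply: avg_ind => // t _; apply: Qf; rewrite nm_circle. Qed.

Lemma cmean_ext n f g r : 0 < r -> (forall z, nm z = r -> f z = g z) -> cmean n f r = cmean n g r.
Proof. by move=> r0 fg; apply: avg_ext => t _; apply: fg; rewrite nm_circle. Qed.

Lemma cmean_bound n f r (x : W) (M : R) : 0 < r ->
  (forall z, nm z = r -> nm (f z - x) <= M) -> nm (cmean n f r - x) <= M.
Proof. by move=> r0 fM; apply: avg_bound => t _; apply: fM; rewrite nm_circle. Qed.

(* In logarithmic coordinates an annulus is a rectangle whose horizontal edges
   cancel, so the means over two concentric circles have the same limit. *)
Theorem cmean_cvg f (rho r : R) : continuous_at f 0 ->
  (forall z, 0 < nm z < rho -> exists D, der f z D) -> 0 < r < rho ->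
  forall e : R, 0 < e -> exists N, forall n, (N <= n)%N -> nm (cmean n f r - f 0) <= e.
Proof.
move=> fc fD /andP[r0 rrho] e e0.
have e2 : 0 < e / 2 by rewrite divr_gt0.
have [d d0 dP] := fc _ e2.
pose r1 := Num.min r (d / 2).
have r10 : 0 < r1 by rewrite lt_min r0 divr_gt0.
have r1r : r1 <= r by rewrite ge_min lexx.
have r1d : r1 < d by rewrite gt_min; apply/orP; right; lra.
pose u : C := (ln r - ln r1)%:C; pose v : C := 0 +i* (2 * pi).
have lnr : 0 <= ln r - ln r1 by rewrite subr_ge0 ler_ln.
have p0 : 0 < 2 * pi :> R by rewrite mulr_gt0 ?pi_gt0.
have nv : nm v = 2 * pi.
  by apply: complexI; rewrite cnmE normc_def /= expr0n add0r sqrtr_sqr gtr0_norm.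
have HD s t : 0 <= s <= 1 -> 0 <= t <= 1 ->
    exists D, der (fun z => f (cexp z)) ((ln r1)%:C + s%:C * u + t%:C * v) D.
  move=> /andP[s0 s1] _; set z := _ + _ + _.
  have Rz : complex.Re z = ln r1 + s * (ln r - ln r1).
    by rewrite /z /u /v /= !(mul0r, mulr0, subr0, addr0).
  have [|D HD] := fD (cexp z).
    rewrite nm_cexp expR_gt0 andTb; apply: le_lt_trans rrho; rewrite -[leRHS]lnK// ler_expR Rz.
    have := ler_wpM2r lnr s1; lra.
  by exists ((cexp z : R[i]) *: D); apply: der_comp HD; exact: der_cexp.
(* After cancellation the boundary sum is [v] times the difference of the two means, and [v] has
   modulus 2 pi. *)
have [N NP] := goursat HD (mulr_gt0 e2 p0).
exists N => n /NP; rewrite /bdry.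
rewrite -(avg_shift n _ (ln r1)%:C u v) (@avg_ext _ _ n (fun z => f (cexp (z + v))) (fun z => f (cexp z))); last first.
  by move=> t _; rewrite cexp_period.
rewrite subrr scaler0 add0r nmZ nv mulrC ler_pM2r//.
have -> : ((ln r1)%:C : C) + u = (ln r)%:C by rewrite /u rmorphB /= addrC subrK.
rewrite -/(cmean n f r) -/(cmean n f r1) => H1.
have H2 : nm (cmean n f r1 - f 0) <= e / 2.
  by apply: cmean_bound => // z zr; rewrite -[z]add0r; apply: dP; rewrite zr.
rewrite -(subrK (cmean n f r1) (cmean n f r)) -addrA.
by apply: le_trans (nmD _ _) _; lra.
Qed.

Lemma der_inv (z : C) : z != 0 -> der (fun y : C => (y : R[i])^-1 : C) z (- (z : R[i]) ^- 2 : C).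
Proof.
move=> z0 e e0; have n0 := nm_gt0 z0; set n := nm z in n0.
exists (Num.min (n / 2) (e * n ^+ 3 / 2)).
  by rewrite lt_min !divr_gt0// mulr_gt0// exprn_gt0.
move=> h; rewrite lt_min => /andP[h1 h2].
have nzh : n / 2 <= nm (z + h).
  have : nm ((z + h) - h) <= nm (z + h) + nm h by exact: nmB.
  by rewrite addrK -/n; lra.
have zh : z + h != 0 by apply/eqP => E; move: nzh; rewrite E nm0; lra.
have -> : (z + h : R[i])^-1 - z^-1 - (h : R[i]) *: (- z ^- 2 : C) = h * (h * ((z + h)^-1 * z ^- 2)).
  by rewrite -[_ *: _]/((_ : R[i]) * _); field; rewrite z0 zh.
have nz2 : nm (z ^- 2 : C) = n ^- 2 by rewrite nmV expr2 nmM -expr2.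
have p : 0 < nm (z + h) by lra.
rewrite nmM nmM nmM nmV nz2 mulrC ler_wpM2r ?nm_ge0//.
rewrite -invfM ler_pdivrMr ?mulr_gt0 ?exprn_gt0//; apply: le_trans (ltW h2) _.
have -> : e * n ^+ 3 / 2 = e * (n / 2 * n ^+ 2) by field.
by rewrite ler_pM2l// ler_wpM2r// sqr_ge0.
Qed.

(* The mean value property is applied to the difference quotient at [0]. *)
Theorem cauchy_estimate f (D0 : W) (rho r M : R) : der f 0 D0 ->
  (forall z, 0 < nm z < rho -> exists D, der f z D) -> 0 < r < rho ->
  (forall z, nm z = r -> nm (f z) <= M) -> nm D0 <= 2 * M / r.
Proof.
move=> f0 fD rr fM; have /andP[r0 _] := rr.
pose g (z : C) : W := if z == 0 then D0 else (z : R[i])^-1 *: (f z - f 0).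
have g0 : g 0 = D0 by rewrite /g eqxx.
have gc : continuous_at g 0.
  move=> e e0; have [d d0 dP] := f0 _ e0; exists d => // h /dP; rewrite !add0r g0 /g.
  have [->|h0] := eqVneq h 0; first by move=> _; rewrite subrr nm0 ltW.
  move=> H; have -> : h^-1 *: (f h - f 0) - D0 = h^-1 *: (f h - f 0 - h *: D0).
    by rewrite [RHS]scalerBr scalerA mulVf// scale1r.
  by rewrite nmZ nmV mulrC ler_pdivrMr ?nm_gt0.
have gD z : 0 < nm z < rho -> exists D, der g z D.
  move=> zr; have [D zD] := fD z zr.
  have z0 : z != 0 by apply/eqP => E; move: zr; rewrite E nm0 ltxx.
  have dfz : der (fun y => f y - f 0) z D.
    have := difD zD (@dif_cst _ _ _ (- f 0) z); apply: dif_ext_lin => h; exact: addr0.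
  have := dif_scale (bounded_at_scale _) (bounded_at_scale _) (der_inv z0) dfz.
  exists ((z : R[i])^-1 *: D + (- (z : R[i]) ^- 2) *: (f z - f 0)).
  apply: dif_ext_lin (dif_ext _ H) => [h|] /=.
    by rewrite -![h *: (_ : C)]/((h : R[i]) * _); module.
  exists (nm z); first exact: nm_gt0.
  move=> h hz; rewrite /g; case: eqP => // E; move: hz.
  by have -> : h = - z by [apply/eqP; rewrite -addr_eq0 addrC E]; rewrite nmN ltxx.
apply/ler_addgt0Pr => e e0.
have [N /(_ N (leqnn N))] := cmean_cvg gc gD rr e0.
rewrite g0 nm_distC => H.
(* The value at the centre is a limit of means over the circle, hence also bounded by [M]; this
   bounds [f z - f 0] by [2 * M] and explains the factor 2. *)
have fM0 : nm (f 0) <= M.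
  apply/ler_addgt0Pr => e' e0'.
  have [N' /(_ N' (leqnn N')) H'] := cmean_cvg (der_continuous f0) fD rr e0'.
  have : nm (cmean N' f r - 0) <= M by apply: cmean_bound => // z /fM; rewrite subr0.
  rewrite subr0 => B; rewrite -(subKr (cmean N' f r) (f 0)).
  apply: le_trans (nmB _ _) _; lra.
have : nm (cmean N g r - 0) <= 2 * M / r.
  apply: cmean_bound => // z zr; rewrite subr0 /g.
  case: eqP => [E|_]; first by move: zr r0; rewrite E nm0 => <-; rewrite ltxx.
  rewrite nmZ nmV zr mulrC ler_wpM2r ?invr_ge0 ?(ltW r0)//.
  by apply: le_trans (nmB _ _) _; have := fM z zr; lra.
rewrite subr0 => H2; rewrite -(subrK (cmean N g r) D0); apply: le_trans (nmD _ _) _; lra.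
Qed.

End CircleMean.

(** * Higher Frechet derivatives of holomorphic maps *)

Section BoundedLinearMaps.
Variable R : realType.
Implicit Types X Y : normedModType R[i].

Lemma gt0_complexE (e : R[i]) : 0 < e -> e = (complex.Re e)%:C /\ 0 < complex.Re e.
Proof. by case: e => a b; rewrite ltcE /= => /andP[/eqP ->]. Qed.

Lemma near0P X (P : set X) : (\forall h \near (0 : X), P h) <->
  exists2 d : R, 0 < d & forall h, nm h < d -> P h.
Proof.
split=> [/nbhs_ballP[e /= /gt0_complexE[-> e0] eP]|[d d0 dP]].
  exists (complex.Re e) => // h hd; apply: eP; rewrite -ball_normE /= sub0r normrN.
  by rewrite -nmE ltcR.
apply/nbhs_ballP; exists d%:C => /=; first by rewrite ltcR.
by move=> h; rewrite -ball_normE /= sub0r normrN -nmE ltcR => /dP.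
Qed.

Lemma blin_apply X Y (A : 'L(X, Y)) x : nm (A x) <= nm A * nm x.
Proof. by rewrite -lecR rmorphM /= !nmE opnorm_apply. Qed.

Lemma blin_le X Y (A : 'L(X, Y)) (M : R) : 0 <= M -> (forall x, nm (A x) <= M * nm x) -> nm A <= M.
Proof.
move=> M0 AM; rewrite /nm /=; apply: opnorm_le => x x1.
rewrite -nmE lecR; apply: le_trans (AM x) _.
by rewrite ler_piMr// -lecR nmE.
Qed.

Lemma blin_bounded X Y (A : 'L(X, Y)) : bounded_at A.
Proof.
exists (nm A + 1) => [|h]; first by rewrite ltr_pwDr ?nm_ge0.
by apply: le_trans (blin_apply A h) _; rewrite ler_wpM2r ?nm_ge0// lerDl.
Qed.

Lemma blinD X Y (A : 'L(X, Y)) u v : A (u + v) = A u + A v.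
Proof. exact: (linearD A). Qed.

Lemma blinB X Y (A : 'L(X, Y)) u v : A (u - v) = A u - A v.
Proof. exact: (linearB A). Qed.

Lemma blinZ X Y (A : 'L(X, Y)) (a : R[i]) u : A (a *: u) = a *: A u.
Proof. exact: linearZZ. Qed.

Lemma blin_ext X Y (A B : 'L(X, Y)) : (forall x, A x = B x) -> A = B.
Proof. by move=> AB; apply/val_inj/funext. Qed.

Lemma blin_mk X Y (f : X -> Y) : linear f -> bounded_at f -> exists A : 'L(X, Y), forall x, A x = f x.
Proof.
move=> fl [M M0 fM].
have f0 : f 0 = 0 by have := fl (-1) 0 0; rewrite scaler0 addr0 scaleN1r addNr.
have fB u v : f (u - v) = f u - f v.
  by have := fl (-1) v u; rewrite !scaleN1r => E; rewrite addrC E addrC.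
have fc : continuous f.
  move=> x; apply/(@cvgrPdist_le _ _ _ (nbhs x)) => e /gt0_complexE[-> e0].
  have : \forall y \near x, nm (x - y) < complex.Re e / M.
    apply/nbhs_ballP; exists (complex.Re e / M)%:C => /=; first by rewrite ltcR divr_gt0.
    by move=> y; rewrite -ball_normE /= -nmE ltcR.
  apply: filterS => y; rewrite -fB -nmE lecR ltr_pdivlMr// => h.
  by apply: le_trans (fM _) _; rewrite mulrC ltW.
have fin : f \in @bounded_linear R X Y by apply/asboolP.
by exists (Blin fin).
Qed.

(** One step of the recursion for higher derivatives: [frechet n.+1 F] unfolds to
    [fd (frechet n F)]. *)
Definition fd X Y (G : X -> Y) (x : X) : 'L(X, Y) := insubd (0 : 'L(X, Y)) ('d G x : X -> Y).

Lemma fdP X Y (G : X -> Y) x : differentiable G x -> dif G x (fd G x).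
Proof.
move=> dG e e0.
have fdE : fd G x = 'd G x :> (X -> Y).
  rewrite /fd -[LHS]/(\val _) insubdK//; apply/asboolP; split; first exact: linearP.
  by case/diff_locallyP: dG.
have /diff_locally/eqaddoP/(_ e%:C) := dG.
rewrite ltcR => /(_ e0)/near0P[d d0 dP]; exists d => // h /dP.
rewrite -!nmE -rmorphM lecR /= fdE.
rewrite -[X in nm X <= _ -> _]/(G (h + x) - (G x + 'd G x h)) (addrC h).
by congr (nm _ <= _); module.
Qed.

Lemma dif_differentiable X Y (G : X -> Y) x (A : 'L(X, Y)) : dif G x A ->
  differentiable G x /\ fd G x = A.
Proof.
move=> dA.
have E : G \o shift x = cst (G x) + A +o_ (0 : X) id.
  apply/eqaddoP => e /gt0_complexE[-> e0]; have [d d0 dP] := dA _ e0.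
  apply/near0P; exists d => // h /dP H; rewrite -!nmE -rmorphM lecR /=.
  apply: le_trans H; rewrite -[X in nm X <= _]/(G (h + x) - (G x + A h)) (addrC h).
  by have -> : G (x + h) - (G x + A h) = G (x + h) - G x - A h by module.
have dE : 'd G x = A :> (X -> Y) by apply: diff_unique E; exact: blin_continuous.
split.
  apply/diff_locallyP; rewrite dE; split => //; exact: blin_continuous.
by apply: blin_ext => h; rewrite /fd dE -[LHS]/(\val _ h) insubdK// (valP A).
Qed.

(** Completeness for sequences with geometric increments, with the rate of convergence built in. In
    this form it passes from [Y] to ['L(X, Y)], hence to every [mlin X X n], without a structure of
    complete space on bounded maps. *)
Definition geom_complete (Z : normedModType R[i]) := forall (u : nat -> Z) (c : R),
  (forall n, nm (u n.+1 - u n) <= c * dy R n) ->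
  exists l, forall n, nm (u n - l) <= 2 * c * dy R n.

Lemma geom_cauchy (Z : normedModType R[i]) (u : nat -> Z) (c : R) :
  (forall n, nm (u n.+1 - u n) <= c * dy R n) ->
  forall n k, nm (u (n + k)%N - u n) <= 2 * c * (dy R n - dy R (n + k)).
Proof.
move=> uc n; elim=> [|k IH]; first by rewrite addn0 !subrr nm0 mulr0.
rewrite addnS; have -> : u (n + k).+1 - u n = (u (n + k).+1 - u (n + k)%N) + (u (n + k)%N - u n).
  by rewrite addrA subrK.
apply: le_trans (nmD _ _) _; have := uc (n + k)%N; rewrite (dyS R (n + k)) in IH *.
lra.
Qed.

Lemma geom_complete_banach (X : completeNormedModType R[i]) : geom_complete X.
Proof.
move=> u c uc.
have c0 : 0 <= c.
  by have := le_trans (nm_ge0 _) (uc 0%N); rewrite pmulr_lge0 ?dy_gt0.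
have uB n k : nm (u (n + k)%N - u n) <= 2 * c * dy R n.
  apply: le_trans (geom_cauchy uc n k) _; rewrite ler_wpM2l ?mulr_ge0//.
  by rewrite gerBl ltW ?dy_gt0.
have : cvg (u @ \oo).
  apply: cauchy_cvg; apply/cauchyP => e /gt0_complexE[-> e0].
  have [n nP] := @dy_small R (complex.Re e / (2 * c + 1)) ltac:(rewrite divr_gt0//; lra).
  exists (u n); exists n => //= m /= nm; rewrite -(subnKC nm) -ball_normE /= -nmE ltcR nm_distC.
  apply: le_lt_trans (uB n (m - n)%N) _; move: nP; rewrite ltr_pdivlMr; last lra.
  have := dy_gt0 R n; nra.
move=> /cvgrPdist_le ul; exists (lim (u @ \oo)) => n.
apply/ler_addgt0Pr => e e0.
have /ul[N _ NP] : (0 : R[i]) < e%:C by rewrite ltcR.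
have := NP (n + N)%N; rewrite /= leq_addl -nmE lecR => /(_ isT) h.
have -> : u n - lim (u @ \oo) = (u n - u (n + N)%N) - (lim (u @ \oo) - u (n + N)%N).
  by rewrite opprB addrA subrK.
apply: le_trans (nmB _ _) _; have := uB n N; rewrite nm_distC; lra.
Qed.

Lemma dy_le1 n : dy R n <= 1.
Proof. by rewrite /dy exprn_ile1// ?invr_ge0// invf_le1// ler1n. Qed.

Lemma dy_homo m n : (m <= n)%N -> dy R n <= dy R m.
Proof.
move=> mn; rewrite /dy -(subnKC mn) exprD ler_piMr ?exprn_ge0 ?invr_ge0//; exact: dy_le1.
Qed.

Lemma dy_limit (x b c : R) N : (forall n, (N <= n)%N -> x <= b + c * dy R n) -> x <= b.
Proof.
move=> h; apply/ler_addgt0Pr => e e0.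
have c1 : 0 < `|c| + 1 by rewrite ltr_pwDr.
have [n] := @dy_small R (e / (`|c| + 1)) ltac:(by rewrite divr_gt0).
rewrite ltr_pdivlMr// => nP.
apply: le_trans (h (maxn N n) (leq_maxl _ _)) _; rewrite lerD2l.
have := dy_homo (leq_maxr N n); have := dy_gt0 R (maxn N n); have := ler_norm c; have := normr_ge0 c.
move: (`|c|) nP => k; nra.
Qed.

(** Limits exist pointwise; their rate is proportional to [nm h], so the limit map is bounded and
    the convergence holds in the operator norm. *)
Lemma geom_complete_blin X Y : geom_complete Y -> geom_complete 'L(X, Y).
Proof.
move=> Yc u c uc.
have c0 : 0 <= c by have := le_trans (nm_ge0 _) (uc 0%N); rewrite pmulr_lge0 ?dy_gt0.
have /choice[f fP] : forall h : X, exists l : Y, forall n, nm (u n h - l) <= 2 * (c * nm h) * dy R n.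
  move=> h; apply: Yc => n; rewrite -[_ - _]/((u n.+1 - u n : 'L(X, Y)) h).
  apply: le_trans (blin_apply _ _) _; rewrite mulrAC ler_wpM2r ?nm_ge0//.
have f_lin : linear f.
  move=> a h k; apply/eqP; rewrite -subr_eq0; apply/eqP.
  apply/nm_eq0/eqP; rewrite eq_le nm_ge0 andbT.
  pose M := 2 * c * (nm (a *: h + k) + nm (a : R[i]^o) * nm h + nm k).
  apply: (@dy_limit _ _ M 0) => n _; rewrite add0r.
  have -> : f (a *: h + k) - (a *: f h + f k) =
     - ((u n (a *: h + k) - f (a *: h + k)) - a *: (u n h - f h) - (u n k - f k)).
    by rewrite blinD blinZ; module.
  rewrite nmN; apply: le_trans (nmB _ _) _; have := nmB (u n (a *: h + k) - f (a *: h + k)) (a *: (u n h - f h)).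
  have := fP (a *: h + k) n; have := fP k n; have := ler_wpM2l (nm_ge0 (a : R[i]^o)) (fP h n).
  rewrite nmZ /M; lra.
have f_bd : bounded_at f.
  exists (nm (u 0%N) + 2 * c + 1) => [|h]; first by have := nm_ge0 (u 0%N); lra.
  have -> : f h = u 0%N h - (u 0%N h - f h) by rewrite subKr.
  apply: le_trans (nmB _ _) _; have := fP h 0%N; have := blin_apply (u 0%N) h.
  have := nm_ge0 h; rewrite /dy expr0; lra.
have [A AE] := blin_mk f_lin f_bd.
exists A => n; apply: blin_le; first by rewrite !mulr_ge0// ltW ?dy_gt0.
move=> h; rewrite -[(_ - _ : 'L(X, Y)) h]/(u n h - A h) AE.
by apply: le_trans (fP h n) _; lra.
Qed.

(* The maps [2^n D (2^-n h)] converge geometrically to the linear part of [D]. *)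
Lemma almost_linear X (Z : normedModType R[i]) (D : X -> Z) (d K : R) : geom_complete Z ->
  0 < d -> 0 <= K ->
  (forall h, nm h < d -> nm (D h) <= K * nm h) ->
  (forall h k, nm h < d -> nm k < d -> nm (D (h + k) - D h - D k) <= K * (nm h + nm k) ^+ 2) ->
  (forall (a : R[i]) h, nm h < d -> nm (a *: h) < d ->
     nm (D (a *: h) - a *: D h) <= K * (nm (a : R[i]^o) ^+ 2 + nm (a : R[i]^o)) * nm h ^+ 2) ->
  exists A : 'L(X, Z), dif D 0 A.
Proof.
move=> Zc d0 K0 D1 DD DZ.
have n2 n : nm (2 ^+ n : R[i]^o) = (dy R n)^-1.
  by rewrite -natrX nm_nat /dy exprVn invrK natrX.
have n2d n : nm (2 ^+ n : R[i]^o) * dy R n = 1 by rewrite n2 mulVf// gt_eqF ?dy_gt0.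
have ndy n (h : X) : nm ((dy R n)%:C *: h) = dy R n * nm h.
  by rewrite nmZ nm_real gtr0_norm ?dy_gt0.
pose u h n : Z := (2 ^+ n : R[i]) *: D ((dy R n)%:C *: h).
have uS h n : dy R n * nm h < d -> nm (u h n.+1 - u h n) <= 2 * K * nm h ^+ 2 * dy R n.
  move=> hd; pose k := (dy R n)%:C *: h.
  have half : nm (2^-1 : R[i]^o) = 2^-1 by rewrite nmV nm_nat.
  have -> : u h n.+1 - u h n = (2 ^+ n.+1 : R[i]) *: (D ((2^-1 : R[i]) *: k) - (2^-1 : R[i]) *: D k).
    have -> (x y : Z) : (2 ^+ n.+1 : R[i]) *: (x - (2^-1 : R[i]) *: y) = 2 ^+ n.+1 *: x - 2 ^+ n *: y.
      by rewrite scalerBr scalerA exprSr mulfK ?pnatr_eq0.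
    rewrite /u; congr (_ *: D _ - _).
    by rewrite /k scalerA /dy exprS rmorphM /= fmorphV rmorph_nat.
  have kd : nm k < d by rewrite ndy.
  rewrite nmZ exprSr nmM nm_nat.
  have := DZ 2^-1 k kd; rewrite nmZ half => /(_ ltac:(have := nm_ge0 k; lra)).
  rewrite -(ler_pM2l (x := nm (2 ^+ n : R[i]^o) * 2)) ?mulr_gt0 ?n2 ?invr_gt0 ?dy_gt0//.
  move=> /le_trans; apply; rewrite -n2 ndy.
  have -> : nm (2 ^+ n : R[i]^o) * 2 * (K * (2^-1 ^+ 2 + 2^-1) * (dy R n * nm h) ^+ 2) =
    (nm (2 ^+ n : R[i]^o) * dy R n) * (3 / 2 * K * nm h ^+ 2 * dy R n) by field.
  rewrite n2d mul1r ler_wpM2r ?ler_wpM2r ?sqr_ge0 ?(ltW (dy_gt0 _ _))//; lra.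
have small (h : X) : exists N, forall n, (N <= n)%N -> dy R n * nm h < d.
  have n0 : 0 < nm h + 1 by rewrite ltr_pwDr ?nm_ge0.
  have [N NP] := @dy_small R (d / (nm h + 1)) ltac:(by rewrite divr_gt0).
  exists N => n /dy_homo nN; move: NP; rewrite ltr_pdivlMr//.
  have := dy_gt0 R n; have := nm_ge0 h; nra.
(* For a large [h] the rescaled points enter the ball of radius [d] only from some [N] on, which
   suffices for the existence of the limit. If [h] is in the ball already, [N] is 0 and the whole
   sequence counts: this gives the quadratic error [4 * K * nm h ^+ 2], from which differentiability
   follows. *)
have /choice[f fP] : forall h, exists l, (exists N c, forall n, (N <= n)%N -> nm (u h n - l) <= c * dy R n)
    /\ (nm h < d -> nm (D h - l) <= 4 * K * nm h ^+ 2).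
  move=> h.
  have [N [NP N0]] : exists N, (forall n, (N <= n)%N -> dy R n * nm h < d) /\ (nm h < d -> N = 0%N).
    have [hd|] := boolP (nm h < d); last by move=> /negP H; have [N NP] := small h; exists N.
    exists 0%N; split=> // n _; apply: le_lt_trans hd.
    by rewrite ler_piMl ?nm_ge0// dy_le1.
  have [|l lP] := Zc (fun n => u h (N + n)%N) (2 * K * nm h ^+ 2 * dy R N).
    move=> n; rewrite addnS; apply: le_trans (uS _ _ (NP _ (leq_addr _ _))) _.
    by rewrite /dy exprD !mulrA.
  exists l; split.
    exists N, (4 * K * nm h ^+ 2) => n Nn; have := lP (n - N)%N; rewrite subnKC// => /le_trans; apply.
    by rewrite -{2}(subnKC Nn) /dy exprD; lra.
  move=> hd; have := lP 0%N; rewrite N0// addn0 /u /dy !expr0 !scale1r; lra.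
have f_bd h : nm (f h) <= K * nm h.
  have [[N [c cP]] _] := fP h; have [N' N'P] := small h.
  apply: (@dy_limit _ _ c (maxn N N')) => n; rewrite geq_max => /andP[/cP h1 /N'P h2].
  have := D1 ((dy R n)%:C *: h); rewrite ndy => /(_ h2) h3.
  have : nm (u h n) <= K * nm h.
    rewrite nmZ; apply: le_trans (ler_wpM2l (nm_ge0 _) h3) _.
    have -> : nm (2 ^+ n : R[i]^o) * (K * (dy R n * nm h)) = (nm (2 ^+ n : R[i]^o) * dy R n) * (K * nm h) by ring.
    by rewrite n2d mul1r.
  rewrite -(subKr (u h n) (f h)); have := nmB (u h n) (u h n - f h); lra.
have f_lin : linear f.
  move=> a h k; apply/eqP; rewrite -subr_eq0; apply/eqP.
  have [[N1 [c1 h1]] _] := fP (a *: h + k); have [[N2 [c2 h2]] _] := fP h; have [[N3 [c3 h3]] _] := fP k.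
  have [N4 h4] := small h; have [N5 h5] := small k; have [N6 h6] := small (a *: h).
  set na := nm (a : R[i]^o).
  pose M := K * (na * nm h + nm k) ^+ 2 + K * (na ^+ 2 + na) * nm h ^+ 2.
  apply/nm_eq0/eqP; rewrite eq_le nm_ge0 andbT.
  apply: (@dy_limit _ _ (c1 + na * c2 + c3 + M) (maxn (maxn N1 N2) (maxn (maxn N3 N4) (maxn N5 N6)))) => n.
  rewrite !geq_max => /andP[/andP[/h1 {}h1 /h2 {}h2] /andP[/andP[/h3 {}h3 /h4 {}h4] /andP[/h5 {}h5 /h6 {}h6]]].
  set x := (dy R n)%:C *: h; set y := (dy R n)%:C *: k.
  have axE : (dy R n)%:C *: (a *: h) = a *: x by rewrite /x !scalerA mulrC.
  have xd : nm x < d by rewrite ndy.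
  have yd : nm y < d by rewrite ndy.
  have axd : nm (a *: x) < d by rewrite -axE ndy.
  have H1 := DD _ _ axd yd; have H2 := DZ _ _ xd axd.
  (* At scale 2^-n the defect of linearity is of order 4^-n; multiplied by 2^n it still tends to
     0. *)
  have H3 : nm (u (a *: h + k) n - a *: u h n - u k n) <= M * dy R n.
    have -> : u (a *: h + k) n - a *: u h n - u k n =
       (2 ^+ n : R[i]) *: ((D (a *: x + y) - D (a *: x) - D y) + (D (a *: x) - a *: D x)).
      by rewrite /u scalerDr axE -/x -/y; module.
    rewrite nmZ; apply: le_trans (ler_wpM2l (nm_ge0 _) (le_trans (nmD _ _) (lerD H1 H2))) _.
    rewrite -axE !ndy nmZ -/na.
    have -> : (K * (dy R n * (na * nm h) + dy R n * nm k) ^+ 2 + K * (na ^+ 2 + na) * (dy R n * nm h) ^+ 2)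
       = dy R n * (M * dy R n) by rewrite /M; ring.
    by rewrite [leLHS]mulrA n2d mul1r.
  have -> : f (a *: h + k) - (a *: f h + f k) = (u (a *: h + k) n - a *: u h n - u k n)
     - ((u (a *: h + k) n - f (a *: h + k)) - a *: (u h n - f h) - (u k n - f k)) by module.
  apply: le_trans (nmB _ _) _.
  have := nmB (u (a *: h + k) n - f (a *: h + k) - a *: (u h n - f h)) (u k n - f k).
  have := nmB (u (a *: h + k) n - f (a *: h + k)) (a *: (u h n - f h)).
  have := ler_wpM2l (nm_ge0 (a : R[i]^o)) h2; rewrite -/na nmZ -/na; lra.
have [A AE] : exists A : 'L(X, Z), forall x, A x = f x.
  apply: blin_mk => //; exists (K + 1) => [|h]; first lra.
  by apply: le_trans (f_bd h) _; rewrite ler_wpM2r ?nm_ge0// lerDl.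
exists A => e e0.
have e4 : 0 < e / (4 * K + 1) by rewrite divr_gt0//; lra.
exists (Num.min d (e / (4 * K + 1))); first by rewrite lt_min d0.
have D0 : D 0 = 0 by apply/nm_eq0/eqP; rewrite eq_le nm_ge0 andbT; have := D1 0; rewrite nm0 mulr0; apply.
move=> h; rewrite lt_min add0r D0 subr0 AE => /andP[hd he].
have [_ /(_ hd) h1] := fP h; apply: le_trans h1 _.
rewrite expr2 mulrA ler_wpM2r ?nm_ge0//; move: he; rewrite ltr_pdivlMr; last lra.
have := nm_ge0 h; lra.
Qed.

End BoundedLinearMaps.

Section Holomorphic.
Variables (R : realType) (X Y : normedModType R[i]).
Local Notation C := (R[i]^o).
Implicit Types (G : X -> Y) (x y v : X).

Lemma dif_shift G y k (A : X -> Y) : dif G (y + k) A -> dif (fun z => G (z + k)) y A.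
Proof. by move=> dG e /dG[d d0 dP]; exists d => // h /dP; rewrite (addrAC y). Qed.

Lemma dif_blin (A : 'L(X, Y)) y : dif A y A.
Proof.
move=> e e0; exists 1 => // h _.
have -> : A (y + h) - A y - A h = 0 by rewrite blinD; module.
by rewrite nm0 mulr_ge0 ?nm_ge0// ltW.
Qed.

Lemma dif_blinD G H y (A B : 'L(X, Y)) : dif G y A -> dif H y B ->
  dif (fun z => G z + H z) y (A + B : 'L(X, Y)).
Proof. exact: difD. Qed.

Lemma dif_blinZ G y (a : R[i]) (A : 'L(X, Y)) : dif G y A ->
  dif (fun z => a *: G z) y (a *: A : 'L(X, Y)).
Proof.
move=> dG; apply: (@dif_lin _ _ _ _ (fun u : Y => a *: u)) dG => [u v|].
  exact: scalerBr.
exists (nm (a : C) + 1) => [|h]; first by rewrite ltr_pwDr ?nm_ge0.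
by rewrite nmZ ler_wpM2r ?nm_ge0// lerDl.
Qed.

Lemma dif_blinB G H y (A B : 'L(X, Y)) : dif G y A -> dif H y B ->
  dif (fun z => G z - H z) y (A - B : 'L(X, Y)).
Proof.
move=> dG /(dif_blinZ (-1)); rewrite scaleN1r => dH.
by have := dif_blinD dG dH; apply: dif_ext; exists 1 => // h _; rewrite scaleN1r.
Qed.

Lemma der_slice G y v (z : C) (A : 'L(X, Y)) : dif G (y + (z : R[i]) *: v) A ->
  der (fun w : C => G (y + (w : R[i]) *: v)) z (A v).
Proof.
move=> dA.
have dv : dif (fun w : C => y + (w : R[i]) *: v) z (fun h : C => (h : R[i]) *: v).
  move=> e e0; exists 1 => // h _.
  have -> : y + (z + h : R[i]) *: v - (y + (z : R[i]) *: v) - (h : R[i]) *: v = 0 by module.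
  by rewrite nm0 mulr_ge0 ?nm_ge0// ltW.
have := dif_comp (bounded_at_scale v) (blin_bounded A) (blinD A) dv dA.
by apply: dif_ext_lin => h; rewrite blinZ.
Qed.

Lemma mean_value_segment G y v (B : R -> 'L(X, Y)) (K : R) :
  (forall t, 0 <= t <= 1 -> dif G (y + t%:C *: v) (B t)) ->
  (forall t, 0 <= t <= 1 -> nm (B t v) <= K) -> nm (G (y + v) - G y) <= K.
Proof.
move=> dG BK.
have := @mean_value _ _ (fun w : C => G (y + (w : R[i]) *: v)) (fun t => B t v) K.
rewrite scale1r scale0r addr0; apply => // t t01.
by apply: der_slice; apply: dG.
Qed.

(** Cauchy's estimate on each complex line through [y]. The circle has half the radius of the
    available disc so as to lie inside it, hence 4 instead of 2. *)
Lemma cauchy_ball G y (A : 'L(X, Y)) (rho M : R) : 0 < rho -> dif G y A ->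
  (forall h, nm h < rho -> (exists B : 'L(X, Y), dif G (y + h) B) /\ nm (G (y + h)) <= M) ->
  nm A <= 4 * M / rho.
Proof.
move=> r0 dA GP.
have M0 : 0 <= M by have [_] := GP 0 ltac:(by rewrite nm0); exact/le_trans/nm_ge0.
apply: blin_le => [|v]; first by rewrite divr_ge0 ?mulr_ge0 ?(ltW r0).
have [->|v0] := eqVneq v 0; first by rewrite (linear0 A) !nm0 mulr0.
have nv := nm_gt0 v0.
have -> : 4 * M / rho * nm v = 2 * M / (rho / 2 / nm v).
  by field; rewrite !gt_eqF.
pose f (w : C) := G (y + (w : R[i]) *: v).
have vr (w : C) : nm w < rho / nm v -> nm ((w : R[i]) *: v) < rho by rewrite nmZ ltr_pdivlMr.
apply: (@cauchy_estimate _ _ f _ (rho / nm v)).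
- by apply: der_slice; rewrite scale0r addr0.
- by move=> w /andP[_ /vr/GP[[B dB] _]]; exists (B v); apply: der_slice.
- by rewrite !divr_gt0//= ltr_pM2r ?invr_gt0//; lra.
- by move=> w wr; apply: (GP _ (vr w _)).2; rewrite wr ltr_pM2r ?invr_gt0//; lra.
Qed.

(* Cauchy's estimate on balls turns second-order bounds on [G] into second-order
   bounds on its derivative in the operator norm. *)
Theorem fd_differentiable G x (rho : R) : geom_complete Y -> 0 < rho ->
  (forall h, nm h < rho -> differentiable G (x + h)) -> differentiable (fd G) x.
Proof.
move=> Yc rho0 GD.
have dG h : nm h < rho -> dif G (x + h) (fd G (x + h)) by move=> /GD/fdP.
have dG0 : dif G x (fd G x) by have := dG 0; rewrite nm0 addr0; apply.
have [d d0 dP] := dif_continuous (blin_bounded _) dG0 ltr01.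
pose M := nm (G x) + 1; have M0 : 0 <= M by rewrite addr_ge0 ?nm_ge0.
have GM h : nm h < d -> nm (G (x + h)) <= M.
  move=> /dP H; rewrite -(subrK (G x) (G (x + h))); apply: le_trans (nmD _ _) _.
  by rewrite addrC lerD2l.
(* Room for the nested balls: [G] is bounded and differentiable at distance 8 r, its derivative [A]
   is bounded at distance 4 r, and increments by up to 2 r are then estimated at base points within
   r or 2 r. *)
pose r := Num.min d rho / 8.
have r0 : 0 < r by rewrite divr_gt0// lt_min d0.
have rd : 8 * r <= d.
  have : Num.min d rho <= d by rewrite ge_min lexx.
  by rewrite /r; lra.
have rrho : 8 * r <= rho.
  have : Num.min d rho <= rho by rewrite ge_min lexx orbT.
  by rewrite /r; lra.
clearbody r M; clear d0 dP.
pose A h := fd G (x + h).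
have dA h : nm h < 8 * r -> dif G (x + h) (A h) by move=> hr; apply: dG; lra.
have tri (h k : X) : nm (h + k) <= nm h + nm k := nmD h k.
pose C1 := M / r; have C10 : 0 <= C1 by rewrite divr_ge0// ltW.
have AC1 h : nm h < 4 * r -> nm (A h) <= C1.
  move=> hr; apply: le_trans (cauchy_ball (rho := 4 * r) (M := M) _ (dA h _) _) _; [lra|lra| |].
    move=> k kr; have := tri h k; rewrite -addrA => hk; split; last by apply: GM; lra.
    by exists (A (h + k)); apply: dA; lra.
  by rewrite /C1 le_eqVlt; apply/orP; left; apply/eqP; field; rewrite gt_eqF.
have tn (t : R) (k : X) : 0 <= t <= 1 -> nm (t%:C *: k) <= nm k.
  by move=> /andP[t0 t1]; rewrite nmZ nm_real ger0_norm// ler_piMl ?nm_ge0.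
have GL h k : nm h < 2 * r -> nm k < 2 * r -> nm (G (x + h + k) - G (x + h)) <= C1 * nm k.
  move=> hr kr; apply: (@mean_value_segment _ _ _ (fun t => A (h + t%:C *: k))) => t /tn tk; have := tri h (t%:C *: k) => H.
    by rewrite -addrA; apply: dA; have := tk k; lra.
  apply: le_trans (blin_apply _ _) _; rewrite ler_wpM2r ?nm_ge0//; apply: AC1; have := tk k; lra.
have dT h k : nm (h + k) < 8 * r -> dif (fun z => G (z + k)) (x + h) (A (h + k)).
  by move=> hk; apply: dif_shift; rewrite -addrA; apply: dA.
pose C2 := 4 * C1 / r; have C20 : 0 <= C2 by apply: divr_ge0; [exact: mulr_ge0|exact: ltW].
(* [A (h + k) - A h] is the derivative of the increment of [G] by [k], which is small on a whole
   ball by [GL]; Cauchy's estimate makes [A] Lipschitz in the operator norm. *)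
have AL h k : nm h < r -> nm k < 2 * r -> nm (A (h + k) - A h) <= C2 * nm k.
  move=> hr kr; have := tri h k => thk.
  have -> : C2 * nm k = 4 * (C1 * nm k) / r by rewrite /C2; field; rewrite gt_eqF.
  apply: (cauchy_ball r0 (dif_blinB (dT h k _) (dA h _))); [lra|lra|].
  move=> l lr; have := tri h l; have := tri (h + l) k => t1 t2.
  split; last by rewrite -[x + h + l]addrA; apply: GL; lra.
  by exists (A (h + l + k) - A (h + l)); rewrite -[x + h + l]addrA; apply: dif_blinB; [apply: dT|apply: dA]; lra.
(* The mean value inequality for [G] minus its linear part at [x + h], whose derivative is
   controlled by [AL]. *)
have GE h k : nm h < r -> nm k < 2 * r -> nm (G (x + h + k) - G (x + h) - A h k) <= C2 * nm k ^+ 2.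
  move=> hr kr.
  have -> : G (x + h + k) - G (x + h) - A h k = (G (x + h + k) - A h (x + h + k)) - (G (x + h) - A h (x + h)).
    by rewrite !blinD; module.
  apply: (@mean_value_segment (fun z => G z - A h z) _ _ (fun t => A (h + t%:C *: k) - A h)) => t t01.
    have := tri h (t%:C *: k); have := tn t k t01 => H1 H2.
    by apply: dif_blinB (dif_blin _ _); rewrite -addrA; apply: dA; lra.
  apply: le_trans (blin_apply _ _) _; rewrite expr2 mulrA ler_wpM2r ?nm_ge0//.
  have tk := tn t k t01; apply: le_trans (AL _ _ hr _) _; first lra.
  by rewrite ler_wpM2l.
have A0 : fd G x = A 0 by rewrite /A addr0.
(* [K] dominates the three constants asked for by [almost_linear]: C2 for the size, 12 C2 / r for
   additivity (second differences bounded by 3 C2 through [GE], times 4 / r from Cauchy's estimate),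
   and 4 C2 / r for homogeneity. *)
pose K := C2 + 12 * C2 / r.
have K1 : C2 <= K by rewrite lerDl; apply: divr_ge0; [exact: mulr_ge0|exact: ltW].
have K2 : 12 * C2 / r <= K by rewrite lerDr.
have K3 : 4 * C2 / r <= K.
  by apply: le_trans K2; rewrite ler_pM2r ?invr_gt0//; lra.
have r2 (h : X) : nm h < r -> nm h < 2 * r by move=> ?; lra.
have z0 : nm (0 : X) = 0 := nm0 X.
have [|h hr|h k hr kr|a h hr ahr|B dB] :=
    @almost_linear _ _ _ (fun h => A h - A 0 : 'L(X, Y)) r K (geom_complete_blin Yc) r0.
- exact: le_trans C20 K1.
- have := @AL 0 h; rewrite z0 add0r => /(_ r0 (r2 _ hr)) H; apply: le_trans H _.
  by rewrite ler_wpM2r ?nm_ge0.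
- have -> : A (h + k) - A 0 - (A h - A 0) - (A k - A 0) =
      A (0 + (h + k)) - A (0 + h) - (A (0 + k) - A 0).
    by rewrite !add0r; move: (A (h + k)) (A h) (A k) (A 0) => a1 a2 a3 a4; module.
  have thk := tri h k.
  have := @cauchy_ball (fun z => G (z + (h + k)) - G (z + h) - (G (z + k) - G z)) (x + 0)
     (A (0 + (h + k)) - A (0 + h) - (A (0 + k) - A 0)) r (C2 * 3 * (nm h + nm k) ^+ 2) r0.
  move=> H; apply: le_trans (H _ _) _ => {H}.
  + by apply: dif_blinB; apply: dif_blinB; [apply: dT|apply: dT|apply: dT|apply: dA]; rewrite ?add0r ?z0; lra.
  + move=> l lr; rewrite addr0; have := tri l (h + k); have := tri l h; have := tri l k => t1 t2 t3.
    split.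
      exists (A (l + (h + k)) - A (l + h) - (A (l + k) - A l)).
      by apply: dif_blinB; apply: dif_blinB; [apply: dT|apply: dT|apply: dT|apply: dA]; lra.
    have -> : G (x + l + (h + k)) - G (x + l + h) - (G (x + l + k) - G (x + l)) =
      (G (x + l + (h + k)) - G (x + l) - A l (h + k)) - (G (x + l + h) - G (x + l) - A l h)
        - (G (x + l + k) - G (x + l) - A l k) by rewrite blinD; module.
    apply: le_trans (nmB _ _) _; apply: le_trans (lerD (nmB _ _) (lexx _)) _.
    have := GE l (h + k) lr ltac:(lra); have := GE l h lr (r2 _ hr); have := GE l k lr (r2 _ kr).
    have := nm_ge0 h; have := nm_ge0 k; have := nm_ge0 (h + k).
    have s1 : nm (h + k) ^+ 2 <= (nm h + nm k) ^+ 2.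
      by rewrite ler_pXn2r// nnegrE ?addr_ge0 ?nm_ge0.
    have s2 : nm h ^+ 2 + nm k ^+ 2 <= (nm h + nm k) ^+ 2.
      by have := mulr_ge0 (nm_ge0 h) (nm_ge0 k); nra.
    have := ler_wpM2l C20 s1; have := ler_wpM2l C20 s2.
    have : 0 <= C2 * (nm h + nm k) ^+ 2 by rewrite mulr_ge0 ?sqr_ge0.
    lra.
  + have -> : 4 * (C2 * 3 * (nm h + nm k) ^+ 2) / r = 12 * C2 / r * (nm h + nm k) ^+ 2 by field; rewrite gt_eqF.
    by rewrite ler_wpM2r ?sqr_ge0.
- have -> : A (a *: h) - A 0 - a *: (A h - A 0) = A (0 + a *: h) - A 0 - a *: (A (0 + h) - A 0) by rewrite !add0r.
  set na := nm (a : C); have na0 : 0 <= na := nm_ge0 _.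
  have nah : nm (a *: h) = na * nm h by rewrite nmZ.
  have := @cauchy_ball (fun z => G (z + a *: h) - G z - a *: (G (z + h) - G z)) (x + 0)
     (A (0 + a *: h) - A 0 - a *: (A (0 + h) - A 0)) r (C2 * (na ^+ 2 + na) * nm h ^+ 2) r0.
  move=> H; apply: le_trans (H _ _) _ => {H}.
  + by apply: dif_blinB; [apply: dif_blinB|apply: dif_blinZ; apply: dif_blinB];
      [apply: dT|apply: dA|apply: dT|apply: dA]; rewrite ?add0r ?z0; lra.
  + move=> l lr; rewrite addr0; have := tri l (a *: h); have := tri l h => t1 t2.
    split.
      exists (A (l + a *: h) - A l - a *: (A (l + h) - A l)).
      by apply: dif_blinB; [apply: dif_blinB|apply: dif_blinZ; apply: dif_blinB];
        [apply: dT|apply: dA|apply: dT|apply: dA]; lra.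
    have -> : G (x + l + a *: h) - G (x + l) - a *: (G (x + l + h) - G (x + l)) =
      (G (x + l + a *: h) - G (x + l) - A l (a *: h)) - a *: (G (x + l + h) - G (x + l) - A l h).
      by rewrite blinZ; module.
    apply: le_trans (nmB _ _) _; rewrite nmZ -/na.
    have := GE l (a *: h) lr (r2 _ ahr); have := ler_wpM2l na0 (GE l h lr (r2 _ hr)).
    rewrite nah; lra.
  + have -> : 4 * (C2 * (na ^+ 2 + na) * nm h ^+ 2) / r = 4 * C2 / r * (na ^+ 2 + na) * nm h ^+ 2 by field; rewrite gt_eqF.
    by rewrite ler_wpM2r ?sqr_ge0// ler_wpM2r// addr_ge0 ?sqr_ge0.
apply: (@dif_differentiable _ _ _ _ _ B _).1.
move=> e e0; have [d' d'0 H] := dB e e0; exists d'; first exact: d'0.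
by move=> h hd; have := H h hd; rewrite add0r subrr subr0 -A0.
Qed.

End Holomorphic.

Section FrechetTower.
Variables (R : realType) (X : completeNormedModType R[i]).
Local Notation C := (R[i]^o).

Lemma geom_complete_mlin n : geom_complete (mlin X X n).
Proof.
by elim: n => [|n IH]; [exact: geom_complete_banach|exact: geom_complete_blin].
Qed.

Lemma frechet_differentiable (F : X -> X) n : holomorphic (@unit_ball R X) F ->
  holomorphic (@unit_ball R X) (frechet n F : X -> mlin X X n).
Proof.
move=> Fh; elim: n => [//|n IH] x; rewrite /unit_ball /= -nmE -(rmorph1 (real_complex R)) ltcR => x1.
apply: (@fd_differentiable _ _ _ (frechet n F : X -> mlin X X n) x (1 - nm x)).
- exact: geom_complete_mlin.
- by rewrite subr_gt0.
- move=> h h1; apply: IH; rewrite /unit_ball /= -nmE -(rmorph1 (real_complex R)) ltcR.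
  by have := nmD x h; lra.
Qed.

End FrechetTower.

(** * Coefficients of functions with positive real part *)

Section Caratheodory.
Variable R : realType.
Local Notation C := (R[i]^o).

Lemma nm_sqr (z : C) : nm z ^+ 2 = complex.Re z ^+ 2 + complex.Im z ^+ 2.
Proof. by apply: complexI; rewrite add_Re2_Im2 rmorphXn /= cnmE. Qed.

Lemma nmX (z : C) n : nm (z ^+ n : C) = nm z ^+ n.
Proof. by elim: n => [|n IH]; rewrite ?expr0 ?nm1// !exprS nmM IH. Qed.

Lemma der_mul (f g : C -> C) (z a b : C) : der f z a -> der g z b ->
  der (fun w => f w * g w : C) z (f z * b + a * g z).
Proof.
move=> df dg; have := dif_scale (bounded_at_scale a) (bounded_at_scale b) df dg.
by apply: dif_ext_lin => h; rewrite -![_ *: _]/((_ : R[i]) * _); ring.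
Qed.

Lemma der_id (z : C) : der (fun w : C => w) z (1 : C).
Proof. by apply: dif_ext_lin (@dif_id _ _ z) => h; rewrite -[_ *: _]/((_ : R[i]) * _) mulr1. Qed.

Lemma der_cst (c z : C) : der (fun=> c) z (0 : C).
Proof. by apply: dif_ext_lin (@dif_cst _ _ _ c z) => h; rewrite scaler0. Qed.

Lemma der_add (W : normedModType R[i]) (f g : C -> W) z a b : der f z a -> der g z b -> der (fun w => f w + g w) z (a + b).
Proof. by move=> df dg; apply: dif_ext_lin (difD df dg) => h; rewrite scalerDr. Qed.

Lemma der_pow n (z : C) : exists D, der (fun w : C => w ^+ n : C) z D.
Proof.
elim: n => [|n [D IH]].
  by exists 0; apply: dif_ext (der_cst 1 z); exists 1 => // h _; rewrite expr0.
exists (z * D + 1 * z ^+ n); have := der_mul (der_id z) IH.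
by apply: dif_ext; exists 1 => // h _; rewrite exprS.
Qed.

Definition mean_to (f : C -> C) (r : R) (L : C) := forall e : R, 0 < e ->
  exists N, forall n, (N <= n)%N -> nm (cmean n f r - L) <= e.

Lemma mean_toD f g r L M : mean_to f r L -> mean_to g r M -> mean_to (fun z => f z + g z) r (L + M).
Proof.
move=> hf hg e e0; have e2 : 0 < e / 2 by rewrite divr_gt0.
have [N1 h1] := hf _ e2; have [N2 h2] := hg _ e2.
exists (maxn N1 N2) => n; rewrite geq_max => /andP[/h1 H1 /h2 H2].
rewrite /cmean avgD -!/(cmean _ _ _).
have -> : cmean n f r + cmean n g r - (L + M) = (cmean n f r - L) + (cmean n g r - M) by ring.
by apply: le_trans (nmD _ _) _; lra.
Qed.

Lemma mean_toZ f r (a L : C) : mean_to f r L -> mean_to (fun z => a * f z) r (a * L).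
Proof.
move=> hf e e0; have a1 : 0 < nm a + 1 by rewrite ltr_pwDr ?nm_ge0.
have [N NP] := hf _ (divr_gt0 e0 a1); exists N => n /NP.
rewrite ler_pdivlMr// => H.
have -> : cmean n (fun z => a * f z) r = a * cmean n f r.
  by rewrite /cmean -[RHS]/((a : R[i]) *: (avg _ _ _ _ : C)) -avgZ.
rewrite -mulrBr nmM; have := nm_ge0 (cmean n f r - L); lra.
Qed.

Lemma mean_to_ext f g r L : 0 < r -> (forall z, nm z = r -> f z = g z) -> mean_to f r L -> mean_to g r L.
Proof. by move=> r0 fg hf e /hf[N NP]; exists N => n /NP; rewrite (cmean_ext n r0 fg). Qed.

Lemma mean_to_conj f r L : mean_to f r L -> mean_to (fun z => ((f z : R[i])^*)%C : C) r ((L : R[i])^*)%C.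
Proof.
move=> hf e /hf[N NP]; exists N => n /NP.
have -> : cmean n (fun z => ((f z : R[i])^*)%C : C) r = ((cmean n f r : R[i])^*)%C.
  rewrite /cmean; elim: n ((ln r)%:C : C) (0 +i* (2 * pi) : C) => [//|n IH] w u /=.
  rewrite !IH -rmorphD -![_ *: _]/((_ : R[i]) * _) rmorphM.
  by congr (_ * _); rewrite [RHS]conjc_inv conjc_nat.
rewrite -rmorphB /=; congr (_ <= _).
by apply: complexI; rewrite !cnmE normcJ.
Qed.

Lemma mean_to_pow n r : (0 < n)%N -> 0 < r < 1 -> mean_to (fun z : C => z ^+ n : C) r 0.
Proof.
move=> n0 r01; have := @cmean_cvg _ _ (fun z : C => z ^+ n : C) 1 r; rewrite expr0n eqn0Ngt n0.
apply=> // [|z _]; last exact: der_pow.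
by have [D] := der_pow n (0 : C); exact: der_continuous.
Qed.

(** On a circle about 0 this turns conjugates of polynomials into Laurent polynomials, whose means
    can be computed. *)
Lemma conj_circle (z : C) : z != 0 -> ((z : R[i])^*)%C = (nm z ^+ 2)%:C / z :> C.
Proof.
move=> z0; rewrite rmorphXn /= cnmE sqr_normc; apply: (mulfI z0).
by rewrite mulrC [RHS]mulrC divfK // mulrC.
Qed.

(** On the circle z^-n is a constant multiple of the conjugate of z^n. *)
Lemma mean_to_negpow n r : (0 < n)%N -> 0 < r < 1 -> mean_to (fun z : C => z ^- n : C) r 0.
Proof.
move=> n0 r01; have /andP[r0 _] := r01.
have := mean_toZ ((r ^+ 2)%:C ^- n) (mean_to_conj (mean_to_pow n0 r01)).
rewrite rmorph0 mulr0; apply: mean_to_ext => // z zr.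
have z0 : z != 0 by apply/eqP => E; move: zr r0; rewrite E nm0 => <-; rewrite ltxx.
have -> : ((z ^+ n : R[i])^*)%C = ((r ^+ 2)%:C / z) ^+ n by rewrite -zr -(conj_circle z0) [LHS]rmorphXn.
rewrite expr_div_n mulrA mulVf ?mul1r//.
by rewrite expf_neq0// -(rmorph0 (real_complex R)) (inj_eq (@complexI R)) expf_neq0// gt_eqF.
Qed.

Variables (p : C -> C) (c : nat -> C).
Hypothesis p_der : forall z, nm z < 1 -> exists D, der p z D.
Hypothesis p_Re : forall z, nm z < 1 -> 0 <= complex.Re (p z).
Hypothesis c0 : c 0%N = 1.

(** The coefficients enter through an expansion in Peano's form only: this is the continuity at 0
    that [cmean_cvg] requires of the quotient formed in [mean_to_coef]. *)
Definition taylor_at k := forall e : R, 0 < e -> exists2 d : R, 0 < d &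
  forall z : C, nm z < d -> nm (p z - \sum_(j < k.+1) c j * z ^+ j) <= e * nm z ^+ k.

(** With [T] the part of the Taylor polynomial of degree below [k], the function (p - T) z^-k
    extends continuously to 0 with value [c k], while T z^-k consists of negative powers, of mean
    0. *)
Lemma mean_to_coef k r : taylor_at k -> 0 < r < 1 -> mean_to (fun z => p z * z ^- k) r (c k).
Proof.
move=> pk r01; have /andP[r0 r1] := r01.
pose T (z : C) : C := \sum_(j < k) c j * z ^+ j.
pose g (z : C) : C := if z == 0 then c k else (p z - T z) * z ^- k.
have gr : mean_to g r (c k).
  have := @cmean_cvg _ _ g 1 r; rewrite /mean_to /g eqxx; apply=> // [e e0|z /andP[z0 z1]].
    have [d d0 dP] := pk _ e0; exists d => // h hd; rewrite add0r eqxx.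
    case: eqP => [_|/eqP h0]; first by rewrite subrr nm0 ltW.
    have -> : (p h - T h) * h ^- k - c k = (p h - \sum_(j < k.+1) c j * h ^+ j) * h ^- k.
      by rewrite big_ord_recr /= -/(T h); field; rewrite expf_neq0.
    by rewrite nmM nmV nmX ler_pdivrMr ?exprn_gt0 ?nm_gt0//; apply: dP.
  have zn0 : z != 0 by apply/eqP => E; move: z0; rewrite E nm0 ltxx.
  have [Dp hp] := p_der z1.
  have [DT hT] : exists D, der T z D.
    rewrite /T; elim: k {pk T g} => [|k [D IH]].
      by exists 0; apply: dif_ext (der_cst 0 z); exists 1 => // h _; rewrite big_ord0.
    have [E hE] := der_pow k z; exists (D + (c k * E + 0 * z ^+ k)).
    have := der_add IH (der_mul (der_cst (c k) z) hE).
    by apply: dif_ext; exists 1 => // h _; rewrite big_ord_recr.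
  have [Dk hk] := der_pow k z.
  have zk : z ^+ k != 0 by rewrite expf_neq0.
  have := der_mul (der_add hp (der_mul (der_cst (-1) z) hT)) (der_comp hk (der_inv zk)).
  set D := (X in der _ _ X) => H; exists D; apply: dif_ext H.
  exists (nm z) => // h hz; case: eqP => [E|_]; last by rewrite mulN1r.
  move: hz; have -> : h = - z by apply/eqP; rewrite -addr_eq0 addrC E.
  by rewrite nmN ltxx.
have hT : mean_to (fun z => \sum_(j < k) c j * (z ^+ j * z ^- k)) r 0.
  have H (m : nat) : (m <= k)%N -> mean_to (fun z => \sum_(j < m) c j * (z ^+ j * z ^- k)) r 0.
    elim: m => [_|m IH mk].
      move=> e e0; exists 0%N => n _; rewrite (@cmean_ext _ _ n _ (fun=> 0))// => [|z _].
        by rewrite /cmean avg_cst subrr nm0 ltW.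
      by rewrite big_ord0.
    have := mean_toD (IH (ltnW mk)) (mean_toZ (c m) (mean_to_negpow (n := k - m) _ r01)).
    rewrite subn_gt0 mulr0 addr0 => /(_ mk); apply: mean_to_ext => // z zr.
    rewrite big_ord_recr /=; congr (_ + _ * _).
    have z0 : z != 0 by apply/eqP => E; move: zr r0; rewrite E nm0 => <-; rewrite ltxx.
    by rewrite -{2}(subnKC (ltnW mk)) exprD; field; rewrite !expf_neq0.
  exact: H.
have := mean_toD gr hT; rewrite addr0; apply: mean_to_ext => // z zr.
have z0 : z != 0 by apply/eqP => E; move: zr r0; rewrite E nm0 => <-; rewrite ltxx.
rewrite /g (negPf z0) /T mulrBl mulr_suml.
by under [in X in _ - X]eq_bigr do rewrite -mulrA; rewrite subrK.
Qed.

Lemma mean_to_pos k r : taylor_at 0 -> (0 < k)%N -> 0 < r < 1 -> mean_to (fun z => p z * z ^+ k) r 0.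
Proof.
move=> p0 k0 r01.
have := @cmean_cvg _ _ (fun z : C => p z * z ^+ k : C) 1 r; rewrite expr0n eqn0Ngt k0 mulr0.
have H (z : C) : nm z < 1 -> exists D, der (fun z : C => p z * z ^+ k : C) z D.
  move=> /p_der[D hD]; have [E hE] := der_pow k z; exists (p z * E + D * z ^+ k); exact: der_mul.
apply=> // [|z /andP[_ /H//]].
by have [|D /der_continuous] := H 0; rewrite ?nm0.
Qed.

Lemma bernoulli_le (x : R) k : 0 <= x <= 1 -> 1 - x ^+ k <= k%:R * (1 - x).
Proof.
move=> /andP[x0 x1]; elim: k => [|k IH]; first by rewrite expr0 subrr mul0r.
rewrite exprS -natr1; have : 0 <= x ^+ k <= 1 by rewrite exprn_ge0// exprn_ile1.
move=> /andP[]; nra.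
Qed.

(* The mean of [Re p * |y0 + y1 z^m + y2 z^n|^2] over [|z| = r] is nonnegative;
   then [r] tends to [1]. *)
Lemma toeplitz_psd m n (y0 y1 y2 : C) : (0 < m)%N -> (m < n)%N ->
  taylor_at 0 -> taylor_at m -> taylor_at n -> taylor_at (n - m) ->
  0 <= complex.Re (y0 * y0^*%C + y1 * y1^*%C + y2 * y2^*%C +
     (y0 * y1^*%C * c m + y0 * y2^*%C * c n + y1 * y2^*%C * c (n - m))).
Proof.
move=> m0 mn t0 tm tn tnm.
have n0 : (0 < n)%N := ltn_trans m0 mn.
have nm0' : (0 < n - m)%N by rewrite subn_gt0.
(* On the circle z^a times the conjugate of z^b is r^(2b) z^(a-b). Against [p], a negative power
   yields a coefficient and a positive power yields 0, so only half of the off-diagonal terms occur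
   in [L], with weights r^(2b). *)
pose s (k : nat) (r : R) : C := (r ^+ 2)%:C ^+ k.
pose L r : C := y0 * y0^*%C + s m r * (y1 * y1^*%C) + s n r * (y2 * y2^*%C) +
  (s m r * (y0 * y1^*%C) * c m + s n r * (y0 * y2^*%C) * c n + s n r * (y1 * y2^*%C) * c (n - m)).
have LR r : 0 < r < 1 -> 0 <= complex.Re (L r).
  move=> r01; have /andP[r0 r1] := r01.
  have h0 := mean_to_coef t0 r01; rewrite c0 in h0.
  have HL : mean_to (fun z => p z * ((y0 + y1 * z ^+ m + y2 * z ^+ n) * (y0 + y1 * z ^+ m + y2 * z ^+ n)^*%C)) r (L r).
    have := mean_toD (mean_toD (mean_toD (mean_toZ (y0 * y0^*%C + s m r * (y1 * y1^*%C) + s n r * (y2 * y2^*%C)) h0)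
      (mean_toZ (s m r * (y0 * y1^*%C)) (mean_to_coef tm r01)))
      (mean_toD (mean_toZ (s n r * (y0 * y2^*%C)) (mean_to_coef tn r01))
      (mean_toZ (s n r * (y1 * y2^*%C)) (mean_to_coef tnm r01))))
      (mean_toD (mean_toZ (y1 * y0^*%C) (mean_to_pos t0 m0 r01))
      (mean_toD (mean_toZ (y2 * y0^*%C) (mean_to_pos t0 n0 r01))
       (mean_toZ (s m r * (y2 * y1^*%C)) (mean_to_pos t0 nm0' r01)))).
    set L' := (X in mean_to _ _ X); have -> : L' = L r by rewrite /L' /L; ring.
    apply: mean_to_ext => // z zr.
    have z0 : z != 0 by apply/eqP => E; move: zr r0; rewrite E nm0 => <-; rewrite ltxx.
    have cz : ((z : R[i])^*)%C = (r ^+ 2)%:C / z by rewrite (conj_circle z0) zr.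
    have -> : ((y0 + y1 * z ^+ m + y2 * z ^+ n : R[i])^*)%C =
        y0^*%C + y1^*%C * ((r ^+ 2)%:C / z) ^+ m + y2^*%C * ((r ^+ 2)%:C / z) ^+ n.
      by rewrite -cz -[LHS]/(conjc _) !(rmorphD, rmorphM, rmorphXn).
    rewrite /s; have := subnKC (ltnW mn); set k := (n - m)%N => <-.
    rewrite !expr_div_n !exprD expr0; field.
    by rewrite !expf_neq0.
  apply/ler_addgt0Pr => e e0; have [N /(_ N (leqnn N))] := HL e e0.
  set f := (X in cmean N X r) => H.
  have fR : 0 <= complex.Re (cmean N f r).
    apply: (@cmean_ind _ _ (fun w : C => 0 <= complex.Re w)) => // [x y hx hy|z zr].
      have -> : (2^-1 : R[i]) *: (x + y : C) = (2^-1 : R)%:C * (x + y).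
        by rewrite fmorphV rmorph_nat.
      by case: x hx => ? ?; case: y hy => ? ? /= *; rewrite mul0r subr0 mulr_ge0 ?addr_ge0.
    rewrite /f -sqr_normc -cnmE -rmorphXn /=.
    have := @p_Re z; rewrite zr => /(_ r1); case: (p z) => u v /= u0.
    by rewrite mulr0 subr0 mulr_ge0// sqr_ge0.
  have := le_trans (nm_Re _) H; rewrite raddfB /= ler_norml => /andP[]; lra.
have LE r : 0 < r < 1 -> 0 <= complex.Re (y0 * y0^*%C) + (r ^+ 2) ^+ m * complex.Re (y1 * y1^*%C + y0 * y1^*%C * c m)
   + (r ^+ 2) ^+ n * complex.Re (y2 * y2^*%C + y0 * y2^*%C * c n + y1 * y2^*%C * c (n - m)).
  move=> /LR; have -> : L r = y0 * y0^*%C + ((r ^+ 2) ^+ m)%:C * (y1 * y1^*%C + y0 * y1^*%C * c m) +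
     ((r ^+ 2) ^+ n)%:C * (y2 * y2^*%C + y0 * y2^*%C * c n + y1 * y2^*%C * c (n - m)).
    by rewrite /L /s !rmorphXn /=; ring.
  have Rr (t : R) (w : C) : complex.Re (t%:C * w) = t * complex.Re w by case: w => ? ? /=; rewrite mul0r subr0.
  by rewrite 2!raddfD /= -!/(complex.Re _) !Rr.
set u := complex.Re (y0 * _) in LE; set v := complex.Re (y1 * _ + _) in LE; set w := complex.Re (y2 * _ + _ + _) in LE.
have -> : complex.Re (y0 * y0^*%C + y1 * y1^*%C + y2 * y2^*%C +
     (y0 * y1^*%C * c m + y0 * y2^*%C * c n + y1 * y2^*%C * c (n - m))) = u + v + w.
  by rewrite /u /v /w -!raddfD /=; congr complex.Re; ring.
apply/ler_addgt0Pr => e e0.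
(* By Bernoulli's inequality the weights at r = 1 - d differ from 1 by at most 2 m d and 2 n d, so
   passing to r = 1 costs at most d K. *)
pose K := `|v| * (2 * m)%:R + `|w| * (2 * n)%:R + 1.
have K0 : 0 < K by rewrite ltr_pwDr// addr_ge0// mulr_ge0.
pose d := Num.min (2^-1) (e / K); have d0 : 0 < d by rewrite lt_min invr_gt0 ltr0n divr_gt0.
have d1 : d <= 2^-1 by rewrite ge_min lexx.
have dK : d * K <= e by rewrite -ler_pdivlMr// ge_min lexx orbT.
have r01 : 0 < 1 - d < 1 by apply/andP; split; lra.
have := LE (1 - d) r01.
have r01' : 0 <= 1 - d <= 1 by apply/andP; split; lra.
have := bernoulli_le (2 * m) r01'; have := bernoulli_le (2 * n) r01'.
rewrite -!exprM; set X := _ ^+ (2 * m); set Y := _ ^+ (2 * n).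
have X1 : X <= 1 by rewrite exprn_ile1//; lra.
have Y1 : Y <= 1 by rewrite exprn_ile1//; lra.
rewrite opprD opprK addrA subrr add0r => hY hX H.
have hv : v * (X - 1) <= `|v| * ((2 * m)%:R * d).
  apply: le_trans (ler_norm _) _; rewrite normrM ler_wpM2l// ler0_norm; lra.
have hw : w * (Y - 1) <= `|w| * ((2 * n)%:R * d).
  apply: le_trans (ler_norm _) _; rewrite normrM ler_wpM2l// ler0_norm; lra.
have : d * K = `|v| * ((2 * m)%:R * d) + `|w| * ((2 * n)%:R * d) + d by rewrite /K; ring.
lra.
Qed.

End Caratheodory.

(** * Minors of the Toeplitz form and bounds for the determinants *)

Section CoefficientBounds.
Variable R : realType.
Local Notation C := (R[i]^o).

(** The form belongs to the Hermitian matrix with unit diagonal and entries [a], [g], [b] above it.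
    Vectors with one zero entry give the minors of order 2; the last inequality is the determinant,
    which equals (1 - |a|^2) (1 - |b|^2) - |g - a b|^2. *)
Lemma psd_minors (a b g : C) :
  (forall y0 y1 y2 : C, 0 <= complex.Re (y0 * y0^*%C + y1 * y1^*%C + y2 * y2^*%C +
     (y0 * y1^*%C * (2 * a) + y0 * y2^*%C * (2 * g) + y1 * y2^*%C * (2 * b)))) ->
  [/\ nm a <= 1, nm b <= 1, nm g <= 1 &
      nm (g - a * b : C) ^+ 2 <= (1 - nm a ^+ 2) * (1 - nm b ^+ 2)].
Proof.
have sq1 (x : R) : 0 <= x -> x ^+ 2 <= 1 -> x <= 1 by move=> x0; rewrite expr_le1.
case: a b g => [a1 a2] [b1 b2] [g1 g2] H.
have a_le1 : nm (a1 +i* a2 : C) ^+ 2 <= 1.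
  have := H 1 (- a1 -i* a2) 0; rewrite nm_sqr /= !(mul0r, mulr0, mul1r, mulr1, oppr0, addr0, subr0); lra.
have b_le1 : nm (b1 +i* b2 : C) ^+ 2 <= 1.
  have := H 0 1 (- b1 -i* b2); rewrite nm_sqr /= !(mul0r, mulr0, mul1r, mulr1, oppr0, addr0, subr0); lra.
have g_le1 : nm (g1 +i* g2 : C) ^+ 2 <= 1.
  have := H 1 0 (- g1 -i* g2); rewrite nm_sqr /= !(mul0r, mulr0, mul1r, mulr1, oppr0, addr0, subr0); lra.
split; [exact: sq1 (nm_ge0 _) a_le1|exact: sq1 (nm_ge0 _) b_le1|exact: sq1 (nm_ge0 _) g_le1|].
rewrite !nm_sqr /= in a_le1 b_le1 *.
pose d1 := g1 - (a1 * b1 - a2 * b2); pose d2 := g2 - (a1 * b2 + a2 * b1).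
pose A := 1 - (a1 ^+ 2 + a2 ^+ 2); pose B := 1 - (b1 ^+ 2 + b2 ^+ 2); pose D := d1 ^+ 2 + d2 ^+ 2.
(* The middle vector is chosen to minimize the form, which leaves the Schur complement. *)
have key (s t : R) : 0 <= s ^+ 2 * D * A + t ^+ 2 * B - 2 * (s * t * D).
  have := H ((- (s * d1)) +i* (s * d2))
     ((s * (a1 * d1 + a2 * d2) - t * b1) +i* (s * (a2 * d1 - a1 * d2) + t * b2)) (t +i* 0).
  by congr (0 <= _); rewrite /= /A /B /D /d1 /d2; ring.
have -> : (g1 - (a1 * b1 - a2 * b2)) ^+ 2 + (g2 - (a1 * b2 + a2 * b1)) ^+ 2 = D by [].
have D0 : 0 <= D by rewrite addr_ge0 ?sqr_ge0.
have A0 : 0 <= A by rewrite subr_ge0.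
have B0 : 0 <= B by rewrite subr_ge0.
rewrite -/A -/B; have [->|Dn] := eqVneq D 0; first exact: mulr_ge0.
have Dp : 0 < D by rewrite lt_neqAle eq_sym Dn.
(* If [B] vanishes, the form is affine in [t] with slope -2 s D, and a large [t] forces [D] to be
   0. *)
have [B00|Bn] := eqVneq B 0.
  have := key 1 (A + 1); rewrite B00 expr1n mul1r mulr0 addr0 mul1r; nra.
have Bp : 0 < B by rewrite lt_neqAle eq_sym Bn.
(* This choice of [s] and [t] gives the form the value B D (A B - D). *)
have := key B D; rewrite leNgt => kBD; rewrite leNgt; apply/negP => AB; move/negP: kBD; apply.
have -> : B ^+ 2 * D * A + D ^+ 2 * B - 2 * (B * D * D) = (B * D) * (A * B - D) by ring.
by rewrite pmulr_rlt0 ?mulr_gt0// subr_lt0.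
Qed.

(* [q_k] is half the [k]-th coefficient of [p], and [A_k] are the coefficients of
   [f], where [1 + z f'' / f' = 1 - c + c p] and [c = lam + 1/2]. *)
Section Bounds.
Variables (c : R) (q1 q2 q3 : C).
Hypotheses (c1 : 1 <= c) (q1_le1 : nm q1 <= 1) (q2_le1 : nm q2 <= 1) (q3_le1 : nm q3 <= 1).
Hypothesis h12 : nm (q2 - q1 * q1 : C) ^+ 2 <= (1 - nm q1 ^+ 2) * (1 - nm q1 ^+ 2).
Hypothesis h23 : nm (q3 - q1 * q2 : C) ^+ 2 <= (1 - nm q1 ^+ 2) * (1 - nm q2 ^+ 2).

Let A2 : C := c%:C * q1.
Let A3 : C := (c / 3)%:C * (q2 + (2 * c)%:C * (q1 * q1)).
Let A4 : C := (c / 6)%:C * (q3 + (3 * c)%:C * (q1 * q2) + (2 * c ^+ 2)%:C * (q1 * q1 * q1)).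
Let t := nm q1 ^+ 2.

Let t01 : 0 <= t <= 1.
Proof. by rewrite sqr_ge0 exprn_ile1 ?nm_ge0. Qed.

Let d12 : nm (q2 - q1 * q1 : C) <= 1 - t.
Proof.
rewrite -(@ler_pXn2r _ 2)// ?nnegrE ?nm_ge0//; by case/andP: t01; rewrite subr_ge0.
Qed.

Let nmr (x : R) (z : C) : 0 <= x -> nm (x%:C * z : C) = x * nm z.
Proof. by move=> x0; rewrite nmM nm_real ger0_norm. Qed.

Let c0 : 0 <= c. Proof. exact: le_trans c1. Qed.

Let nq11 : nm (q1 * q1 : C) = t. Proof. by rewrite nmM -expr2. Qed.

Let nm_A3 : nm A3 <= c * (1 + 2 * c) / 3.
Proof.
rewrite /A3 nmr; last by rewrite divr_ge0.
have := nmD q2 ((2 * c)%:C * (q1 * q1)); rewrite nmr ?mulr_ge0// nq11.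
have /andP[? ?] := t01; have := c0; have := q2_le1; nra.
Qed.

(** In the second factor q_2 - 4 c q_1^2 is read as (q_2 - q_1^2) - (4 c - 1) q_1^2, of modulus at
    most (1 - t) + (4 c - 1) t. As 4 c - 1 >= 1, this is at most 4 c - 1, whereas bounding q_2 and 4
    c q_1^2 separately would give 4 c + 1. *)
Lemma toeplitz31_bound :
  nm ((1 - A3) * (1 + A3 - 2 * A2 ^+ 2) : C) <= (1 + c * (1 + 2 * c) / 3) * (1 + c * (4 * c - 1) / 3).
Proof.
rewrite nmM; apply: ler_pM; rewrite ?nm_ge0//.
  by apply: le_trans (nmB _ _) _; rewrite nm1 lerD2l.
have -> : 1 + A3 - 2 * A2 ^+ 2 = 1 + (c / 3)%:C * ((q2 - q1 * q1) - (4 * c - 1)%:C * (q1 * q1)).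
  by rewrite /A2 /A3 !(rmorphM, rmorphB, rmorph_nat, rmorph1) /= ?fmorphV ?rmorph_nat; field.
apply: le_trans (nmD _ _) _; rewrite nm1 lerD2l nmr; last by rewrite divr_ge0.
rewrite [leRHS]mulrAC ler_wpM2l ?divr_ge0//; apply: le_trans (nmB _ _) _.
rewrite nmr; last by have := c1; lra.
rewrite nq11; have /andP[? ?] := t01; have := d12; have := c1; nra.
Qed.

Lemma toeplitz32_bound :
  nm ((A2 - A4) * (A2 ^+ 2 + A2 * A4 - 2 * A3 ^+ 2) : C) <=
  (c + c * (1 + c) * (1 + 2 * c) / 6) * (c ^+ 2 / 18 * (19 + 7 * c + 10 * c ^+ 2)).
Proof.
have c1' := c1; have c0' := c0; have x0 := nm_ge0 q1; have y0 := nm_ge0 q2.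
have /andP[t0 t1] := t01.
rewrite nmM; apply: ler_pM; rewrite ?nm_ge0//.
  apply: le_trans (nmB _ _) _; apply: lerD; first by rewrite /A2 nmr// ler_piMr.
  rewrite /A4 nmr; last by rewrite divr_ge0.
  have -> : c * (1 + c) * (1 + 2 * c) / 6 = c / 6 * (1 + 3 * c + 2 * c ^+ 2) by field.
  rewrite ler_wpM2l ?divr_ge0//; apply: le_trans (nmD _ _) _.
  apply: le_trans (lerD (nmD _ _) (lexx _)) _.
  have c20 : 0 <= 2 * c ^+ 2 by rewrite mulr_ge0 ?sqr_ge0.
  rewrite !nmr ?mulr_ge0// !nmM; apply: lerD; [apply: lerD => //|].
    by rewrite ler_piMr ?mulr_ge0// mulr_ile1.
  by rewrite ler_piMr// mulr_ile1 ?mulr_ge0// mulr_ile1.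
(* 3 q_1 q_3 - 4 q_2^2 is rewritten as 3 (q_1 (q_3 - q_1 q_2) - q_2 (q_2 - q_1^2)) - q_2^2. The
   bracket vanishes at the extremum, so the constant is 18 + 1 = 19, where separate bounds would
   give 18 + 3 + 4. *)
have -> : A2 ^+ 2 + A2 * A4 - 2 * A3 ^+ 2 = (c ^+ 2 / 18)%:C *
  (18%:R * (q1 * q1) + (3 * (q1 * (q3 - q1 * q2) - q2 * (q2 - q1 * q1)) - q2 * q2
    - (7 * c)%:C * (q1 * q1 * q2) - (10 * c ^+ 2)%:C * (q1 * q1 * (q1 * q1)))).
  by rewrite /A2 /A3 /A4 !(rmorphM, rmorphXn, rmorph_nat) /= ?fmorphV ?rmorph_nat; field.
rewrite nmr ?divr_ge0 ?sqr_ge0// ler_wpM2l ?divr_ge0 ?sqr_ge0//.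
have y1 := q2_le1; have x1 := q1_le1; have h23' := h23.
set y := nm q2 in y0 y1 h23' *; set x := nm q1 in x0 x1 *.
have hx : x ^+ 2 = t by [].
(* By [d12] one has |q_2| >= 2 t - 1, hence 1 - |q_2|^2 <= 2 (1 - |q_2|) <= 4 (1 - t); with [h23]
   this makes the bound linear in 1 - t. *)
have w2 : nm (q3 - q1 * q2 : C) <= 2 * (1 - t).
  rewrite -(@ler_pXn2r _ 2)// ?nnegrE ?nm_ge0//; last by rewrite mulr_ge0// subr_ge0.
  apply: (le_trans h23'); rewrite -/t.
  have -> : (2 * (1 - t)) ^+ 2 = (1 - t) * (4 * (1 - t)) by ring.
  rewrite ler_wpM2l ?subr_ge0//.
  have : t <= y + nm (q2 - q1 * q1).
    by have := nmB q2 (q2 - q1 * q1); rewrite subKr nq11.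
  have := d12; have : 0 <= (1 - y) * (1 + y) by rewrite mulr_ge0 ?subr_ge0// addr_ge0.
  have : 0 <= (1 - y) * (1 - y) by rewrite mulr_ge0 ?subr_ge0.
  nra.
have h3 : nm (3 * (q1 * (q3 - q1 * q2) - q2 * (q2 - q1 * q1)) : C) <= 9 * (1 - t).
  rewrite nmM nm_nat; have := nmB (q1 * (q3 - q1 * q2)) (q2 * (q2 - q1 * q1)); rewrite !nmM -/x -/y.
  have e1 : x * nm (q3 - q1 * q2 : C) <= 1 * (2 * (1 - t)) by apply: ler_pM; rewrite ?nm_ge0.
  have e2 : y * nm (q2 - q1 * q1 : C) <= 1 * (1 - t) by apply: ler_pM; rewrite ?nm_ge0.
  lra.
have e1 : nm (18%:R * (q1 * q1) : C) <= 18 by rewrite nmM nm_nat nq11; lra.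
have e2 : nm (q2 * q2 : C) <= 1 by rewrite nmM mulr_ile1.
have e3 : nm ((7 * c)%:C * (q1 * q1 * q2) : C) <= 7 * c * t.
  by rewrite nmr ?mulr_ge0// nmM nq11 ler_wpM2l ?mulr_ge0// ler_piMr.
have e4 : nm ((10 * c ^+ 2)%:C * (q1 * q1 * (q1 * q1)) : C) = 10 * c ^+ 2 * t ^+ 2.
  by rewrite nmr ?mulr_ge0 ?sqr_ge0// nmM nq11 expr2.
(* The loss 9 (1 - t) is absorbed by what the last two terms lack when t < 1; as c >= 1, the factor
   7 c + 10 c^2 (1 + t) of 1 - t is at least 17. *)
have e5 : 9 * (1 - t) + 7 * c * t + 10 * c ^+ 2 * t ^+ 2 <= 7 * c + 10 * c ^+ 2.
  have -> : 7 * c + 10 * c ^+ 2 = (1 - t) * (7 * c + 10 * c ^+ 2 * (1 + t)) + 7 * c * t + 10 * c ^+ 2 * t ^+ 2 by ring.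
  rewrite !lerD2r mulrC ler_wpM2l ?subr_ge0//.
  have : 0 <= 10 * c ^+ 2 * t by rewrite !mulr_ge0 ?sqr_ge0.
  have : 1 <= c ^+ 2 by rewrite exprn_ege1.
  lra.
apply: le_trans (nmD _ _) _; apply: le_trans (lerD (lexx _) (nmB _ _)) _.
apply: le_trans (lerD (lexx _) (lerD (nmB _ _) (lexx _))) _.
apply: le_trans (lerD (lexx _) (lerD (lerD (nmB _ _) (lexx _)) (lexx _))) _.
lra.
Qed.

End Bounds.

End CoefficientBounds.

Lemma det2 (K : comNzRingType) (M : 'M[K]_2) : \det M = M 0 0 * M 1 1 - M 0 1 * M 1 0.
Proof.
rewrite (expand_det_row _ ord0) !big_ord_recl big_ord0 /cofactor !det_mx11 !mxE /=.
rewrite !(addn0, expr0, mul1r, addr0) /bump /= expr1 mulN1r mulrN.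
by congr (M _ _ * M _ _ - M _ _ * M _ _); apply: val_inj.
Qed.

(** The matrix commutes with the reversal of coordinates: the antisymmetric vector (1, 0, -1) has
    eigenvalue a - d, and the symmetric plane contributes a (a + d) - 2 b^2. *)
Lemma det_sym_toeplitz3 (R : realType) (a b d : R[i]) :
  \det (sym_toeplitz3 a b d) = (a - d) * (a ^+ 2 + a * d - 2 * b ^+ 2).
Proof.
rewrite (expand_det_row _ ord0) !big_ord_recl big_ord0 /cofactor !det2 !mxE.
rewrite -![nat_of_ord (lift _ _)]/(bump _ _) /= /bump /=.
rewrite !(expr0, expr1, mul1r, addr0).
set e := (-1) ^+ _.
have -> : e = 1 by rewrite /e sqrrN expr1n.
ring.
Qed.

(** * Taylor expansions and the one-variable bounds *)

Section Taylor.
Variable R : realType.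
Local Notation C := (R[i]^o).

(* [g(z) = o(|z|^k)] at [0]. *)
Definition lo (k : nat) (g : C -> C) := forall e : R, 0 < e -> exists2 d : R, 0 < d &
  forall z : C, nm z < d -> nm (g z) <= e * nm z ^+ k.

Definition bounded_near0 (g : C -> C) := exists2 M : R, 0 < M & exists2 d : R, 0 < d &
  forall z : C, nm z < d -> nm (g z) <= M.

Lemma lo_ext k f g : (exists2 d : R, 0 < d & forall z, nm z < d -> f z = g z) -> lo k f -> lo k g.
Proof.
move=> [r r0 fg] hf e /hf[d d0 dP]; exists (Num.min d r); first by rewrite lt_min d0.
by move=> z; rewrite lt_min => /andP[/dP h /fg <-].
Qed.

Lemma lo_add k f g : lo k f -> lo k g -> lo k (fun z => f z + g z).
Proof.
move=> hf hg e e0; have e2 : 0 < e / 2 by rewrite divr_gt0.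
have [d1 d10 h1] := hf _ e2; have [d2 d20 h2] := hg _ e2.
exists (Num.min d1 d2); first by rewrite lt_min d10.
move=> z; rewrite lt_min => /andP[/h1 H1 /h2 H2]; apply: le_trans (nmD _ _) _; lra.
Qed.

Lemma lo_mul k f g : bounded_near0 f -> lo k g -> lo k (fun z => f z * g z).
Proof.
move=> [M M0 [r r0 fM]] hg e e0; have [d d0 dP] := hg _ (divr_gt0 e0 M0).
exists (Num.min d r); first by rewrite lt_min d0.
move=> z; rewrite lt_min => /andP[/dP h /fM H]; rewrite nmM.
apply: le_trans (ler_pM (nm_ge0 _) (nm_ge0 _) H h) _.
by rewrite le_eqVlt; apply/orP; left; apply/eqP; field; rewrite gt_eqF.
Qed.

Lemma lo_mulX k f : lo k f -> lo k.+1 (fun z => z * f z).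
Proof.
move=> hf e /hf[d d0 dP]; exists d => // z /dP h.
by rewrite nmM exprS mulrCA ler_wpM2l ?nm_ge0.
Qed.

Lemma lo_X k : lo k (fun z => z ^+ k.+1).
Proof.
move=> e e0; exists e => // z h; rewrite nmX exprS ler_wpM2r ?exprn_ge0 ?nm_ge0//; exact: ltW.
Qed.

Lemma bounded_near0_continuous f : continuous_at f 0 -> bounded_near0 f.
Proof.
move=> fc; exists (nm (f 0) + 1); first by rewrite ltr_pwDr ?nm_ge0.
have [d d0 dP] := fc 1 ltr01; exists d => // z /dP; rewrite add0r => h.
by rewrite -(subrK (f 0) (f z)); apply: le_trans (nmD _ _) _; lra.
Qed.

(** Little-o estimates are integrated by the mean value inequality on the segment from 0 to [z];
    repeated use turns a tower of derivatives into Taylor expansions. *)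
Lemma lo_integral k (f g : C -> C) : (forall z : C, nm z < 1 -> der f z (g z)) -> lo k g ->
  lo k.+1 (fun z => f z - f 0).
Proof.
move=> fg hg e e0; have [d d0 dP] := hg _ e0.
exists (Num.min d 1); first by rewrite lt_min d0 ltr01.
move=> z; rewrite lt_min => /andP[zd z1].
have := @mean_value _ _ (fun w : C => f (w * z)) (fun t => z * g (t%:C * z)) (e * nm z ^+ k.+1).
rewrite mul1r mul0r; apply=> t /andP[t0 t1].
  have tz : nm (t%:C * z : C) < 1.
    by rewrite nmM nm_real ger0_norm//; apply: le_lt_trans z1; rewrite ler_piMl ?nm_ge0.
  have dl : der (fun w : C => w * z : C) (t%:C : C) (z : C).
    have := der_mul (der_id (t%:C : C)) (der_cst z (t%:C)); congr der.
    by rewrite mulr0 mul1r add0r.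
  exact: der_comp dl (fg _ tz).
have tz : nm (t%:C * z : C) <= nm z.
  by rewrite nmM nm_real ger0_norm// ler_piMl ?nm_ge0.
rewrite nmM exprS mulrCA ler_wpM2l ?nm_ge0//; apply: le_trans (dP _ (le_lt_trans tz zd)) _.
by rewrite ler_wpM2l ?(ltW e0)// lerXn2r// nnegrE nm_ge0.
Qed.

Lemma lo_down k f : lo k.+1 f -> lo k f.
Proof.
move=> hf e e0; have [d d0 dP] := hf _ e0; exists (Num.min d 1); first by rewrite lt_min d0 ltr01.
move=> z; rewrite lt_min => /andP[/dP h z1]; apply: le_trans h _.
by rewrite ler_wpM2l ?(ltW e0)// exprS ler_piMl ?exprn_ge0 ?nm_ge0// ltW.
Qed.

Lemma taylor_down (p : C -> C) (c : nat -> C) k : taylor_at p c k.+1 -> taylor_at p c k.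
Proof.
move=> h; have bc : bounded_near0 (fun=> c k.+1).
  by exists (nm (c k.+1) + 1); [rewrite ltr_pwDr ?nm_ge0|exists 1 => // z _; rewrite lerDl].
have := lo_add (lo_down h) (lo_mul bc (@lo_X k)); apply: lo_ext; exists 1 => // z _.
by rewrite [in LHS]big_ord_recr /= opprD addrA subrK.
Qed.

Lemma poly_bounded (a b c : C) : bounded_near0 (fun z => a + b * z + c * (z * z)).
Proof.
apply: bounded_near0_continuous.
have := der_add (der_add (der_cst a 0) (der_mul (der_cst b 0) (der_id 0)))
  (der_mul (der_cst c 0) (der_mul (der_id 0) (der_id 0))).
exact: der_continuous.
Qed.

(** [f n] plays the role of the n-th derivative of a function on the disc. Only functions of one
    variable occur here; the slices of [F] and their derivatives are substituted later. *)
Theorem toeplitz_bounds (f : nat -> C -> C) (lam : R) : 2^-1 <= lam <= 1 ->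
  (forall n (z : C), nm z < 1 -> der (f n) z (f n.+1 z)) -> f 1%N 0 = 1 ->
  (forall z : C, nm z < 1 -> f 1%N z != 0) ->
  (forall z : C, nm z < 1 -> z != 0 -> 2^-1 - lam <= complex.Re ((z * f 2%N z + f 1%N z) / f 1%N z)) ->
  let A n := (n`!)%:R^-1 * f n 0 in
  nm (\det (sym_toeplitz3 1 (A 2%N) (A 3%N)) : C) <=
    (4 + 3 * lam + 2 * lam ^+ 2) * (7 + 6 * lam + 8 * lam ^+ 2) / 18 /\
  nm (\det (sym_toeplitz3 (A 2%N) (A 3%N) (A 4%N)) : C) <=
    864^-1 * (1 + 2 * lam) ^+ 3 * (9 + 5 * lam + 2 * lam ^+ 2) * (25 + 17 * lam + 10 * lam ^+ 2).
Proof.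
move=> /andP[lam1 lam2] fD f10 f1n fRe A.
have [c cE] : exists c : R, c = lam + 2^-1 by exists (lam + 2^-1).
have c1 : 1 <= c by lra.
have cp : 0 < c by lra.
have cn : (c%:C : C) != 0 by rewrite -(rmorph0 (real_complex R)) (inj_eq (@complexI R)) gt_eqF.
have z00 : nm (0 : C) < 1 by rewrite nm0.
(* These are obtained by solving the formulas for A_2, A_3, A_4; that they are half the coefficients
   of [p] is what [T3] verifies. *)
pose q1 : C := A 2%N / c%:C.
pose q2 : C := 3 * A 3%N / c%:C - 2 * c%:C * q1 ^+ 2.
pose q3 : C := 6 * A 4%N / c%:C - 3 * c%:C * q1 * q2 - 2 * c%:C ^+ 2 * q1 ^+ 3.
pose b n := f n 0.
have bA n : b n = (n`!)%:R * A n.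
  by rewrite /A mulrA mulfV ?mul1r// pnatr_eq0 -lt0n fact_gt0.
have b2 : b 2%N = 2 * c%:C * q1 by rewrite bA /q1 -[(2`!)%N]/2%N; field.
have b3 : b 3%N = 2 * c%:C * (q2 + 2 * c%:C * q1 ^+ 2).
  by rewrite bA /q2 -[(3`!)%N]/6%N; field.
have b4 : b 4%N = 4 * c%:C * (q3 + 3 * c%:C * q1 * q2 + 2 * c%:C ^+ 2 * q1 ^+ 3).
  by rewrite bA /q3 -[(4`!)%N]/24%N; field.
have E4 : lo 0 (fun z => f 4%N z - b 4%N).
  move=> e e0; have [d d0 dP] := der_continuous (fD 4%N 0 z00) e0.
  by exists d => // z /dP; rewrite add0r expr0 mulr1.
have dpow1 (a z : C) : der (fun w : C => a * w : C) z (a : C).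
  by have := der_mul (der_cst a z) (der_id z); congr der; rewrite mulr1 mul0r addr0.
have dpow2 (a z : C) : der (fun w : C => a * (w * w) : C) z (2 * a * z : C).
  have := der_mul (der_cst a z) (der_mul (der_id z) (der_id z)); congr der; ring.
have dpow3 (a z : C) : der (fun w : C => a * (w * w * w) : C) z (3 * a * (z * z) : C).
  have := der_mul (der_cst a z) (der_mul (der_mul (der_id z) (der_id z)) (der_id z)); congr der; ring.
have E3 : lo 1 (fun z => f 3%N z - b 3%N - b 4%N * z).
  have := lo_integral (f := fun z => f 3%N z + - b 4%N * z) _ E4 => H.
  apply: lo_ext (H _) => [|z z1]; last exact: der_add (fD 3%N z z1) (dpow1 _ z).
  by exists 1 => // z _; rewrite /b; ring.
have E2 : lo 2 (fun z => f 2%N z - b 2%N - b 3%N * z - b 4%N / 2 * (z * z)).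
  have := lo_integral (f := fun z => f 2%N z + - b 3%N * z + - (b 4%N / 2) * (z * z)) _ E3 => H.
  apply: lo_ext (H _) => [|z z1].
    by exists 1 => // z _; rewrite /b; ring.
  have := der_add (der_add (fD 2%N z z1) (dpow1 (- b 3%N) z)) (dpow2 (- (b 4%N / 2)) z).
  by congr der; field.
have E1 : lo 3 (fun z => f 1%N z - 1 - b 2%N * z - b 3%N / 2 * (z * z) - b 4%N / 6%:R * (z * z * z)).
  have := lo_integral (f := fun z => f 1%N z + - b 2%N * z + - (b 3%N / 2) * (z * z) + - (b 4%N / 6%:R) * (z * z * z)) _ E2 => H.
  apply: lo_ext (H _) => [|z z1].
    by exists 1 => // z _; rewrite f10; ring.
  have := der_add (der_add (der_add (fD 1%N z z1) (dpow1 (- b 2%N) z)) (dpow2 (- (b 3%N / 2)) z)) (dpow3 (- (b 4%N / 6%:R)) z).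
  by congr der; field.
pose p (z : C) : C := 1 + z * f 2%N z * (c%:C * f 1%N z)^-1.
pose cc (n : nat) : C := nth 0 [:: 1; 2 * q1; 2 * q2; 2 * q3] n.
have cf (z : C) : nm z < 1 -> c%:C * f 1%N z != 0 by move=> z1; rewrite mulf_neq0 ?f1n.
have p_der (z : C) : nm z < 1 -> exists D, der p z D.
  move=> z1.
  have := der_add (der_cst 1 z) (der_mul (der_mul (der_id z) (fD 2%N z z1))
     (der_comp (der_mul (der_cst c%:C z) (fD 1%N z z1)) (der_inv (cf z z1)))).
  by set D := (X in der _ _ X) => H; exists D.
have p_Re (z : C) : nm z < 1 -> 0 <= complex.Re (p z).
  move=> z1; have [->|z0] := eqVneq z 0; first by rewrite /p !mul0r addr0.
  have -> : p z = (c^-1)%:C * ((z * f 2%N z + f 1%N z) / f 1%N z - (2^-1 - lam)%:C).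
    have hc : (2^-1 - lam)%:C = 1 - c%:C :> C.
      by rewrite cE !rmorphD rmorphN /= fmorphV rmorph_nat; field.
    by rewrite hc fmorphV /p /=; field; rewrite cn f1n.
  have := fRe z z1 z0; case: (_ / _) => u v /= h.
  by rewrite mul0r subr0 mulr_ge0 ?invr_ge0 ?subr_ge0 ?(ltW cp).
have T3 : taylor_at p cc 3.
  have bi : bounded_near0 (fun z => (c%:C * f 1%N z)^-1).
    apply: bounded_near0_continuous.
    exact: der_continuous (der_comp (der_mul (der_cst c%:C 0) (fD 1%N 0 z00)) (der_inv (cf 0 z00))).
  have bT : bounded_near0 (fun z => z * (2 * q1 + 2 * q2 * z + 2 * q3 * (z * z)) * - c%:C).
    apply: bounded_near0_continuous.
    exact: der_continuous (der_mul (der_mul (der_id 0) (der_add (der_add (der_cst (2 * q1) 0) (dpow1 (2 * q2) 0))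
      (dpow2 (2 * q3) 0))) (der_cst (- c%:C) 0)).
  (* After multiplication by c f', the remainder of [p] consists of the remainders [E1] and [E2],
     and of the terms of degree 4, 5, 6 in the product of the Taylor polynomials, with coefficients
     [e1], [e2], [e3]; the lower degrees cancel by the choice of the q_k. *)
  pose e1 : C := - (2 * q1 * b 4%N / 6%:R + 2 * q2 * b 3%N / 2 + 2 * q3 * b 2%N) * c%:C.
  pose e2 : C := - (2 * q2 * b 4%N / 6%:R + 2 * q3 * b 3%N / 2) * c%:C.
  pose e3 : C := - (2 * q3 * b 4%N / 6%:R) * c%:C.
  have := lo_mul bi (lo_add (lo_add (lo_mulX E2) (lo_mul bT E1)) (lo_mul (poly_bounded e1 e2 e3) (@lo_X 3))).
  apply: lo_ext; exists 1 => // z z1; rewrite 4!big_ord_recr big_ord0 /= /cc /= /p.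
  have f1z := f1n z z1.
  rewrite /e1 /e2 /e3 b2 b3 b4; field.
  by rewrite cn f1z.
have T2 := taylor_down T3; have T1 := taylor_down T2; have T0 := taylor_down T1.
(* The exponents 0, 1, 2 have differences 1, 1, 2 and give the minor in q_1, q_1, q_2; below, the
   exponents 0, 1, 3 give the one in q_1, q_2, q_3. *)
have [n1 n2' _ h12] : [/\ nm q1 <= 1, nm q1 <= 1, nm q2 <= 1 &
      nm (q2 - q1 * q1 : C) ^+ 2 <= (1 - nm q1 ^+ 2) * (1 - nm q1 ^+ 2)].
  by apply: psd_minors => y0 y1 y2; exact: (@toeplitz_psd _ p cc p_der p_Re erefl 1 2 y0 y1 y2).
have [_ n2 n3 h23] : [/\ nm q1 <= 1, nm q2 <= 1, nm q3 <= 1 &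
      nm (q3 - q1 * q2 : C) ^+ 2 <= (1 - nm q1 ^+ 2) * (1 - nm q2 ^+ 2)].
  by apply: psd_minors => y0 y1 y2; exact: (@toeplitz_psd _ p cc p_der p_Re erefl 1 3 y0 y1 y2).
have A2E : A 2%N = c%:C * q1 by rewrite /q1; field.
have A3E : A 3%N = (c / 3)%:C * (q2 + (2 * c)%:C * (q1 * q1)).
  by rewrite /q2 !rmorphM /= fmorphV !rmorph_nat; field.
have A4E : A 4%N = (c / 6)%:C * (q3 + (3 * c)%:C * (q1 * q2) + (2 * c ^+ 2)%:C * (q1 * q1 * q1)).
  by rewrite /q3 !rmorphM /= fmorphV !rmorph_nat ?rmorphXn /=; field.
split; rewrite det_sym_toeplitz3.
  rewrite expr1n mul1r A2E A3E; apply: le_trans (toeplitz31_bound c1 n1 n2 h12) _.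
  by rewrite le_eqVlt cE; apply/orP; left; apply/eqP; field.
rewrite A2E A3E A4E; apply: le_trans (toeplitz32_bound c1 n1 n2 n3 h12 h23) _.
by rewrite le_eqVlt cE; apply/orP; left; apply/eqP; field.
Qed.

End Taylor.

(** * Reduction to the slice through x0 *)

Section Slices.
Variables (R : realType) (X : normedModType R[i]).
Local Notation C := (R[i]^o).

Lemma mlin_diagB (Y : normedModType R[i]) n (x : X) (u v : mlin X Y n) :
  mlin_diag x (u - v) = mlin_diag x u - mlin_diag x v.
Proof. by elim: n u v => [//|n IH] u v /=; rewrite -IH. Qed.

Lemma mlin_diagZ (Y : normedModType R[i]) n (x : X) (a : R[i]) (u : mlin X Y n) :
  mlin_diag x (a *: u) = a *: mlin_diag x u.
Proof. by elim: n u => [//|n IH] u /=; rewrite -IH. Qed.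

Lemma mlin_diag_bounded (Y : normedModType R[i]) n (x : X) :
  bounded_at (mlin_diag x : mlin X Y n -> Y).
Proof.
elim: n => [|n [M M0 IH]]; first by exists 1 => // u /=; rewrite mul1r.
exists (M * (nm x + 1)) => [|u /=]; first by rewrite mulr_gt0// ltr_pwDr ?nm_ge0.
apply: le_trans (IH _) _; rewrite -mulrA ler_wpM2l ?(ltW M0)//.
apply: le_trans (blin_apply (u : 'L(X, mlin X Y n)) x) _.
by rewrite mulrC ler_wpM2r ?nm_ge0// lerDl.
Qed.

Lemma mlin_diag_scale1 (Y : normedModType R[i]) (a : R[i]) (x : X) (u : mlin X Y 1) :
  mlin_diag (a *: x) u = a *: mlin_diag x u.
Proof. exact: blinZ. Qed.

Lemma mlin_diag_scale2 (Y : normedModType R[i]) (a : R[i]) (x : X) (u : mlin X Y 2) :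
  mlin_diag (a *: x) u = a ^+ 2 *: mlin_diag x u.
Proof.
rewrite /= (blinZ (u : 'L(X, 'L(X, Y)))) -[LHS]/(a *: (u : 'L(X, 'L(X, Y))) x (a *: x)).
by rewrite blinZ scalerA.
Qed.

Lemma binvK (V W : normedModType R[i]) (A : 'L(V, W)) : binvertible A -> cancel A (binv A).
Proof. by move=> /(xgetPex (0 : 'L(W, V)))[]. Qed.

Lemma unit_ballE (x : X) : unit_ball x <-> nm x < 1.
Proof. by rewrite /unit_ball /= -nmE -(rmorph1 (real_complex R)) ltcR. Qed.

End Slices.

Section DiscSlice.
Variables (R : realType) (X : completeNormedModType R[i]).
Local Notation C := (R[i]^o).
Variables (F : X -> X) (x0 : X).
Hypothesis Fh : holomorphic (@unit_ball R X) F.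
Hypothesis x01 : nm x0 = 1.

Definition slice n (z : C) : X := mlin_diag x0 (frechet n F ((z : R[i]) *: x0)).

Let nmz (z : C) : nm ((z : R[i]) *: x0) = nm z. Proof. by rewrite nmZ x01 mulr1. Qed.

Lemma der_slice_frechet n (z : C) : nm z < 1 -> der (slice n) z (slice n.+1 z).
Proof.
move=> z1; set x := (z : R[i]) *: x0.
have xB : unit_ball x by apply/unit_ballE; rewrite nmz.
have := fdP (frechet_differentiable n Fh xB); rewrite -[x]add0r => /der_slice.
move=> /(dif_lin (@mlin_diagB _ _ X n x0) (@mlin_diag_bounded _ _ X n x0)) H.
apply: dif_ext_lin (dif_ext _ H) => [h|]; last by exists 1 => // h _; rewrite !add0r.
by rewrite mlin_diagZ add0r.
Qed.

Variables (T : 'L(X, C)).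
Hypothesis Tx0 : T x0 = 1.
Hypothesis F_radial : forall z : C, nm z < 1 -> exists a : R[i], F ((z : R[i]) *: x0) = a *: x0.

Definition tslice n (z : C) : C := T (slice n z).

Lemma der_tslice n (z : C) : nm z < 1 -> der (tslice n) z (tslice n.+1 z).
Proof.
move=> /(der_slice_frechet n)/(dif_lin (blinB T) (blin_bounded T)).
by apply: dif_ext_lin => h; rewrite blinZ.
Qed.

(** Since [F] maps the slice into the line of [x0], so do all its derivatives along the slice: the
    derivative of [slice n] is also that of the scalar [tslice n] times [x0], and derivatives are
    unique. *)
Lemma slice_radial n (z : C) : nm z < 1 -> slice n z = (tslice n z : R[i]) *: x0.
Proof.
elim: n z => [|n IH] z z1.
  have [a aE] := F_radial z1; rewrite /tslice /slice /= aE blinZ Tx0.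
  by congr (_ *: _); rewrite -[RHS]/(a * 1 : R[i]) mulr1.
have Z (W : normedModType R[i]) (d : W) (a : R[i]) (h : C) : (a *: h : R[i]) *: d = a *: ((h : R[i]) *: d).
  by rewrite scalerA.
have H1 := der_slice_frechet n z1.
have H2 : der (slice n) z ((tslice n.+1 z : R[i]) *: x0).
  have [M M0 HM] := bounded_at_scale x0.
  have := dif_lin (fun u v : C => scalerBl (u : R[i]) v x0) (ex_intro2 _ _ M M0 HM) (der_tslice n z1).
  move=> H; apply: dif_ext_lin (dif_ext _ H) => [h|].
    by rewrite scalerA.
  exists (1 - nm z) => [|h h1]; first by rewrite subr_gt0.
  by rewrite IH//; apply: le_lt_trans (nmD _ _) _; lra.
have := dif_unique (Z _ _) (Z _ _) H1 H2 (1 : C).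
by rewrite !scale1r.
Qed.

End DiscSlice.

Section UpperBound.
Variables (R : realType) (X : completeNormedModType R[i]).
Local Notation C := (R[i]^o).

Lemma admissible_bounds (lam : R) (g : X -> C) (F : X -> X) (x0 : X) (T : 'L(X, C)) :
  2^-1 <= lam <= 1 -> admissible lam g F x0 T ->
  nm (T31 F x0 T : C) <= (4 + 3 * lam + 2 * lam ^+ 2) * (7 + 6 * lam + 8 * lam ^+ 2) / 18 /\
  nm (T32 F x0 T : C) <=
    864^-1 * (1 + 2 * lam) ^+ 3 * (9 + 5 * lam + 2 * lam ^+ 2) * (25 + 17 * lam + 10 * lam ^+ 2).
Proof.
move=> lam_itv [gh g0 Fg [[F0 DF0] [Fh Finv] FRe] [x01 [Tx0 T1]]].
have nx0 : nm x0 = 1 by apply: complexI; rewrite nmE x01.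
rewrite x01 in Tx0.
have nmz (z : C) : nm ((z : R[i]) *: x0) = nm z by rewrite nmZ nx0 mulr1.
have x0n : x0 != 0 by apply/eqP => E; move: nx0; rewrite E nm0 => /esym/eqP; rewrite oner_eq0.
have Frad (z : C) : nm z < 1 -> exists a : R[i], F ((z : R[i]) *: x0) = a *: x0.
  move=> z1; exists (g ((z : R[i]) *: x0) * z).
  by rewrite Fg ?scalerA//; apply/unit_ballE; rewrite nmz.
pose f n := tslice F x0 T n.
have sE n (z : C) : nm z < 1 -> slice F x0 n z = (f n z : R[i]) *: x0 by exact: slice_radial.
have DE (z : C) : (frechet 1 F ((z : R[i]) *: x0) : 'L(X, X)) x0 = slice F x0 1 z by [].
have f1n (z : C) : nm z < 1 -> f 1%N z != 0.
  move=> z1; apply/eqP => f1; have /Finv[S [AS _]] : unit_ball ((z : R[i]) *: x0).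
    by apply/unit_ballE; rewrite nmz.
  have := AS x0; rewrite DE sE// f1 scale0r (linear0 S) => /esym/eqP.
  by rewrite (negPf x0n).
have fRe (z : C) : nm z < 1 -> z != 0 -> 2^-1 - lam <= complex.Re ((z * f 2%N z + f 1%N z) / f 1%N z).
  move=> z1 z0; set x := (z : R[i]) *: x0.
  have xB : unit_ball x by apply/unit_ballE; rewrite nmz.
  have xn : x != 0 by rewrite scaler_eq0 negb_or z0.
  have nz0 : `|z : R[i]| != 0 by rewrite normr_eq0.
  have xE : `|x| = `|z : R[i]| by rewrite normrZ x01 mulr1.
  (* [T] rotated by the phase of [z] is a support functional at z x0; it is the one for which the
     hypothesis on [F] is used. *)
  pose Tx : 'L(X, C) := (`|z : R[i]|^-1 * ((z : R[i])^*)%C) *: T.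
  have zz : (z : R[i]) * ((z : R[i])^*)%C = `|z : R[i]| ^+ 2 by rewrite sqr_normc.
  have TxE y : Tx y = `|z : R[i]|^-1 * ((z : R[i])^*)%C * T y by [].
  have sTx : support_functionals x Tx.
    split; last by rewrite normrZ T1 mulr1 normrM normfV normr_id normcJ mulVf.
    rewrite TxE blinZ Tx0 xE -[_ *: _]/((z : R[i]) * 1) mulr1 -mulrA (mulrC _ z) zz.
    by rewrite expr2 mulKf.
  have := FRe x Tx xB xn sTx.
  rewrite mlin_diag_scale2 mlin_diag_scale1 -!/(slice _ _ _ _) !sE// scalerA scalerA -scalerDl.
  set A : 'L(X, X) := frechet 1 F x.
  (* On the slice [x0] is an eigenvector of the derivative of [F], with eigenvalue [f 1 z], so the
     inverse divides by it. *)
  have bx0 : binv A x0 = (f 1%N z : R[i])^-1 *: x0.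
    rewrite -[in LHS](scale1r x0) -(mulVf (f1n z z1)) -scalerA -sE// -DE -blinZ binvK//.
    exact: Finv.
  rewrite (blinZ (binv A)) bx0 !blinZ TxE Tx0 xE => H; apply: le_trans H _.
  rewrite -![_ *: _]/((_ : R[i]) * _) le_eqVlt; apply/orP; left; apply/eqP; congr complex.Re.
  have f1z := f1n z z1; rewrite -/(f 1%N z) -/(f 2%N z).
  have -> : `|z : R[i]|^-1 * ((z ^+ 2 * f 2%N z + z * f 1%N z) * ((f 1%N z)^-1 * (`|z : R[i]|^-1 * ((z : R[i])^*)%C * 1))) =
    (z : R[i]) * ((z : R[i])^*)%C * `|z : R[i]| ^- 2 * ((z * f 2%N z + f 1%N z) / f 1%N z).
    by field; rewrite f1z nz0.
  by rewrite zz mulfV ?mul1r// expf_neq0.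
have f10 : f 1%N 0 = 1 by rewrite /f /tslice /slice scale0r /= DF0.
have := toeplitz_bounds lam_itv (fun n z => @der_tslice _ _ F x0 Fh nx0 T n z) f10 f1n fRe.
by rewrite /T31 /T32 /coefA /tslice /slice !scale0r.
Qed.

End UpperBound.

(** * Sharpness *)

Section HahnBanach.
Variables (R : realType) (X : normedModType R[i]).
Local Notation C := (R[i]^o).

(* Only the inequality is required for homogeneity: it yields the equality for
   [t > 0], hence linearity of minimal functionals. *)
Definition sublinear (q : X -> R) := [/\ forall x y, q (x + y) <= q x + q y,
  forall (t : R) x, 0 <= t -> q (t%:C *: x) <= t * q x & forall x, q x <= nm x].

Lemma nm_sublinear : sublinear (@nm R X).
Proof. by split=> // [|t x t0]; [exact: nmD|rewrite nmZ nm_real ger0_norm]. Qed.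

Lemma sublinear_oppr q x : sublinear q -> - q (- x) <= q x.
Proof.
move=> [qD qZ _]; have := qD x (- x); rewrite subrr; have := qD 0 0.
by rewrite addr0; lra.
Qed.

Lemma sublinearZ q (t : R) x : sublinear q -> 0 <= t -> q (t%:C *: x) = t * q x.
Proof.
move=> qs t0; have [_ qZ _] := qs; apply/eqP; rewrite eq_le qZ//=.
have [->|tn] := eqVneq t 0.
  by rewrite mul0r scale0r; have := sublinear_oppr 0 qs; rewrite oppr0; lra.
have tp : 0 < t by rewrite lt_neqAle eq_sym tn.
have := qZ t^-1 (t%:C *: x); rewrite invr_ge0 => /(_ t0).
by rewrite scalerA -rmorphM /= mulVf// scale1r ler_pdivlMl.
Qed.

(** Used for two families: the shifts indexed by t >= 0, and a chain of sublinear functionals in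
    Zorn's argument. The lower bound [b] ensures that the infimum is a genuine one. *)
Lemma sublinear_inf (I : Type) (D : set I) (f : I -> X -> R) (b : X -> R) :
  D !=set0 -> (forall i x, D i -> b x <= f i x) ->
  (forall x y i j, D i -> D j -> exists2 k, D k & f k (x + y) <= f i x + f j y) ->
  (forall t x i, 0 <= t -> D i -> exists2 k, D k & f k (t%:C *: x) <= t * f i x) ->
  (forall x, exists2 i, D i & f i x <= nm x) ->
  sublinear (fun x => inf [set f i x | i in D]) /\
  forall i x, D i -> inf [set f i x | i in D] <= f i x.
Proof.
move=> [i0 Di0] fb fD fZ fn; pose q x := inf [set f i x | i in D].
have lb x i : D i -> q x <= f i x.
  move=> Di; apply: ge_inf; last by exists i.
  by exists (b x) => _ [j Dj <-]; apply: fb.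
have gl x c : (forall i, D i -> c <= f i x) -> c <= q x.
  by move=> h; apply: lb_le_inf => [|_ [i Di <-]]; [exists (f i0 x), i0|exact: h].
split; last by move=> i x; apply: lb.
split=> [x y|t x t0|x].
- rewrite -lerBlDr; apply: (gl) => i Di; rewrite lerBlDr -lerBlDl; apply: gl => j Dj.
  by rewrite lerBlDl; have [k Dk] := fD x y i j Di Dj; apply: le_trans; apply: lb.
- have [->|tn] := eqVneq t 0.
    by have [k Dk] := fZ 0 x i0 (lexx _) Di0; rewrite !mul0r; apply: le_trans; apply: lb.
  have tp : 0 < t by rewrite lt_neqAle eq_sym tn.
  rewrite -ler_pdivrMl//; apply: gl => i Di; rewrite ler_pdivrMl//.
  by have [k Dk] := fZ t x i t0 Di; apply: le_trans; apply: lb.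
- by have [i Di] := fn x; apply: le_trans; apply: lb.
Qed.

(** [q'] is the infimum over t >= 0 of q (x + t y) - t q y: the value t = 0 keeps it below [q], and
    t = 1 gives the bound at [- y]. *)
Lemma sublinear_shift q y : sublinear q -> exists q', [/\ sublinear q',
  forall x, q' x <= q x & q' (- y) <= - q y].
Proof.
move=> qs; have [qD qZ qn] := qs.
pose f (t : R) x := q (x + t%:C *: y) - t * q y.
have f0 x : f 0 x = q x by rewrite /f scale0r addr0 mul0r subr0.
have [|||||qs' qle] := @sublinear_inf R [set t | 0 <= t] f (fun x => - q (- x)).
- by exists 0 => /=.
- move=> t x /= t0; have := qD (x + t%:C *: y) (- x).
  by rewrite addrAC subrr add0r /f sublinearZ//; lra.
- move=> x x' t s /= t0 s0; exists (t + s); first by rewrite /= addr_ge0.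
  have := qD (x + t%:C *: y) (x' + s%:C *: y); rewrite /f.
  have -> : x + t%:C *: y + (x' + s%:C *: y) = x + x' + (t + s)%:C *: y by rewrite rmorphD /=; module.
  lra.
- move=> t x s /= t0 s0; exists (t * s); first exact: mulr_ge0.
  have := qZ t (x + s%:C *: y) t0; rewrite /f scalerDr scalerA -rmorphM /=; lra.
- by move=> x; exists 0; rewrite /= ?f0.
exists (fun x => inf [set f t x | t in [set t | 0 <= t]]); split=> // [x|].
  by rewrite -f0; apply: qle => /=.
have := qle 1 (- y); rewrite /f /= ler01 scale1r addNr mul1r => /(_ isT) /le_trans; apply.
by have := qZ 0 0 (lexx 0); rewrite scaler0 mul0r; lra.
Qed.

(* A minimal sublinear functional coincides with all its shifts, hence is additive. *)
Theorem sublinear_minorant q : sublinear q -> exists phi : X -> R,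
  [/\ sublinear phi, forall x, phi x <= q x & forall x y, phi (x + y) = phi x + phi y].
Proof.
move=> qs; pose S := {p : X -> R | sublinear p /\ forall x, p x <= q x}.
pose mk (p : X -> R) (ps : sublinear p) (pq : forall x, p x <= q x) : S :=
  exist (fun p => sublinear p /\ forall x, p x <= q x) p (conj ps pq).
pose q0 : S := mk q qs (fun x => lexx (q x)).
pose r (p p' : S) : bool := `[< forall x, sval p' x <= sval p x >].
have [|||[phi [phis phiq]] phimin] := @ZL_preorder S q0 r.
- by move=> p; apply/asboolP.
- by move=> p1 p2 p3 /asboolP h1 /asboolP h2; apply/asboolP => x; apply: le_trans (h1 x).
- move=> A Atot; have [[p0 Ap0]|A0] := pselect (A !=set0); last first.
    by exists q0 => p Ap; case: A0; exists p.
  have [|||||ps ple] := @sublinear_inf S A (fun p => sval p) (fun x => - nm x).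
  + by exists p0.
  + move=> p x _; have [ps _] := svalP p; apply: le_trans (sublinear_oppr x ps).
    by rewrite lerN2 -(nmN x); case: ps.
  + move=> x y p p' Ap Ap'; have [/asboolP h|/asboolP h] := Atot p p' Ap Ap'.
      exists p' => //; have [[pD _ _] _] := svalP p'; apply: le_trans (pD x y) _.
      by rewrite lerD2r.
    exists p => //; have [[pD _ _] _] := svalP p; apply: le_trans (pD x y) _.
    by rewrite lerD2l.
  + by move=> t x p t0 Ap; exists p => //; have [[_ pZ _] _] := svalP p; apply: pZ.
  + by move=> x; exists p0 => //; have [[_ _ pn] _] := svalP p0.
  have pq x : inf [set sval p x | p in A] <= q x.
    by apply: le_trans (ple p0 x Ap0) _; have [_] := svalP p0.
  exists (mk _ ps pq) => p Ap; apply/asboolP => x /=; exact: ple.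
exists phi; split=> // x y; apply/eqP; rewrite eq_le; apply/andP; split.
  by have [pD _ _] := phis; apply: pD.
have [phi' [phis' le' leN]] := sublinear_shift y phis.
have pq' z : phi' z <= q z by apply: le_trans (phiq z).
have /asboolP H : r (mk _ phis' pq') (mk _ phis phiq).
  by apply: phimin; apply/asboolP.
have /= e1 := H (- y); have [pD _ _] := phis.
have := pD (x + y) (- y); rewrite addrK; lra.
Qed.

(** A real functional below the norm with value 1 at [x0] is made complex linear by T x = phi x - i
    phi (i x). The bound on T follows from rotating its value onto the positive axis. *)
Lemma norming_functional : (exists x : X, x != 0) ->
  exists (x0 : X) (T : 'L(X, C)), `|x0| = 1 /\ support_functionals x0 T.
Proof.
move=> [v v0]; have nv := nm_gt0 v0.
pose x0 := (nm v)^-1%:C *: v.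
have x01 : nm x0 = 1 by rewrite nmZ nm_real gtr0_norm ?invr_gt0// mulVf// gt_eqF.
(* Shifting the norm along [x0] beforehand forces every minorant to be at most -1 at [- x0], hence
   at least 1 at [x0] once it is additive. *)
have [p [ps ple pN]] := sublinear_shift x0 nm_sublinear.
have [phi [phis phip phiD]] := sublinear_minorant ps.
have [_ _ phin] := phis.
have phi0 : phi 0 = 0 by have := phiD 0 0; rewrite addr0; lra.
have phiN x : phi (- x) = - phi x by have := phiD x (- x); rewrite subrr phi0; lra.
have phiZ (t : R) x : phi (t%:C *: x) = t * phi x.
  have [t0|/ltW t0] := lerP 0 t; first exact: sublinearZ.
  have -> : t%:C *: x = - ((- t)%:C *: x) by rewrite rmorphN /= scaleNr opprK.
  by rewrite phiN sublinearZ ?oppr_ge0// mulNr opprK.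
have phix0 : phi x0 = 1.
  apply/eqP; rewrite eq_le -{1}x01 phin /=.
  by have := le_trans (phip (- x0)) pN; rewrite phiN x01 lerN2.
pose T (x : X) : C := phi x -i* phi ('i *: x).
have Tlin : linear T.
  case=> a b x y.
  have E (z : X) : (a +i* b) *: z = a%:C *: z + b%:C *: ('i *: z).
    by rewrite scalerA -scalerDl; congr (_ *: _); simpc.
  have ii (z : X) : 'i *: ('i *: z : X) = - z.
    by rewrite scalerA -expr2 sqr_i scaleN1r.
  have E' (z : X) : 'i *: ((a +i* b) *: z) = a%:C *: ('i *: z) - b%:C *: z.
    by rewrite E scalerDr !scalerA (mulrC 'i a%:C) (mulrC 'i b%:C) -!scalerA ii scalerN.
  rewrite /T scalerDr E' E !(phiD, phiN, phiZ).
  by apply/eqP; rewrite eq_complex /=; apply/andP; split; apply/eqP; ring.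
have TZ (a : R[i]) x : T (a *: x) = a * T x.
  have := Tlin a x 0; have -> : T 0 = 0 by rewrite /T scaler0 phi0 oppr0.
  by rewrite !addr0.
have nT x : nm (T x) <= nm x.
  have [->|Tn] := eqVneq (T x) 0; first by rewrite nm0 nm_ge0.
  (* The unimodular [u] makes T (u x) = |T x|, whose real part is phi (u x). *)
  pose u : R[i] := (nm (T x))%:C / T x.
  have nu : nm (u : C) = 1 by rewrite /u nmM nmV nm_real ger0_norm ?nm_ge0// mulfV// gt_eqF ?nm_gt0.
  have : complex.Re (T (u *: x)) = nm (T x) by rewrite TZ /u divfK.
  by move=> <-; apply: le_trans (phin _) _; rewrite nmZ nu mul1r.
have [A AE] : exists A : 'L(X, C), forall x, A x = T x.
  by apply: blin_mk => //; exists 1 => // h; rewrite mul1r.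
have Ax0 : A x0 = 1.
  (* The value has real part 1 and modulus at most 1, so its imaginary part vanishes. *)
  rewrite AE; have := nT x0; rewrite x01 /T phix0 => h.
  have : nm (1 -i* phi ('i *: x0) : C) ^+ 2 <= 1 by rewrite expr_le1 ?nm_ge0.
  rewrite nm_sqr /= expr1n gerDl sqrrN => h2.
  have /eqP : phi ('i *: x0) ^+ 2 = 0 by apply/eqP; rewrite eq_le h2 sqr_ge0.
  by rewrite sqrf_eq0 => /eqP ->; rewrite oppr0.
exists x0, A; have x01' : `|x0| = 1 by rewrite -nmE x01.
split=> //; split; first by rewrite x01'.
rewrite -nmE; congr (_%:C); apply/eqP; rewrite eq_le; apply/andP; split.
  by apply: blin_le => // x; rewrite AE mul1r.
by have := blin_apply A x0; rewrite x01 mulr1 Ax0 nm1.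
Qed.

End HahnBanach.

(** * Complex logarithm and powers on the right half-plane *)

Section ComplexPower.
Variable R : realType.
Local Notation C := (R[i]^o).

Lemma is_derive_continuous (f : R -> R) (x d : R) : is_derive x 1 f d -> forall e : R, 0 < e ->
  exists2 r : R, 0 < r & forall h, `|h| < r -> `|f (x + h) - f x| <= e.
Proof.
move=> fx e e0; have [r r0 rP] := is_derive_dif fx ltr01.
have d1 : 0 < `|d| + 1 by rewrite ltr_pwDr.
exists (Num.min r (e / (`|d| + 1))); first by rewrite lt_min r0 divr_gt0.
move=> h; rewrite lt_min => /andP[/rP H]; rewrite ltr_pdivlMr// => he.
have -> : f (x + h) - f x = (f (x + h) - f x - d * h) + d * h by rewrite subrK.
by apply: le_trans (ler_normD _ _) _; rewrite normrM; move: H he; rewrite mul1r mulrDr mulr1 mulrC; lra.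
Qed.

(* The principal branch; only its values on the right half-plane are meaningful. *)
Definition clog (u : C) : C := ln (nm u) +i* atan (complex.Im u / complex.Re u).

Lemma cexp_clog (u : C) : 0 < complex.Re u -> cexp (clog u) = u.
Proof.
case: u => a b /= a0; set u : C := a +i* b.
have u0 : u != 0 by apply/eqP => -[] /eqP; rewrite gt_eqF.
have s0 : 0 < Num.sqrt (1 + (b / a) ^+ 2) by rewrite sqrtr_gt0 ltr_pwDl ?sqr_ge0.
have nu : nm u = a * Num.sqrt (1 + (b / a) ^+ 2).
  apply: complexI; rewrite cnmE normc_def /=; congr (_%:C).
  rewrite -{2}(gtr0_norm a0) -sqrtr_sqr -sqrtrM ?sqr_ge0//; congr Num.sqrt.
  by field; rewrite gt_eqF.
have ca : cos (atan (b / a)) = (Num.sqrt (1 + (b / a) ^+ 2))^-1 := cos_atan _.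
have ca0 : cos (atan (b / a)) != 0 by rewrite ca invr_eq0 gt_eqF.
have sa : sin (atan (b / a)) = b / a * cos (atan (b / a)).
  by have := atanK (b / a); rewrite /tan => {2}<-; rewrite divfK.
rewrite /clog cexpE lnK ?posrE ?nm_gt0// sa ca nu.
apply/eqP; rewrite eq_complex /=; apply/andP; split; apply/eqP; field; rewrite ?gt_eqF//.
Qed.

Lemma clog_continuous (u : C) : 0 < complex.Re u -> continuous_at clog u.
Proof.
move=> a0 e e0; have e2 : 0 < e / 2 by rewrite divr_gt0.
set a := complex.Re u in a0 *; pose b := complex.Im u.
have u0 : u != 0 by apply/eqP => E; move: a0; rewrite /a E /= ltxx.
have nu := nm_gt0 u0.
have [d1 d10 h1] := is_derive_continuous (is_derive1_ln nu) e2.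
have [d2 d20 h2] := is_derive_continuous (is_derive1_atan (b / a)) e2.
(* The fraction bounds the change of Im / Re per unit of [nm h] as long as the real part stays above
   a / 2; the added 1 makes it positive. *)
have q0 : 0 < (a + `|b|) / (a * a / 2) + 1.
  by rewrite ltr_pwDr// divr_ge0 ?addr_ge0 ?(ltW a0)// divr_ge0// mulr_ge0 ?(ltW a0).
exists (Num.min (a / 2) (Num.min d1 (d2 / ((a + `|b|) / (a * a / 2) + 1)))).
  by rewrite !lt_min d10 !divr_gt0.
move=> h; rewrite !lt_min => /and3P[ha hd1]; rewrite ltr_pdivlMr// => hd2.
have hR := nm_Re h; have hI := nm_Im h.
apply: le_trans (nm_ReIm _) _.
have -> : complex.Re (clog (u + h) - clog u) = ln (nm (u + h)) - ln (nm u) by [].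
have -> : complex.Im (clog (u + h) - clog u) =
    atan (complex.Im (u + h) / complex.Re (u + h)) - atan (b / a) by [].
have H1 : `|ln (nm (u + h)) - ln (nm u)| <= e / 2.
  have := h1 (nm (u + h) - nm u); rewrite [nm u + _]addrC subrK; apply; apply: le_lt_trans hd1.
  rewrite ler_norml; have := nmD u h; have := nmB (u + h) h; rewrite addrK; lra.
set p := complex.Im (u + h) / complex.Re (u + h).
have H2 : `|atan p - atan (b / a)| <= e / 2.
  have := h2 (p - b / a); rewrite [b / a + _]addrC subrK; apply; apply: le_lt_trans hd2.
  have -> : p = (b + complex.Im h) / (a + complex.Re h).
    by rewrite /p /b /a; case: (u) (h) => ? ? [].
  move: hR hI; set x := complex.Re h; set y := complex.Im h => hR hI.
  have ax : a / 2 <= a + x by move: hR; rewrite ler_norml; lra.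
  have ax0 : 0 < a + x by lra.
  have -> : (b + y) / (a + x) - b / a = (a * y - b * x) / (a * (a + x)).
    by field; rewrite !gt_eqF.
  rewrite normrM normfV (gtr0_norm (mulr_gt0 a0 ax0)) ler_pdivrMr ?mulr_gt0//.
  have n0 := nm_ge0 h.
  have l1 : `|a * y - b * x| <= (a + `|b|) * nm h.
    apply: le_trans (ler_normB _ _) _; rewrite !normrM (gtr0_norm a0) mulrDl.
    by apply: lerD; apply: ler_wpM2l => //; exact: ltW.
  apply: le_trans l1 _.
  have aa : a * a / 2 <= a * (a + x) by rewrite -mulrA ler_pM2l.
  have aa0 : 0 < a * a / 2 by rewrite divr_gt0// mulr_gt0.
  set Q := (a + `|b|) / (a * a / 2).
  have QE : a + `|b| = Q * (a * a / 2) by rewrite /Q divfK// gt_eqF.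
  have Q0 : 0 <= Q by rewrite divr_ge0 ?addr_ge0 ?(ltW a0) ?(ltW aa0).
  rewrite QE mulrAC; apply: ler_pM => //; [exact: mulr_ge0|exact: ltW|].
  by rewrite mulrC ler_wpM2l// lerDl.
by move: H1 H2; lra.
Qed.

(** Derivative of an inverse function: with [k] the increment of the logarithm, cexp k - 1 = h / u
    exactly, and [k] is small by continuity. *)
Lemma der_clog (u : C) : 0 < complex.Re u -> der clog u (u^-1 : C).
Proof.
move=> a0 e e0.
have u0 : u != 0 by apply/eqP => E; move: a0; rewrite E /= ltxx.
have nu := nm_gt0 u0.
(* The bound 1/2 gives |k| <= 2 |h| / |u|; the second bound then brings the error n |k| below e
   |h|. *)
pose n := Num.min (2^-1) (e * nm u / 2).
have n0 : 0 < n by rewrite lt_min invr_gt0 ltr0n !(divr_gt0, mulr_gt0).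
have n1 : n <= 2^-1 by rewrite ge_min lexx.
have n2 : n <= e * nm u / 2 by rewrite ge_min lexx orbT.
have [d d0 dP] := der_cexp0 n0.
have d2 : 0 < d / 2 by rewrite divr_gt0.
have [r r0 rP] := clog_continuous a0 d2.
exists (Num.min r (complex.Re u)); first by rewrite lt_min r0.
move=> h; rewrite lt_min => /andP[/rP hr ha].
set k := clog (u + h) - clog u in hr *.
have ah : 0 < complex.Re (u + h).
  have := nm_Re h; rewrite ler_norml => /andP[h1 _].
  rewrite raddfD /=; lra.
have kE : cexp k - 1 = h / u.
  have : cexp k * cexp (clog u) = u + h by rewrite -cexpD subrK cexp_clog.
  rewrite cexp_clog// => E; apply: (mulIf u0).
  by rewrite mulrBl E mul1r divfK// addrAC subrr add0r.
have := dP k ltac:(lra); rewrite add0r cexp0 kE -[k *: (1 : C)]/((k : R[i]) * 1) mulr1 => H.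
rewrite -[_ *: _]/((h : R[i]) / u) nm_distC.
have nhu : nm (h / u : C) = nm h / nm u by rewrite nmM nmV.
have kb : nm k <= 2 * (nm h / nm u).
  have := nmB (h / u : C) (h / u - k); rewrite subKr nhu.
  have : n * nm k <= 2^-1 * nm k by rewrite ler_wpM2r ?nm_ge0.
  lra.
apply: le_trans H _; apply: le_trans (ler_wpM2l (ltW n0) kb) _.
apply: le_trans (ler_wpM2r _ n2) _; first by rewrite mulr_ge0// divr_ge0 ?nm_ge0.
by rewrite le_eqVlt; apply/orP; left; apply/eqP; field; rewrite gt_eqF.
Qed.

Lemma cexp_eq1 (z : C) : - pi < complex.Im z < pi -> cexp z = 1 -> z = 0.
Proof.
case: z => x y /= /andP[y1 y2]; rewrite cexpE => -[Ec Es].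
have y0 : y = 0.
  have sy : sin y = 0 by move/eqP: Es; rewrite mulf_eq0 expR_eq0 /= => /eqP.
  apply/eqP; rewrite eq_le !leNgt; apply/andP; split; apply/negP => yn.
    by have := @sin_gt0_pi R y; rewrite yn y2 sy ltxx => /(_ isT).
  have := @sin_gt0_pi R (- y); rewrite sinN sy oppr0 ltxx oppr_gt0 yn /= ltrNl y1.
  by move=> /(_ isT).
move: Ec; rewrite y0 cos0 mulr1 -expR0 => /expR_inj ->.
by [].
Qed.

(* [cpow b z] is [(1 - i z) ^ (- b)]. *)
Definition cpow (b : R) (z : C) : C := cexp ((- b)%:C * clog (1 - 'i * z)).

Lemma Re_1iz (z : C) : complex.Re (1 - 'i * z) = 1 + complex.Im z.
Proof. by case: z => x y /=; ring. Qed.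

Lemma Re_1iz_gt0 (z : C) : nm z < 1 -> 0 < complex.Re (1 - 'i * z).
Proof.
by move=> z1; rewrite Re_1iz; have := nm_Im z; rewrite ler_norml => /andP[]; lra.
Qed.

Lemma iz_neq0 (z : C) : nm z < 1 -> 1 - 'i * z != 0.
Proof. by move=> /Re_1iz_gt0 h; apply/eqP => E; move: h; rewrite E /= ltxx. Qed.

Lemma cpow_neq0 b z : cpow b z != 0. Proof. exact: cexp_neq0. Qed.

Lemma cpow0 b : cpow b 0 = 1.
Proof.
by rewrite /cpow mulr0 subr0 /clog nm1 ln1 /= mul0r atan0 -[_ +i* _]/(0 : C) mulr0 cexp0.
Qed.

Lemma cpowS b (z : C) : nm z < 1 -> cpow (b + 1) z = cpow b z / (1 - 'i * z).
Proof.
move=> z1; apply: (mulIf (iz_neq0 z1)); rewrite divfK ?iz_neq0//.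
rewrite -[X in _ * X = _](cexp_clog (Re_1iz_gt0 z1)) /cpow -cexpD; congr cexp.
by rewrite opprD rmorphD rmorphN1 /=; ring.
Qed.

Lemma der_cpow b (z : C) : nm z < 1 -> der (cpow b) z (b%:C * 'i * cpow (b + 1) z : C).
Proof.
move=> z1.
have d1 : der (fun w : C => 1 - 'i * w : C) z (- 'i : C).
  have := der_add (der_cst 1 z) (der_mul (der_cst (- 'i) z) (der_id z)).
  move=> H; apply: dif_ext (dif_ext_lin _ H); first by exists 1 => // h _; rewrite mulNr.
  by move=> h; congr (_ *: _); ring.
have d2 := der_comp d1 (der_clog (Re_1iz_gt0 z1)).
have d3 := der_comp (der_mul (der_cst ((- b)%:C) z) d2) (der_cexp _).
move: d3; congr (der _ _ _).
rewrite cpowS// -![_ *: _]/((_ : R[i]) * _) rmorphN /= -/(cpow b z) /cpow rmorphN /=.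
by field; exact: iz_neq0.
Qed.

(** The point w = 1 - i z lies in the disc |w - 1| < 1, which inversion maps into the half-plane Re
    > 1/2; the term is 1 / w - 1. *)
Lemma Re_power_term (z : C) : nm z < 1 -> - 2^-1 <= complex.Re ('i * z / (1 - 'i * z)).
Proof.
move=> z1; have w0 := iz_neq0 z1; set w := 1 - 'i * z in w0 *.
have -> : 'i * z / w = w^-1 - 1 by rewrite /w; field.
have nw : nm w ^+ 2 <= 2 * complex.Re w.
  have : nm (1 - w : C) ^+ 2 <= 1.
    rewrite /w opprB addrC subrK nmM.
    have -> : nm ('i : C) = 1 by apply: complexI; rewrite cnmE normc_def /= expr0n expr1n add0r sqrtr1.
    by rewrite mul1r expr_le1 ?nm_ge0// ltW.
  rewrite !nm_sqr; case: (w) => a b /=; lra.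
have nw0 := nm_gt0 w0.
rewrite raddfB /= invc_norm mulrC.
have -> : complex.Re (w^* * `|w : R[i]| ^- 2) = complex.Re w / nm w ^+ 2.
  rewrite -cnmE -rmorphXn -fmorphV /=; case: (w) => a b /=; ring.
have : 2^-1 <= complex.Re w / nm w ^+ 2 by rewrite ler_pdivlMr ?exprn_gt0//; lra.
lra.
Qed.

(** The logarithm has imaginary part within pi / 2 of 0; multiplied by b <= 2 it stays within pi,
    where the exponential takes the value 1 only at 0. It is applied with b = 2 lam. *)
Lemma cpow_eq1 b (z : C) : 0 < b <= 2 -> nm z < 1 -> cpow b z = 1 -> z = 0.
Proof.
move=> /andP[b0 b2] z1 /cexp_eq1; set L := clog _.
have LI : - (pi / 2) < complex.Im L < pi / 2 by rewrite atan_gtNpi2 atan_ltpi2.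
have -> : complex.Im ((- b)%:C * L) = - b * complex.Im L by case: (L) => x y /=; ring.
case/andP: LI => l1 l2.
have p0 : 0 < pi / 2 :> R by rewrite divr_gt0 ?pi_gt0.
have -> : - pi < - b * complex.Im L < pi.
  by apply/andP; split; nra.
move=> /(_ isT) /eqP; rewrite mulf_eq0 -(rmorph0 (real_complex R)) (inj_eq (@complexI R)) oppr_eq0 gt_eqF//=.
rewrite rmorph0 => /eqP L0.
have := cexp_clog (Re_1iz_gt0 z1); rewrite -/L L0 cexp0 => /eqP.
rewrite -subr_eq0 opprB addrC subrK mulf_eq0 => /orP[/eqP[] /eqP|/eqP//].
by rewrite oner_eq0.
Qed.

End ComplexPower.

(** * The extremal function of one variable *)

Section Extremal.
Variables (R : realType) (lam : R).
Hypothesis lam_itv : 2^-1 <= lam <= 1.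
Local Notation C := (R[i]^o).

(** Rising factorial of 1 + 2 lam times i^n: the constants produced by differentiating the power (1
    - i z)^-(1 + 2 lam). *)
Fixpoint ext_coef n : C :=
  if n is n'.+1 then ext_coef n' * ((1 + 2 * lam + n'%:R)%:C * 'i) else 1.

(* The iterated derivatives of [((1 - i z) ^ (- 2 lam) - 1) / (2 lam i)]. *)
Definition ext_fun n (z : C) : C :=
  if n is n'.+1 then ext_coef n' * cpow (1 + 2 * lam + n'%:R) z
  else (cpow (2 * lam) z - 1) / ((2 * lam)%:C * 'i).

Let lam0 : 0 < 2 * lam. Proof. by case/andP: lam_itv => ? _; lra. Qed.

Let i0 : ('i : C) != 0. Proof. by apply/eqP => -[] /eqP; rewrite oner_eq0. Qed.

Let lamC : ((2 * lam)%:C : C) != 0.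
Proof. by rewrite -(rmorph0 (real_complex R)) (inj_eq (@complexI R)) gt_eqF. Qed.

Let lamC' : (lam%:C : C) != 0.
Proof. by have := lamC; rewrite rmorphM /= mulf_eq0 negb_or => /andP[]. Qed.

Lemma der_ext_fun n (z : C) : nm z < 1 -> der (ext_fun n) z (ext_fun n.+1 z).
Proof.
move=> z1; case: n => [|n].
  have H := der_mul (der_add (der_cpow (2 * lam) z1) (der_cst (-1) z)) (der_cst ((2 * lam)%:C * 'i)^-1 z).
  move: H; congr (der _ _ _); rewrite /=.
  have -> : 1 + 2 * lam + 0%:R = 2 * lam + 1 by ring.
  by field; rewrite i0 lamC'.
have H := der_mul (der_cst (ext_coef n) z) (der_cpow (1 + 2 * lam + n%:R) z1).
have E : 1 + 2 * lam + n.+1%:R = 1 + 2 * lam + n%:R + 1 by rewrite -(natr1 n) addrA.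
by move: H; congr (der _ _ _); rewrite /= E; ring.
Qed.

Lemma ext_fun0 : ext_fun 0 0 = 0.
Proof. by rewrite /= cpow0 subrr mul0r. Qed.

(** On the kernel of T the derivative of the extremal map is multiplication by f(z) / z with z = T
    x, so its invertibility requires that f have no zero other than 0. *)
Lemma ext_fun_neq0 (z : C) : nm z < 1 -> z != 0 -> ext_fun 0 z != 0.
Proof.
move=> z1; apply: contra => /=; rewrite mulf_eq0 invr_eq0 mulf_eq0 (negPf i0) (negPf lamC) !orbF.
rewrite subr_eq0 => /eqP h; apply/eqP; apply: cpow_eq1 h => //.
by case/andP: lam_itv => h1 h2; apply/andP; split; lra.
Qed.

Lemma ext_fun1_neq0 (z : C) : ext_fun 1 z != 0.
Proof. by rewrite /= mul1r cpow_neq0. Qed.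

(** The expression is 1 + (1 + 2 lam) i z / (1 - i z), and 1 - (1 + 2 lam) / 2 = 1/2 - lam. *)
Lemma ext_fun_Re (z : C) : nm z < 1 ->
  2^-1 - lam <= complex.Re ((z * ext_fun 2 z + ext_fun 1 z) / ext_fun 1 z).
Proof.
move=> z1; have h := Re_power_term z1.
have -> : (z * ext_fun 2 z + ext_fun 1 z) / ext_fun 1 z =
    1 + (1 + 2 * lam)%:C * ('i * z / (1 - 'i * z)).
  have E : 1 + 2 * lam + 1%:R = (1 + 2 * lam + 0%:R) + 1 by ring.
  rewrite /= E cpowS// addr0; field.
  by rewrite iz_neq0// cpow_neq0.
have -> (t : R) (w : C) : complex.Re (1 + t%:C * w) = 1 + t * complex.Re w.
  by case: w => x y /=; ring.
by have := lam0; move: h; set r := complex.Re _; nra.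
Qed.

Definition ext_quot (z : C) : C := if z == 0 then 1 else ext_fun 0 z / z.

Lemma ext_quotE (z : C) : z * ext_quot z = ext_fun 0 z.
Proof.
rewrite /ext_quot; case: eqP => [->|/eqP z0]; first by rewrite ext_fun0 mul0r.
by rewrite mulrC divfK.
Qed.

Lemma ext_quot_neq0 (z : C) : nm z < 1 -> ext_quot z != 0.
Proof.
move=> z1; rewrite /ext_quot; have [_|z0] := eqVneq z 0; first exact: oner_neq0.
by rewrite mulf_neq0 ?invr_eq0 ?ext_fun_neq0.
Qed.

Lemma ext_fun10 : ext_fun 1 0 = 1.
Proof. by rewrite /= mul1r cpow0. Qed.

Lemma der_ext_quot (z : C) : nm z < 1 -> exists D, der ext_quot z D.
Proof.
move=> z1; have [->|z0] := eqVneq z 0; last first.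
  have H := der_mul (der_ext_fun 0 z1) (der_inv z0).
  exists (ext_fun 0 z * - z ^- 2 + ext_fun 1 z * z^-1); apply: dif_ext H.
  exists (nm z) => [|h hz]; first exact: nm_gt0.
  rewrite /ext_quot; case: eqP => // E; move: hz.
  by have -> : h = - z by [apply/eqP; rewrite -addr_eq0 addrC E]; rewrite nmN ltxx.
(* At 0 the quotient is differentiable because f(z) = z + D z^2 / 2 + o(z^2), obtained by
   integrating the expansion of f'. *)
have z00 : nm (0 : C) < 1 by rewrite nm0.
set D := ext_fun 2 0.
have L1 : lo 1 (fun z => ext_fun 1 z - 1 - z * D).
  move=> e e0; have [d d0 dP] := der_ext_fun 1 z00 e0.
  by exists d => // h /dP; rewrite add0r ext_fun10 expr1.
have L2 : lo 2 (fun z => ext_fun 0 z - z - D / 2 * (z * z)).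
  have := lo_integral (f := fun z => ext_fun 0 z + -1 * z + - (D / 2) * (z * z)) _ L1 => H.
  apply: lo_ext (H _) => [|w w1].
    by exists 1 => // w _; rewrite ext_fun0; ring.
  have := der_add (der_add (der_ext_fun 0 w1) (der_mul (der_cst (-1) w) (der_id w)))
    (der_mul (der_cst (- (D / 2)) w) (der_mul (der_id w) (der_id w))).
  by congr (der _ _ _); field.
exists (D / 2) => e e0; have [d d0 dP] := L2 _ e0.
exists d => // h /dP H; rewrite add0r /ext_quot eqxx.
case: eqP => [->|/eqP h0]; first by rewrite scale0r subr0 subrr !nm0 mulr0.
have -> : ext_fun 0 h / h - 1 - (h : R[i]) *: (D / 2 : C) = (ext_fun 0 h - h - D / 2 * (h * h)) / h.
  by rewrite -[_ *: _]/((h : R[i]) * (D / 2)); field.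
rewrite nmM nmV ler_pdivrMr ?nm_gt0//; apply: le_trans H _.
by rewrite expr2 mulrA.
Qed.

Lemma ext_T31 : let A n := (n`!)%:R^-1 * ext_fun n 0 in
  nm (\det (sym_toeplitz3 1 (A 2%N) (A 3%N)) : C) =
    (4 + 3 * lam + 2 * lam ^+ 2) * (7 + 6 * lam + 8 * lam ^+ 2) / 18.
Proof.
move=> A; have l0 := lam0.
have -> : A 2%N = ((1 + 2 * lam) / 2)%:C * 'i.
  rewrite /A -[(2`!)%N]/2%N /= cpow0 mulr1 addr0 mul1r rmorphM /= fmorphV rmorph_nat.
  by field.
have -> : A 3%N = - ((1 + 2 * lam) * (2 + 2 * lam) / 6%:R)%:C.
  rewrite /A -[(3`!)%N]/6%N /= cpow0 mulr1 addr0 mul1r.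
  have -> : 1 + 2 * lam + 1%:R = 2 + 2 * lam by ring.
  rewrite [X in _ * X](_ : _ = ((1 + 2 * lam)%:C * (2 + 2 * lam)%:C) * 'i ^+ 2); last by ring.
  by rewrite sqr_i !rmorphM /= fmorphV rmorph_nat; field.
rewrite det_sym_toeplitz3.
set s := (1 + 2 * lam) * _ / _.
have -> : (1 - (- s%:C)) * (1 ^+ 2 + 1 * (- s%:C) - 2 * (((1 + 2 * lam) / 2)%:C * 'i) ^+ 2) =
   ((1 + s) * (1 - s + (1 + 2 * lam) ^+ 2 / 2))%:C :> R[i].
  rewrite exprMn sqr_i /s !(rmorphM, rmorphD, rmorphB, rmorph1, rmorph_nat) /= ?fmorphV ?rmorph_nat.
  by field.
rewrite nm_real /s ger0_norm; first by field.
by apply: mulr_ge0; nra.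
Qed.

Lemma ext_T32 : let A n := (n`!)%:R^-1 * ext_fun n 0 in
  nm (\det (sym_toeplitz3 (A 2%N) (A 3%N) (A 4%N)) : C) =
    864^-1 * (1 + 2 * lam) ^+ 3 * (9 + 5 * lam + 2 * lam ^+ 2) * (25 + 17 * lam + 10 * lam ^+ 2).
Proof.
move=> A; have l0 := lam0.
have -> : A 2%N = ((1 + 2 * lam) / 2)%:C * 'i.
  rewrite /A -[(2`!)%N]/2%N /= cpow0 mulr1 addr0 mul1r rmorphM /= fmorphV rmorph_nat.
  by field.
have -> : A 3%N = - ((1 + 2 * lam) * (2 + 2 * lam) / 6%:R)%:C.
  rewrite /A -[(3`!)%N]/6%N /= cpow0 mulr1 addr0 mul1r.
  have -> : 1 + 2 * lam + 1%:R = 2 + 2 * lam by ring.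
  rewrite [X in _ * X](_ : _ = ((1 + 2 * lam)%:C * (2 + 2 * lam)%:C) * 'i ^+ 2); last by ring.
  by rewrite sqr_i !rmorphM /= fmorphV rmorph_nat; field.
have -> : A 4%N = - ((1 + 2 * lam) * (2 + 2 * lam) * (3 + 2 * lam) / 24%:R)%:C * 'i.
  rewrite /A -[(4`!)%N]/24%N /= cpow0 mulr1 addr0 mul1r.
  have -> : 1 + 2 * lam + 1%:R = 2 + 2 * lam by ring.
  have -> : 1 + 2 * lam + 2%:R = 3 + 2 * lam by ring.
  rewrite [X in _ * X](_ : _ = ((1 + 2 * lam)%:C * (2 + 2 * lam)%:C * (3 + 2 * lam)%:C) * 'i ^+ 2 * 'i); last by ring.
  by rewrite sqr_i !rmorphM /= fmorphV rmorph_nat; field.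
rewrite det_sym_toeplitz3.
set p := (1 + 2 * lam) / 2; set s := (1 + 2 * lam) * (2 + 2 * lam) / 6%:R; set q := _ / 24%:R.
have -> : (p%:C * 'i - - q%:C * 'i) * ((p%:C * 'i) ^+ 2 + p%:C * 'i * (- q%:C * 'i) - 2 * (- s%:C) ^+ 2) =
  ((p + q) * - (p ^+ 2 - p * q + 2 * s ^+ 2))%:C * 'i :> R[i].
  have -> : (p%:C * 'i) ^+ 2 + p%:C * 'i * (- q%:C * 'i) - 2 * (- s%:C) ^+ 2 =
     (p%:C ^+ 2 - p%:C * q%:C) * 'i ^+ 2 - 2 * s%:C ^+ 2 :> R[i] by ring.
  rewrite sqr_i !(rmorphM, rmorphN, rmorphD, rmorphB, rmorphXn, rmorph_nat) /=; ring.
have ni : nm ('i : C) = 1 by apply: complexI; rewrite cnmE normc_def /= expr0n expr1n add0r sqrtr1.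
rewrite nmM ni mulr1 nm_real mulrN normrN ger0_norm /p /q /s; first by field.
have -> : ((1 + 2 * lam) / 2) ^+ 2 - (1 + 2 * lam) / 2 * ((1 + 2 * lam) * (2 + 2 * lam) * (3 + 2 * lam) / 24) +
  2 * ((1 + 2 * lam) * (2 + 2 * lam) / 6) ^+ 2 = (1 + 2 * lam) ^+ 2 * (25 + 17 * lam + 10 * lam ^+ 2) / 72 by field.
have l1 : 0 <= lam by lra.
by rewrite !(mulr_ge0, addr_ge0, divr_ge0, sqr_ge0)//.
Qed.

End Extremal.

(** * The extremal map on the ball *)

Section ExtremalMap.
Variables (R : realType) (X : completeNormedModType R[i]) (lam : R).
Hypothesis lam_itv : 2^-1 <= lam <= 1.
Local Notation C := (R[i]^o).
Variables (x0 : X) (T : 'L(X, C)).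
Hypotheses (x01 : `|x0| = 1) (T_supp : support_functionals x0 T).

Definition ext_scalar (x : X) : C := ext_quot lam (T x).
Definition ext_map (x : X) : X := (ext_scalar x : R[i]) *: x.

Let nx0 : nm x0 = 1. Proof. by apply: complexI; rewrite nmE x01. Qed.

Let Tx0 : T x0 = 1. Proof. by case: T_supp => ->; rewrite x01. Qed.

Let nT x : nm (T x) <= nm x.
Proof.
have nT1 : nm T = 1 by apply: complexI; rewrite nmE; case: T_supp => _ ->.
by apply: le_trans (blin_apply T x) _; rewrite nT1 mul1r.
Qed.

Let fext n (z : C) : C := ext_fun lam n z.

Lemma ext_scalar_dif x : nm x < 1 -> exists2 d : C, der (ext_quot lam) (T x) d &
  exists2 A : 'L(X, C), dif ext_scalar x A & forall h, A h = (T h : R[i]) *: d.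
Proof.
move=> x1; have Tx1 := le_lt_trans (nT x) x1.
have [d dd] := der_ext_quot lam_itv Tx1; exists d => //.
have H := dif_comp (blin_bounded T) (bounded_at_scale d) (fun u v : C => scalerDl d (u : R[i]) v) (dif_blin T x) dd.
have [A AE] : exists A : 'L(X, C), forall h, A h = (T h : R[i]) *: d.
  apply: blin_mk => [a u v|]; first by rewrite blinD blinZ scalerDl scalerA.
  have [M M0 TM] := blin_bounded T; have [N N0 dN] := bounded_at_scale d.
  exists (N * M) => [|h]; first exact: mulr_gt0.
  by apply: le_trans (dN _) _; rewrite -mulrA ler_wpM2l// ltW.
by exists A => //; apply: dif_ext_lin H => h; rewrite AE.
Qed.

Lemma ext_quot_der_eq (z d : C) : nm z < 1 -> der (ext_quot lam) z d ->
  ext_quot lam z + z * d = fext 1 z.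
Proof.
move=> z1 dd.
have H1 := der_mul (der_id z) dd.
have H2 : der (fun w : C => w * ext_quot lam w : C) z (fext 1 z).
  by apply: dif_ext (der_ext_fun lam_itv 0 z1); exists 1 => // h _; rewrite ext_quotE.
have Z (e : C) (a : R[i]) (h : C) : (a *: h : R[i]) *: e = a *: ((h : R[i]) *: e) by rewrite scalerA.
have := dif_unique (Z _) (Z _) H1 H2 (1 : C).
by rewrite !scale1r mul1r addrC.
Qed.

Lemma ext_map_fd x : nm x < 1 -> exists2 d : C, der (ext_quot lam) (T x) d &
  differentiable ext_map x /\
  forall h, fd ext_map x h = (ext_scalar x : R[i]) *: h + ((T h : R[i]) * d) *: x.
Proof.
move=> x1; have [d dd [A dA AE]] := ext_scalar_dif x1; exists d => //.
have bid : bounded_at (fun h : X => h) by exists 1 => // h; rewrite mul1r.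
have H := dif_scale (blin_bounded A) bid dA (@dif_id _ _ x).
have [B BE] : exists B : 'L(X, X), forall h, B h = (ext_scalar x : R[i]) *: h + (A h : R[i]) *: x.
  apply: blin_mk => [a u v|]; first by rewrite blinD blinZ; module.
  have [M M0 AM] := blin_bounded A.
  exists (nm (ext_scalar x) + M * nm x + 1) => [|h].
    by rewrite ltr_pwDr// addr_ge0 ?nm_ge0// mulr_ge0 ?nm_ge0// ltW.
  apply: le_trans (nmD _ _) _; rewrite !nmZ.
  by have := ler_wpM2r (nm_ge0 x) (AM h); have := nm_ge0 h; lra.
have [dF fdE] := dif_differentiable (dif_ext_lin (fun h => esym (BE h)) H).
by split=> // h; rewrite fdE BE AE.
Qed.

Lemma ext_map_holomorphic : holomorphic (@unit_ball R X) ext_map.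
Proof. by move=> x /unit_ballE/ext_map_fd[d _ []]. Qed.

Lemma ext_map_fd_radial x : nm x < 1 -> fd ext_map x x = (fext 1 (T x) : R[i]) *: x.
Proof.
move=> x1; have [d dd [_ ->]] := ext_map_fd x1.
by rewrite -scalerDl (ext_quot_der_eq (le_lt_trans (nT x) x1) dd).
Qed.

(** No formula for the second derivative is required: it is read off along the ray through [x], by
    differentiating at w = 1 the map sending w to DF(w x) x = f'(w T x) x. *)
Lemma ext_map_diag2 x : nm x < 1 ->
  mlin_diag x (frechet 2 ext_map x) = (T x * fext 2 (T x) : R[i]) *: x.
Proof.
move=> x1; set z := T x; have z1 : nm z < 1 := le_lt_trans (nT x) x1.
have xB : unit_ball x by apply/unit_ballE.
have xE : x = 0 + (1 : R[i]) *: x by rewrite add0r scale1r.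
have := fdP (frechet_differentiable 1 ext_map_holomorphic xB).
rewrite {1}xE => /der_slice.
move=> /(dif_lin (@mlin_diagB _ _ X 1 x) (@mlin_diag_bounded _ _ X 1 x)) H1.
have H2 : der (fun w : C => (fext 1 (w * z) : R[i]) *: x) (1 : C) ((z * fext 2 z : R[i]) *: x).
  have dl : der (fun w : C => w * z : C) (1 : C) (z : C).
    by have := der_mul (der_id 1) (der_cst z 1); congr der; rewrite mulr0 mul1r add0r.
  have dz : der (fext 1) (1 * z) (fext 2 (1 * z)) by apply: der_ext_fun; rewrite ?mul1r.
  have [M M0 HM] := bounded_at_scale x.
  have := dif_lin (fun u v : C => scalerBl (u : R[i]) v x) (ex_intro2 _ _ M M0 HM) (der_comp dl dz).
  by apply: dif_ext_lin => h; rewrite mul1r [RHS]scalerA -![_ *: (_ : C)]/((_ : R[i]) * _) mulrA.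
have H3 : der (fun w : C => (fext 1 (w * z) : R[i]) *: x) (1 : C) (mlin_diag x (frechet 2 ext_map x)).
  apply: dif_ext_lin (dif_ext _ H1) => [h|].
    exact: (@mlin_diagZ _ X X 1 x h _).
  exists (1 - nm x) => [|h h1]; first by rewrite subr_gt0.
  cbv beta; rewrite add0r; set a : R[i] := 1 + h.
  have na : nm (a : C) <= 1 + nm h by rewrite -(nm1 R); exact: nmD.
  have ax1 : nm (a *: x) < 1.
    rewrite nmZ; have := ler_wpM2r (nm_ge0 x) na.
    have : nm h * nm x <= nm h by rewrite ler_piMr ?nm_ge0// ltW.
    lra.
  have [d dd [_ dE]] := ext_map_fd ax1.
  rewrite -[LHS]/(fd ext_map (a *: x) x) dE scalerA -scalerDl; congr (_ *: _).
  have Ta : T (a *: x) = a * z by rewrite blinZ.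
  have := ext_quot_der_eq (le_lt_trans (nT _) ax1) dd; rewrite Ta => <-.
  by rewrite /ext_scalar Ta -/z; ring.
have Z (e : X) (a : R[i]) (h : C) : (a *: h : R[i]) *: e = a *: ((h : R[i]) *: e) by rewrite scalerA.
by have := dif_unique (Z _) (Z _) H3 H2 (1 : C); rewrite !scale1r.
Qed.

(** The derivative is a scalar [k] plus an operator of rank one; the inverse is given by the
    Sherman-Morrison formula, with denominators [k] = f(T x) / (T x), read as 1 when T x = 0, and
    [e] = f'(T x). *)
Lemma ext_map_binvertible x : nm x < 1 -> binvertible (fd ext_map x).
Proof.
move=> x1; have z1 := le_lt_trans (nT x) x1.
have [d dd [_ AE]] := ext_map_fd x1; have kd := ext_quot_der_eq z1 dd.
set k : R[i] := ext_scalar x; set e : R[i] := k + T x * d.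
have k0 : k != 0 by apply: ext_quot_neq0.
have e0 : e != 0 by rewrite /e /k /ext_scalar kd ext_fun1_neq0.
have [S SE] : exists S : 'L(X, X), forall w, S w = k^-1 *: w - ((T w : R[i]) * (d / (k * e))) *: x.
  apply: blin_mk => [a u v|]; first by rewrite blinD blinZ -[a *: T u]/(a * T u : R[i]); module.
  exists (nm (k^-1 : C) + nm T * nm (d / (k * e) : C) * nm x + 1) => [|h].
    by rewrite ltr_pwDr// addr_ge0 ?nm_ge0// !mulr_ge0 ?nm_ge0.
  apply: le_trans (nmB _ _) _; rewrite 2!nmZ nmM.
  have := ler_wpM2r (nm_ge0 x) (ler_wpM2r (nm_ge0 (d / (k * e) : C)) (blin_apply T h)).
  by have := nm_ge0 h; lra.
exists S; split=> h.
  rewrite SE AE -/k blinD !blinZ -![_ *: T _]/((_ : R[i]) * _).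
  rewrite scalerDr !scalerA mulVf// scale1r -addrA -scalerBl.
  have -> : k^-1 * (T h * d) - (k * T h + T h * d * T x) * (d / (k * e)) = 0.
    by rewrite /e; field; rewrite e0 k0.
  by rewrite scale0r addr0.
rewrite AE SE -/k blinB !blinZ -![_ *: T _]/((_ : R[i]) * _).
rewrite scalerBr !scalerA mulfV// scale1r -addrA addrC -scaleNr -scalerDl.
have -> : - (k * (T h * (d / (k * e)))) + (k^-1 * T h - T h * (d / (k * e)) * T x) * d = 0.
  by rewrite /e; field; rewrite e0 k0.
by rewrite scale0r add0r.
Qed.

(** All vectors in the defining inequality of the class are multiples of [x], so an arbitrary
    support functional [T'] at [x] enters only through T' x = |x|, and the inequality becomes the
    one for f at T x. *)
Lemma ext_map_admissible : admissible lam ext_scalar ext_map x0 T.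
Proof.
have n00 : nm (0 : X) < 1 by rewrite nm0.
split=> //.
- move=> x /unit_ballE/ext_scalar_dif[d _ [A dA _]]; exact: (dif_differentiable dA).1.
- by rewrite /ext_scalar (linear0 T) /ext_quot eqxx.
split.
- split; first by rewrite /ext_map scaler0.
  move=> v; have [d _ [_ E]] := ext_map_fd n00.
  rewrite -[LHS]/(fd ext_map 0 v) E scaler0 addr0 /ext_scalar (linear0 T) /ext_quot eqxx.
  exact: scale1r.
- split; first exact: ext_map_holomorphic.
  by move=> x /unit_ballE; exact: ext_map_binvertible.
move=> x T' /unit_ballE x1 xn [T'x _].
set z := T x; have z1 : nm z < 1 := le_lt_trans (nT x) x1.
have f1n : fext 1 z != 0 by exact: ext_fun1_neq0.
rewrite ext_map_diag2// -[mlin_diag x (frechet 1 ext_map x)]/(fd ext_map x x) ext_map_fd_radial// -/z -scalerDl.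
rewrite -[binv _]/(binv (fd ext_map x)).
have [B BE] : exists B, B = fd ext_map x by exists (fd ext_map x).
have Bx : B x = (fext 1 z : R[i]) *: x by rewrite BE ext_map_fd_radial.
rewrite -BE.
have bx : binv B x = (fext 1 z : R[i])^-1 *: x.
  rewrite -[in LHS](scale1r x) -(mulVf f1n) -scalerA -Bx -blinZ binvK// BE.
  exact: ext_map_binvertible.
rewrite (blinZ (binv _)) bx !blinZ T'x.
have nx : `|x| != 0 by rewrite normr_eq0.
apply: le_trans (ext_fun_Re lam_itv z1) _; rewrite le_eqVlt; apply/orP; left; apply/eqP; congr complex.Re.
by rewrite -![_ *: _]/((_ : R[i]) * _) /fext in f1n *; field; rewrite nx f1n.
Qed.

Lemma ext_map_coef n : coefA ext_map x0 T n = (n`!)%:R^-1 * ext_fun lam n 0.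
Proof.
have E m (z : C) : nm z < 1 -> tslice ext_map x0 T m z = fext m z.
  elim: m z => [|m IH] z z1.
    rewrite /tslice /slice /= /ext_map /ext_scalar !blinZ Tx0 -![_ *: _]/((_ : R[i]) * _).
    by rewrite !mulr1 mulrC ext_quotE.
  have H1 := der_tslice ext_map_holomorphic nx0 T m z1.
  have H2 : der (tslice ext_map x0 T m) z (fext m.+1 z).
    apply: dif_ext (der_ext_fun lam_itv m z1).
    exists (1 - nm z) => [|h h1]; first by rewrite subr_gt0.
    by rewrite IH//; apply: le_lt_trans (nmD _ _) _; lra.
  have Z (e : C) (a : R[i]) (h : C) : (a *: h : R[i]) *: e = a *: ((h : R[i]) *: e) by rewrite scalerA.
  by have := dif_unique (Z _) (Z _) H1 H2 (1 : C); rewrite !scale1r.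
have := E n 0; rewrite nm0 ltr01 => /(_ isT); rewrite /coefA /fext => <-.
by rewrite /tslice /slice scale0r.
Qed.

End ExtremalMap.

Theorem theorem4p1 (R : realType) (X : completeNormedModType R[i])
  (X_neq0 : exists x : X, x != 0) (lam : R) (lam_itv : 2^-1 <= lam <= 1) :
  [/\ forall (g : X -> R[i]^o) (F : X -> X) (x0 : X) (T : 'L(X, R[i]^o)),
        admissible lam g F x0 T ->
        `|T31 F x0 T| <= ((4 + 3 * lam + 2 * lam ^+ 2) *
                          (7 + 6 * lam + 8 * lam ^+ 2) / 18)%:C /\
        `|T32 F x0 T| <= (864^-1 * (1 + 2 * lam) ^+ 3 *
                          (9 + 5 * lam + 2 * lam ^+ 2) *
                          (25 + 17 * lam + 10 * lam ^+ 2))%:C,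
      exists (g : X -> R[i]^o) (F : X -> X) (x0 : X) (T : 'L(X, R[i]^o)),
        admissible lam g F x0 T /\
        `|T31 F x0 T| = ((4 + 3 * lam + 2 * lam ^+ 2) *
                         (7 + 6 * lam + 8 * lam ^+ 2) / 18)%:C &
      exists (g : X -> R[i]^o) (F : X -> X) (x0 : X) (T : 'L(X, R[i]^o)),
        admissible lam g F x0 T /\
        `|T32 F x0 T| = (864^-1 * (1 + 2 * lam) ^+ 3 *
                         (9 + 5 * lam + 2 * lam ^+ 2) *
                         (25 + 17 * lam + 10 * lam ^+ 2))%:C].
Proof.
have [x0 [T [x01 Ts]]] := norming_functional X_neq0.
have A := ext_map_admissible lam_itv x01 Ts.
have nE (z : R[i]) (b : R) : nm (z : R[i]^o) = b -> `|z| = b%:C by rewrite -cnmE => ->.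
split.
- move=> g F y S /(admissible_bounds lam_itv)[h1 h2].
  by rewrite -!cnmE !lecR.
- exists (ext_scalar lam T), (ext_map lam T), x0, T; split=> //; apply: nE.
  by rewrite /T31 !(ext_map_coef lam_itv x01 Ts); exact: ext_T31.
- exists (ext_scalar lam T), (ext_map lam T), x0, T; split=> //; apply: nE.
  by rewrite /T32 !(ext_map_coef lam_itv x01 Ts); exact: ext_T32.
Qed.
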